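(* Let $H=H_+\oplus H_-$ be a polarized complex Hilbert space, let $F_{\mathbf r}(H)$ be the Hilbert--Schmidt flag manifold of type $\mathbf r=(r_1,\dots,r_n)$ with distinguished indices $k,l$ (the subspaces $E_k=W_{\mathrm{in}}$ and $E_l=W_{\mathrm{out}}$ being infinite-dimensional), let $\sigma\subset\{1,\dots,n\}$ be a subset such that $k\in\sigma$ and $l\notin\sigma$, and set $r=\sum_{i\in\sigma}r_i$. Provide $F_{\mathbf r}(H)$ with the almost complex structure $\mathcal J^2_\sigma$. Then the map $$\pi_\sigma:F_{\mathbf r}(H)\longrightarrow G_r(H),\qquad (E_1,\dots,E_n)\longmapsto\bigoplus_{i\in\sigma}E_i,$$ is a twistor bundle, i.e. for every Riemann surface $M$ and every $\mathcal J^2_\sigma$-holomorphic map $\psi:M\to F_{\mathbf r}(H)$, the projection $\varphi=\pi_\sigma\circ\psi:M\to G_r(H)$ is harmonic.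
   Context: **Hilbert--Schmidt Grassmannian.** $H$ is a complex Hilbert space with a polarization, i.e. a direct orthogonal decomposition $H=H_+\oplus H_-$ into closed infinite-dimensional subspaces; $\mathrm{pr}_\pm$ denotes the orthogonal projection to $H_\pm$. The Hilbert--Schmidt Grassmannian $\mathrm{Gr}_{\mathrm{HS}}(H)$ is the set of closed subspaces $W\subset H$ such that $\mathrm{pr}_+:W\to H_+$ is a Fredholm operator and $\mathrm{pr}_-:W\to H_-$ is a Hilbert--Schmidt operator. The virtual dimension of $W$ is the index of $\mathrm{pr}_+:W\to H_+$. $G_r(H)$ denotes the connected component of $\mathrm{Gr}_{\mathrm{HS}}(H)$ consisting of subspaces of virtual dimension $r\in\mathbb Z$. Let $\mathrm U_{\mathrm{HS}}(H)$ be the group of unitary operators in $H$ whose off-diagonal blocks $H_\mp\to H_\pm$ are Hilbert--Schmidt. $\mathrm{Gr}_{\mathrm{HS}}(H)=\mathrm U_{\mathrm{HS}}(H)/(\mathrm U(H_+)\times \mathrm U(H_-))$ is a Kähler Hilbert manifold: its tangent space at $H_+$ is the space of Hilbert--Schmidt operators $\mathrm{HS}(H_+,H_-)$, and it carries the $\mathrm U_{\mathrm{HS}}(H)$-invariant Riemannian metric given at $H_+$ by $(A,B)\mapsto \mathrm{Re}\,\mathrm{tr}(AB^\dagger)$. **Harmonic maps.** A smooth map $\varphi:M\to G_r(H)$ from a Riemann surface is harmonic if it is extremal for the energy functional $E(\varphi)=\frac12\int_M|d\varphi|^2\,\mathrm{vol}$ with respect to all smooth variations with compact support; equivalently, in a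 local complex coordinate $z$ on $M$, $\nabla_{\partial/\partial\bar z}\big(\varphi_*(\partial/\partial z)\big)=0$, where $\nabla$ is induced by the Levi-Civita connection of the $\mathrm U_{\mathrm{HS}}(H)$-invariant Riemannian metric on $\mathrm{Gr}_{\mathrm{HS}}(H)$ given at $H_+$ by $(A,B)\mapsto \mathrm{Re}\,\mathrm{tr}(AB^\dagger)$, $A,B\in\mathrm{HS}(H_+,H_-)$. In terms of the subbundle $E\subset M\times H$ with fibre $E_p=\varphi(p)$, and $\pi,\pi^\perp$ the orthogonal projections of $M\times H$ onto $E$, $E^\perp$, this is equivalent to $$A'_E\circ\partial''_E=\partial''_{E^\perp}\circ A'_E,\qquad A'_E=\pi^\perp\circ\tfrac{\partial}{\partial z}\circ\pi,\quad \partial''_E=\pi\circ\tfrac{\partial}{\partial\bar z}\circ\pi,\quad \partial''_{E^\perp}=\pi^\perp\circ\tfrac{\partial}{\partial\bar z}\circ\pi^\perp .$$ **Hilbert--Schmidt flag manifold.** Fix an $n$-tuple of integers $\mathbf r=(r_1,\dots,r_n)$ and indices $1\le k<l\le n$, where $r_i>0$ for $i\ne k,l$. $F_{\mathbf r}(H)$ is the set of $n$-tuples $\mathcal E=(E_1,\dots,E_n)$ of pairwise orthogonal closed subspaces of $H$ with $E_1\oplus\dots\oplus E_n=H$ such that: (1) $E_k=W_{\mathrm{in}}$ is infinite-dimensional, $\mathrm{pr}_+:W_{\mathrm{in}}\to H_+$ is Fredholm of index $r_k$ and $\mathrm{pr}_-:W_{\mathrm{in}}\to H_-$ is Hilbert--Schmidt;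 (2) $E_l=W_{\mathrm{out}}$ is infinite-dimensional, $\mathrm{pr}_-:W_{\mathrm{out}}\to H_-$ is Fredholm of index $r_l$ and $\mathrm{pr}_+:W_{\mathrm{out}}\to H_+$ is Hilbert--Schmidt; (3) $\dim E_i=r_i$ for $i\neq k,l$. The complexified tangent space at $\mathcal E$ is $$T^{\mathbb C}_{\mathcal E}F_{\mathbf r}(H)\cong\bigoplus_{1\le i<j\le n}\big[\overline E_iE_j\oplus\overline E_jE_i\big],$$ where $\overline E_iE_j=\overline{E_i}\otimes E_j$ denotes the space of Hilbert--Schmidt operators $E_i\to E_j$. **The almost complex structure $\mathcal J^2_\sigma$.** For a subset $\sigma\subset\{1,\dots,n\}$, $\mathcal J^2_\sigma$ is the almost complex structure on $F_{\mathbf r}(H)$ whose $(1,0)$-part in the summand indexed by $i<j$ is $\overline E_jE_i$ if $i,j\in\sigma$ or $i,j\notin\sigma$, and is $\overline E_iE_j$ if exactly one of $i,j$ lies in $\sigma$. A smooth map $\psi:M\to F_{\mathbf r}(H)$ is $\mathcal J^2_\sigma$-holomorphic if its differential intertwines the complex structure of $M$ with $\mathcal J^2_\sigma$. Writing $\psi(p)=(E_{1,p},\dots,E_{n,p})$, letting $\pi_i:M\times H\to E_i$ be the orthogonal projections and $A'_{ij}=\pi_i\circ\frac{\partial}{\partial z}\circ\pi_j$, $A''_{ij}=\pi_i\circ\frac{\partial}{\partial\bar z}\circ\pi_j$ (so $A''_{ij}=-(A'_{ji})^*$ for $i\neq j$), this means: $A'_{ij}=0=A''_{ji}$ whenever either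 $i>j$ and ($i,j\in\sigma$ or $i,j\notin\sigma$), or $i<j$ and exactly one of $i,j$ lies in $\sigma$. *)

(* Defs.v *)
From HB Require Import structures.
From mathcomp Require Import all_boot all_order all_algebra.
From mathcomp Require Import all_classical all_reals all_analysis.
From mathcomp Require Import complex ring lra.

Set Implicit Arguments.
Unset Strict Implicit.
Unset Printing Implicit Defensive.

Import Order.TTheory GRing.Theory Num.Theory.
Import numFieldNormedType.Exports.

Local Open Scope classical_set_scope.
Local Open Scope ring_scope.
Local Open Scope complex_scope.

Section HilbertSchmidt.
Context {R : realType} {H : lmodType R[i]}.
Variable ip : {dot H for Num.conj}.

(* The square of the Hilbert-Schmidt norm of T : W -> H, that is the trace of
   T T^dagger.  It is the sum of the |T e|^2 over any orthonormal basis of W,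
   which is the supremum of these sums over the finite orthonormal families
   of W; the supremum makes sense without choosing a basis. *)
Definition hs_sq (W : set H) (T : H -> H) : \bar R :=
  ereal_sup [set (\sum_(e <- s) complex.Re (ip (T e) (T e)))%:E
            | s in [set s : seq H | orthonormal ip s
                                  /\ forall e, e \in s -> W e]].

Definition hs_op (T : H -> H) : Prop :=
  linear T /\ (hs_sq setT T < +oo)%E.

Definition hs_pred : {pred H -> H} := fun T => `[<hs_op T>].

Lemma dot_ge0 (x : H) : 0 <= complex.Re (ip x x).
Proof. by have := dnorm_ge0 ip x; rewrite lecE => /andP[]. Qed.

Lemma hs_sq_ge0 W T : (0 <= hs_sq W T)%E.
Proof.
by apply: ereal_sup_ubound; exists [::] => //; rewrite big_nil.
Qed.

Lemma hs_sqP W T (a : R) : 0 <= a ->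
  (hs_sq W T <= (a ^+ 2)%:E)%E <->
  forall s, orthonormal ip s -> (forall e, e \in s -> W e) ->
    \sum_(e <- s) complex.Re (ip (T e) (T e)) <= a ^+ 2.
Proof.
move=> a0; split=> [le s os sW|le].
  by rewrite -lee_fin; apply: le_trans le; apply: ereal_sup_ubound; exists s.
by apply: ge_ereal_sup => _ [s [os sW] <-]; rewrite lee_fin; exact: le.
Qed.

Definition hs_nrm (T : H -> H) : R := Num.sqrt (fine (hs_sq setT T)).

Lemma hs_nrm_ge0 T : 0 <= hs_nrm T. Proof. exact: sqrtr_ge0. Qed.

Lemma hs_nrm2 T : hs_op T -> hs_sq setT T = (hs_nrm T ^+ 2)%:E.
Proof.
move=> [_ fT]; rewrite sqr_sqrtr ?fineK ?fine_ge0 ?hs_sq_ge0//.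
by rewrite ge0_fin_numE ?hs_sq_ge0.
Qed.

Lemma hs_nrm_le T (a : R) : hs_op T -> 0 <= a ->
  (hs_sq setT T <= (a ^+ 2)%:E)%E -> hs_nrm T <= a.
Proof.
by move=> hT a0; rewrite (hs_nrm2 hT) lee_fin ler_pXn2r// nnegrE hs_nrm_ge0.
Qed.

Lemma sum_hs_le T s : hs_op T -> orthonormal ip s ->
  \sum_(e <- s) complex.Re (ip (T e) (T e)) <= hs_nrm T ^+ 2.
Proof.
move=> hT os; have := lexx (hs_sq setT T); rewrite {2}(hs_nrm2 hT).
by move/(hs_sqP _ _ (hs_nrm_ge0 T)); apply.
Qed.

Lemma Re_dotD (u v : H) (a b : R) : 0 < a -> 0 < b ->
  complex.Re (ip (u + v) (u + v)) <=
  (1 + b / a) * complex.Re (ip u u) + (1 + a / b) * complex.Re (ip v v).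
Proof.
move=> a0 b0; set k := Num.sqrt (b / a).
have ba0 : 0 < b / a by rewrite divr_gt0.
have k0 : 0 < k by rewrite sqrtr_gt0.
have k2 : k ^+ 2 = b / a by rewrite sqr_sqrtr// ltW.
have kV2 : k^-1 ^+ 2 = a / b by rewrite exprVn k2 invf_div.
have ReD (x y : R[i]) : complex.Re (x + y) = complex.Re x + complex.Re y.
  by case: x y => ? ? [].
have ReZ (c : R) (x : R[i]) : complex.Re (c%:C * x) = c * complex.Re x.
  by case: x => ? ? /=; rewrite mul0r subr0.
have ReN (x : R[i]) : complex.Re (- x) = - complex.Re x by case: x.
have ReJ (x : R[i]) : complex.Re (Num.conj x) = complex.Re x by case: x.
have nrmZ (c : R) (w : H) : 0 < c ->
    complex.Re (ip (c%:C *: w) (c%:C *: w)) = c ^+ 2 * complex.Re (ip w w).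
  by move=> c0; rewrite dnormZ ger0_norm ?lecR ?ltW// -rmorphXn ReZ.
have kJ : Num.conj (k^-1)%:C = (k^-1)%:C :> R[i].
  exact: conjc_real.
have kk : k%:C * (k^-1)%:C = 1 :> R[i].
  by rewrite -rmorphM/= mulfV ?gt_eqF.
have d : ip (k%:C *: u) ((k^-1)%:C *: v) = ip u v.
  by rewrite linearZr_LR linearZl_LR /= kJ mulrCA mulrA kk mul1r.
have := dot_ge0 (k%:C *: u - (k^-1)%:C *: v).
rewrite dnormB dnormD !(ReD, ReN, ReJ) !nrmZ ?invr_gt0// k2 kV2.
rewrite d.
by move=> h; rewrite !mulrDl !mul1r; lra.
Qed.

Lemma hs_nrmD T U : hs_op T -> hs_op U ->
  hs_op (T \+ U) /\ hs_nrm (T \+ U) <= hs_nrm T + hs_nrm U.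
Proof.
move=> hT hU.
have lTU : linear (T \+ U).
  by move=> a x y /=; rewrite hT.1 hU.1 scalerDr addrACA.
have bound (a b : R) : hs_nrm T <= a -> hs_nrm U <= b -> 0 < a -> 0 < b ->
    (hs_sq setT (T \+ U)%R <= ((a + b) ^+ 2)%:E)%E.
  move=> Ta Ub a0 b0; apply/hs_sqP; first by rewrite addr_ge0 ?ltW.
  move=> s os _.
  have sT : \sum_(e <- s) complex.Re (ip (T e) (T e)) <= a ^+ 2.
    by rewrite (le_trans (sum_hs_le hT os))// lerXn2r// nnegrE ?hs_nrm_ge0 ?ltW.
  have sU : \sum_(e <- s) complex.Re (ip (U e) (U e)) <= b ^+ 2.
    by rewrite (le_trans (sum_hs_le hU os))// lerXn2r// nnegrE ?hs_nrm_ge0 ?ltW.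
  have ba : 0 <= 1 + b / a by rewrite addr_ge0 ?divr_ge0 ?ltW.
  have ab : 0 <= 1 + a / b by rewrite addr_ge0 ?divr_ge0 ?ltW.
  apply: (@le_trans _ _ (\sum_(e <- s) ((1 + b / a) * complex.Re (ip (T e) (T e))
        + (1 + a / b) * complex.Re (ip (U e) (U e))))).
    by apply: ler_sum => e _; exact: Re_dotD.
  rewrite big_split/= -!mulr_sumr.
  apply: (le_trans (lerD (ler_wpM2l ba sT) (ler_wpM2l ab sU))).
  rewrite le_eqVlt; apply/orP; left; apply/eqP; field.
  by rewrite !gt_eqF.
have hTU : hs_op (T \+ U).
  split=> //; apply: le_lt_trans (ltry _).
  apply: (bound (hs_nrm T + 1) (hs_nrm U + 1));
    rewrite ?lerDl ?ler01//; apply: ltr_wpDl => //; exact: hs_nrm_ge0.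
split=> //; apply/ler_addgt0Pr => e e0.
apply: hs_nrm_le => //; first by rewrite !addr_ge0 ?hs_nrm_ge0 ?ltW.
have -> : hs_nrm T + hs_nrm U + e = (hs_nrm T + e / 2) + (hs_nrm U + e / 2).
  by rewrite addrACA -splitr.
have e2 : 0 < e / 2 by rewrite divr_gt0.
by apply: bound; rewrite ?lerDl ?ltW//; apply: ltr_wpDl => //; exact: hs_nrm_ge0.
Qed.

Lemma hs_nrmZ_le (c : R) T : hs_op T ->
  hs_op (fun x => c%:C *: T x) /\
  hs_nrm (fun x => c%:C *: T x) <= `|c| * hs_nrm T.
Proof.
move=> hT.
have le : (hs_sq setT (fun x => c%:C *: T x)%R <= ((`|c| * hs_nrm T) ^+ 2)%:E)%E.
  apply/hs_sqP; first by rewrite mulr_ge0 ?hs_nrm_ge0.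
  move=> s os _; rewrite exprMn.
  apply: le_trans (ler_wpM2l _ (sum_hs_le hT os)); last exact: sqr_ge0.
  rewrite mulr_sumr; apply: ler_sum => e _.
  rewrite dnormZ normc_def/= expr0n/= addr0 sqrtr_sqr -rmorphXn/=.
  by case: (ip _ _) => ? ? /=; rewrite mul0r subr0.
have h : hs_op (fun x => c%:C *: T x).
  split; last exact: le_lt_trans le (ltry _).
  by move=> a x y /=; rewrite hT.1 scalerDr !scalerA mulrC.
by split=> //; apply: hs_nrm_le => //; rewrite mulr_ge0 ?hs_nrm_ge0.
Qed.

Lemma hs_op0 : hs_op (fun=> 0).
Proof.
split; first by move=> a x y; rewrite scaler0 addr0.
apply: le_lt_trans (ltry (0 ^+ 2)); apply/hs_sqP => // s _ _.
by rewrite big1 ?expr0n// => e _; rewrite linear0l.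
Qed.

Lemma hs_nrm_eq0 T : hs_op T -> hs_nrm T = 0 -> T = fun=> 0.
Proof.
move=> hT T0; apply/funext => x; have [->|x0] := eqVneq x 0.
  by have := hT.1 (-1) 0 0; rewrite scaler0 addr0 scaleN1r addNr.
pose a := sqrtC (ip x x).
have a0 : a != 0 by rewrite sqrt_dnorm_eq0.
have aa : ip (a^-1 *: x) (a^-1 *: x) = 1.
  rewrite dnormZ ger0_norm ?invr_ge0 ?sqrt_dnorm_ge0// exprVn sqrtCK mulVf//.
  by rewrite dnorm_eq0.
have o1 : orthonormal ip [:: a^-1 *: x].
  apply/orthonormalP; split=> // u v; rewrite !inE => /eqP -> /eqP ->.
  by rewrite eqxx aa.
have := sum_hs_le hT o1; rewrite T0 expr0n big_seq1/= => le0.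
have : ip (T (a^-1 *: x)) (T (a^-1 *: x)) == 0.
  rewrite eq_le dnorm_ge0 andbT lecE/= le0 andbT.
  by have := dnorm_ge0 ip (T (a^-1 *: x)); rewrite lecE => /andP[/eqP ->].
rewrite dnorm_eq0 => /eqP Tx.
have T00 : T 0 = 0.
  by have := hT.1 (-1) 0 0; rewrite scaler0 addr0 scaleN1r addNr.
have := hT.1 a (a^-1 *: x) 0.
by rewrite addr0 scalerA divff// scale1r Tx T00 scaler0 addr0.
Qed.

End HilbertSchmidt.

Section HSType.
Context {R : realType} {H : lmodType R[i]}.
Variable ip : {dot H for Num.conj}.

Lemma hs_predP (T : H -> H) : reflect (hs_op ip T) (T \in hs_pred ip).
Proof. exact: asboolP. Qed.

Lemma hs_pred_closed : zmod_closed (hs_pred ip).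
Proof.
split; first exact/hs_predP/hs_op0.
move=> T U /hs_predP hT /hs_predP hU; apply/hs_predP.
have [hN _] := hs_nrmZ_le (-1) hU.
have -> : T - U = T \+ (fun x => (-1)%:C *: U x).
  by apply/funext => x /=; rewrite rmorphN scaleN1r.
by have [] := hs_nrmD hT hN.
Qed.

HB.instance Definition _ :=
  GRing.isZmodClosed.Build (H -> H) (hs_pred ip) hs_pred_closed.

Record hs := HSOp { hs_fun :> H -> H ; hs_funP : hs_fun \in hs_pred ip }.

HB.instance Definition _ := [isSub for hs_fun].
HB.instance Definition _ := [Choice of hs by <:].
HB.instance Definition _ := [SubChoice_isSubZmodule of hs by <:].

Lemma hs_funK (T : hs) : hs_op ip T. Proof. exact/hs_predP/hs_funP. Qed.

Lemma hs_scale_subproof (c : R) (T : hs) :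
  (fun x => c%:C *: T x) \in hs_pred ip.
Proof. by apply/hs_predP; have [] := hs_nrmZ_le c (hs_funK T). Qed.

Definition hs_scale (c : R) (T : hs) : hs := HSOp (hs_scale_subproof c T).

Lemma hs_scaleA a b T : hs_scale a (hs_scale b T) = hs_scale (a * b) T.
Proof. by apply/val_inj/funext => x /=; rewrite scalerA rmorphM. Qed.
Lemma hs_scale1 : left_id 1 hs_scale.
Proof. by move=> T; apply/val_inj/funext => x /=; rewrite scale1r. Qed.
Lemma hs_scaleDr : right_distributive hs_scale +%R.
Proof. by move=> a T U; apply/val_inj/funext => x /=; rewrite scalerDr. Qed.
Lemma hs_scaleDl T : {morph hs_scale^~ T : a b / a + b}.
Proof. by move=> a b; apply/val_inj/funext => x /=; rewrite rmorphD scalerDl. Qed.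

HB.instance Definition _ := GRing.Zmodule_isLmodule.Build R hs
  hs_scaleA hs_scale1 hs_scaleDr hs_scaleDl.

Definition hs_norm (T : hs) : R := hs_nrm ip T.

Lemma hs_normD T U : hs_norm (T + U) <= hs_norm T + hs_norm U.
Proof. by have [] := hs_nrmD (hs_funK T) (hs_funK U). Qed.

Lemma hs_normZ (c : R) T : hs_norm (c *: T) = `|c| * hs_norm T.
Proof.
apply/eqP; rewrite eq_le; apply/andP; split.
  by have [] := hs_nrmZ_le c (hs_funK T).
have [->|c0] := eqVneq c 0; first by rewrite normr0 mul0r hs_nrm_ge0.
have [_] := hs_nrmZ_le c^-1 (hs_funK (c *: T)).
rewrite normfV mulrC ler_pdivlMr ?normr_gt0// mulrC.
suff -> : (fun x => c^-1%:C *: (c *: T : hs) x) = T by [].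
apply/funext => x; rewrite [X in _ *: X]/= scalerA -rmorphM/= mulVf//.
by rewrite scale1r.
Qed.

Lemma hs_norm_eq0 T : hs_norm T = 0 -> T = 0.
Proof. by move=> T0; apply/val_inj; exact: (hs_nrm_eq0 (hs_funK T)). Qed.

HB.instance Definition _ := Lmodule_isNormed.Build R hs
  hs_normD hs_normZ hs_norm_eq0.

Definition to_hs (T : H -> H) : hs := insubd 0 T.

End HSType.

(* C^infinity on the open set O: the iterated directional derivatives of every
   order exist and are continuous on O. *)
Definition smooth_on {R : realType} {V W : normedModType R}
    (O : set V) (f : V -> W) : Prop :=
  exists S : set (V -> W), S f /\ forall g, S g ->
    (forall x, O x -> {for x, continuous g}) /\
    (forall v, S ('D_v g) /\ forall x, O x -> derivable g x v).

Section Grassmannian.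
Context {R : realType} {H : completeNormedModType R[i]}.
Variable ip : {dot H for Num.conj}.

Definition closed_subspace (W : set H) : Prop :=
  [/\ closed W, W 0 & forall (a : R[i]) x y, W x -> W y -> W (a *: x + y)].

Definition orthogonal_sets (U W : set H) : Prop :=
  forall x y, U x -> W y -> ip x y = 0.

Definition oproj (W : set H) (x : H) : H :=
  get [set y | W y /\ forall w, W w -> ip (x - y) w = 0].

(* dim (V / U) = m, for subspaces U <= V *)
Definition quot_dim (V U : set H) (m : nat) : Prop :=
  exists b : 'I_m -> H,
    [/\ forall i, V (b i),
        forall a : 'I_m -> R[i], U (\sum_i a i *: b i) -> forall i, a i = 0 &
        forall x, V x -> exists a : 'I_m -> R[i], U (x - \sum_i a i *: b i)].

Definition has_dim (W : set H) (m : nat) : Prop := quot_dim W [set 0] m.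

Definition infinite_dim (W : set H) : Prop := forall m, ~ has_dim W m.

(* T : W -> V is Fredholm of index d.  A bounded operator between Hilbert
   spaces whose range has finite codimension has closed range. *)
Definition fredholm (W V : set H) (T : H -> H) (d : int) : Prop :=
  exists a b : nat, [/\ has_dim (W `&` [set x | T x = 0]) a,
                        quot_dim V (T @` W) b & d = a%:Z - b%:Z].

Definition polarization (Hp Hm : set H) : Prop :=
  [/\ closed_subspace Hp /\ infinite_dim Hp,
      closed_subspace Hm /\ infinite_dim Hm,
      orthogonal_sets Hp Hm &
      forall x, exists y z, [/\ Hp y, Hm z & x = y + z]].

Variables Hp Hm : set H.

(* W belongs to the component G_d(H) of the Hilbert-Schmidt Grassmannian,
   i.e. it has virtual dimension d. *)
Definition grassmannian (d : int) (W : set H) : Prop :=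
  [/\ closed_subspace W, fredholm W Hp (oproj Hp) d &
      (hs_sq ip W (oproj Hm) < +oo)%E].

(* The manifold structure of the Grassmannian is the one for which
   W |-> pr_W - pr_+ is an embedding into the Hilbert space of Hilbert-Schmidt
   operators. *)
Definition gr_embed (W : set H) : hs ip :=
  to_hs ip (fun x => oproj W x - oproj Hp x).

(* phi, defined on the open subset O of a parameter space V, is a smooth map
   into G_d(H).  The second clause holds for all elements of the
   Grassmannian: to_hs does not truncate. *)
Definition gr_smooth {V : normedModType R} (d : int) (O : set V)
    (phi : V -> set H) : Prop :=
  [/\ forall v, O v -> grassmannian d (phi v),
      forall v, O v -> hs_op ip (fun x => oproj (phi v) x - oproj Hp x) &
      smooth_on O (fun v => gr_embed (phi v))].

(* The differential d(phi)_v(e), as an element of HS(W, W^perp), W = phi v;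
   a curve of graphs of operators t A + o(t) : W -> W^perp has velocity A. *)
Definition gr_diff {V : normedModType R} (phi : V -> set H) (v e : V)
    (x : H) : H :=
  let y := ('D_e (fun u => gr_embed (phi u)) v : hs ip) (oproj (phi v) x) in
  y - oproj (phi v) y.

(* The squared length of that tangent vector for the invariant metric
   (A, B) |-> Re tr (A B^dagger). *)
Definition gr_speed2 {V : normedModType R} (phi : V -> set H) (v e : V) : R :=
  fine (hs_sq ip (phi v) (gr_diff phi v e)).

End Grassmannian.

Definition holomorphic_on {R : realType} (O : set R[i]) (h : R[i] -> R[i]) :=
  forall z, O z -> derivable (h : R[i]^o -> R[i]^o) z 1 /\
    (* automatic on open sets, by Goursat's theorem *)
    {for z, continuous ('D_1 (h : R[i]^o -> R[i]^o))}.

Record riemann_surface (R : realType) (M : ptopologicalType) := RiemannSurface {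
  chart : Type;
  chart_dom : chart -> set M;
  chart_coord : chart -> M -> R[i];
  chart_inv : chart -> R[i] -> M;
  chart_at : M -> chart;
  rs_hausdorff : hausdorff_space M;
  rs_connected : connected [set: M];
  rs_cover : forall p, chart_dom (chart_at p) p;
  rs_open_dom : forall c, open (chart_dom c);
  rs_open_img : forall c, open (chart_coord c @` chart_dom c : set R[i]^o);
  rs_coordK : forall c p, chart_dom c p -> chart_inv c (chart_coord c p) = p;
  rs_coord_cont : forall c p, chart_dom c p ->
    {for p, continuous (chart_coord c : M -> R[i]^o)};
  rs_inv_cont : forall c z, (chart_coord c @` chart_dom c) z ->
    {for z, continuous (chart_inv c : R[i]^o -> M)};
  rs_transition : forall c c',
    holomorphic_on (chart_coord c @` (chart_dom c `&` chart_dom c'))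
      (chart_coord c' \o chart_inv c) }.

Section Surface.
Context {R : realType} {M : ptopologicalType}.
Variable S : riemann_surface R M.

(* Local real coordinates (x, y), where z = x + i y. *)
Definition xy (c : chart S) (p : M) : R * R :=
  (complex.Re (chart_coord c p), complex.Im (chart_coord c p)).
Definition of_xy (c : chart S) (v : R * R) : M := chart_inv c (v.1 +i* v.2).
Definition chart_img (c : chart S) : set (R * R) := xy c @` chart_dom c.

(* A Riemannian metric compatible with the complex structure, with its area
   measure: in the chart c it is conf_c (dx^2 + dy^2), with area element
   conf_c dx dy. *)
Record conformal_metric := ConformalMetric {
  conf : chart S -> R * R -> R;
  conf_gt0 : forall c v, chart_img c v -> 0 < conf c v;
  conf_smooth : forall c, smooth_on (chart_img c) (conf c : R * R -> R^o);
  conf_transition : forall c c' p, chart_dom c p -> chart_dom c' p ->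
    conf c (xy c p) = conf c' (xy c' p) *
      complex.Re `|'D_1 (chart_coord c' \o chart_inv c : R[i]^o -> R[i]^o)
                     (chart_coord c p)| ^+ 2;
  area : {measure set (g_sigma_algebraType (@open M)) -> \bar R};
  area_chart : forall c (B : set (measurableTypeR R * measurableTypeR R)),
    measurable B -> B `<=` chart_img c ->
    area (chart_dom c `&` xy c @^-1` B) =
    (\int[(@lebesgue_measure R \x @lebesgue_measure R)%E]_(v in B)
       (conf c v)%:E)%E }.

End Surface.

Section Harmonic.
Context {R : realType} {H : completeNormedModType R[i]}.
Variables (ip : {dot H for Num.conj}) (Hp Hm : set H) (d : int).
Context {M : ptopologicalType}.
Variable S : riemann_surface R M.

Definition gr_smooth_map (phi : M -> set H) : Prop :=
  forall c : chart S, gr_smooth ip Hp Hm d (chart_img c) (phi \o of_xy c).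

(* |d phi|^2 at p; the vectors (1, 0) and (0, 1) have square g-length conf. *)
Definition energy_density (g : conformal_metric S) (phi : M -> set H) (p : M) :
    R :=
  let c := chart_at S p in
  (gr_speed2 ip Hp (phi \o of_xy c) (xy c p) (1, 0)
   + gr_speed2 ip Hp (phi \o of_xy c) (xy c p) (0, 1)) / conf g c (xy c p).

(* The energy of phi over K; only the energy over compact sets is finite in
   general. *)
Definition energy (g : conformal_metric S) (K : set M) (phi : M -> set H) : R :=
  2^-1 * Rintegral (area g) K (energy_density g phi).

Definition variation (phi : M -> set H) (K : set M) (e : R)
    (Phi : R -> M -> set H) : Prop :=
  [/\ Phi 0 = phi,
      forall t p, `|t| < e -> ~ K p -> Phi t p = phi p &
      forall c : chart S,
        gr_smooth ip Hp Hm d [set w : R * (R * R) | `|w.1| < e /\ chart_img c w.2]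
                  (fun w : R * (R * R) => Phi w.1 (of_xy c w.2))].

(* phi is extremal for the energy with respect to the smooth variations with
   compact support; the density may be restricted to a compact K outside which
   the variation is constant. *)
Definition harmonic_map (phi : M -> set H) : Prop :=
  gr_smooth_map phi /\
  forall (g : conformal_metric S) (K : set M) (e : R) (Phi : R -> M -> set H),
    compact K -> 0 < e -> variation phi K e Phi ->
    is_derive (0 : R) (1 : R) (fun t : R => energy g K (Phi t) : R) 0.

End Harmonic.

Section Flags.
Context {R : realType} {H : completeNormedModType R[i]}.
Variables (ip : {dot H for Num.conj}) (Hp Hm : set H).
Variables (n : nat) (r : 'I_n -> int) (k l : 'I_n).

Definition flag (E : 'I_n -> set H) : Prop :=
  [/\ (forall i, closed_subspace (E i)) /\
        (forall i j, i != j -> orthogonal_sets ip (E i) (E j)),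
      forall x, exists u : 'I_n -> H, (forall i, E i (u i)) /\ x = \sum_i u i,
      [/\ infinite_dim (E k), fredholm (E k) Hp (oproj ip Hp) (r k) &
          (hs_sq ip (E k) (oproj ip Hm) < +oo)%E],
      [/\ infinite_dim (E l), fredholm (E l) Hm (oproj ip Hm) (r l) &
          (hs_sq ip (E l) (oproj ip Hp) < +oo)%E] &
      forall i, i != k -> i != l ->
        exists2 m : nat, r i = m%:Z & has_dim (E i) m].

(* As for the Grassmannian, the manifold structure is the one for which the
   differences with pr_+ (for E_k), pr_- (for E_l) and 0 (for the other E_i) of
   the projections form an embedding into a Hilbert space of n-tuples of
   Hilbert-Schmidt operators. *)
Definition flag_ref (i : 'I_n) : H -> H :=
  if i == k then oproj ip Hp else if i == l then oproj ip Hm else fun=> 0.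

Definition flag_embed (i : 'I_n) (W : set H) : hs ip :=
  to_hs ip (fun x => oproj ip W x - flag_ref i x).

Definition flag_smooth {V : normedModType R} (O : set V)
    (psi : V -> 'I_n -> set H) : Prop :=
  [/\ forall v, O v -> flag (psi v),
      forall v i, O v ->
        hs_op ip (fun x => oproj ip (psi v i) x - flag_ref i x) &
      forall i, smooth_on O (fun v => flag_embed i (psi v i))].

(* A tangent vector at E is identified with the operator xi of H with
   components pi_i xi pi_j in the spaces HS(E_j, E_i), i <> j; the component
   of the differential of psi in HS(E_j, E_i) is pi_i o d o pi_j. *)
Definition flag_diff {V : normedModType R} (psi : V -> 'I_n -> set H)
    (v e : V) (x : H) : H :=
  \sum_i \sum_(j | j != i)
    oproj ip (psi v i)
      (('D_e (fun u => flag_embed j (psi u j)) v : hs ip)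
         (oproj ip (psi v j) x)).

Variable sigma : {set 'I_n}.

(* HS(E_j, E_i) is of type (1,0) for J^2_sigma. *)
Definition J2_type10 (i j : 'I_n) : bool :=
  if (i \in sigma) == (j \in sigma) then (i < j)%N else (j < i)%N.

(* J^2_sigma at E; it is multiplication by i on the (1,0) components and by -i
   on the (0,1) components. *)
Definition J2 (E : 'I_n -> set H) (xi : H -> H) (x : H) : H :=
  \sum_i \sum_(j | j != i)
    (if J2_type10 i j then 0 +i* 1 else 0 -i* 1) *:
      oproj ip (E i) (xi (oproj ip (E j) x)).

Definition flag_smooth_map {M : ptopologicalType} (S : riemann_surface R M)
    (psi : M -> 'I_n -> set H) : Prop :=
  forall c : chart S, flag_smooth (chart_img c) (psi \o of_xy c).

Definition J2_holomorphic {M : ptopologicalType} (S : riemann_surface R M)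
    (psi : M -> 'I_n -> set H) : Prop :=
  flag_smooth_map S psi /\
  forall (c : chart S) (v : R * R), chart_img c v -> forall a b : R,
    (* i (a, b) = (- b, a) *)
    flag_diff (psi \o of_xy c) v (- b, a)
      = J2 ((psi \o of_xy c) v) (flag_diff (psi \o of_xy c) v (a, b)).

Definition pi_sigma (E : 'I_n -> set H) : set H :=
  [set x | exists2 u : 'I_n -> H, forall i, i \in sigma -> E i (u i)
                                & x = \sum_(i in sigma) u i].

End Flags.

(* Main.v *)
(* Let W be the sum of the E_i with i in sigma, and f = pr_W - pr_+, a map into
   the Hilbert space of Hilbert-Schmidt operators.  The energy density is
   |df|^2 / 4, and the velocity V of a variation is off-diagonal for
   H = W + W^perp, so that the first variation is half the integral of
   <df, dV> over the compact set.  In a chart this is a divergence minus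
   <Laplacian f, V>.  The J2 equations P_j f_y P_i = +-i P_j f_x P_i,
   differentiated once more, show that the off-diagonal blocks of the Laplacian
   vanish: the second derivatives cancel, and so do the quadratic terms, by the
   signs in the definition of J2.  The divergences integrate to zero after V is
   cut by C^1 bump functions into fields supported in squares of charts.
   That W has virtual dimension r is the additivity of the index, the
   finite-dimensional E_i being added one vector at a time. *)
Require Import Defs.
From HB Require Import structures.
From mathcomp Require Import all_boot all_order all_algebra.
From mathcomp Require Import all_classical all_reals all_analysis.
From mathcomp Require Import measurable_realfun.
From mathcomp Require Import complex ring lra zify.

Set Implicit Arguments.
Unset Strict Implicit.
Unset Printing Implicit Defensive.

Import Order.TTheory GRing.Theory Num.Theory.
Import numFieldNormedType.Exports.

Local Open Scope classical_set_scope.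
Local Open Scope ring_scope.
Local Open Scope complex_scope.

(** Harmonicity is defined through the energy, so no connection on the Grassmannian is constructed:
    only the component of the Laplacian along off-diagonal operators enters. Projections are in
    general not Hilbert-Schmidt, only their differences with fixed references are. Relations such as
    P P = P and P_i P_j = 0 are therefore differentiated in weak form, as real inner products of
    vectors. No orthonormal basis of H is chosen: the norm is a supremum over finite families, the
    inner product is its polarization, and orthogonality of operators comes from isometric
    symmetries, the reflections 1 - 2P. [smooth_on] speaks of directional derivatives only, so
    Schwarz's theorem and the chain rule for changes of charts are derived from mean values. One
    continuous derivative suffices for the bump functions, because a localized field enters only an
    integral identity and is no longer the velocity of a variation. *)

Section InnerProduct.
Context {R : realType} {H : lmodType R[i]}.
Variable ip : {dot H for Num.conj}.

Lemma ip_conj x y : ip x y = (ip y x)^*%C.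
Proof. by rewrite (hermC ip) expr0 mul1r. Qed.

Lemma ipZl a x y : ip (a *: x) y = a * ip x y.
Proof. exact: linearZl_LR. Qed.

Lemma ipZr a x y : ip x (a *: y) = a^*%C * ip x y.
Proof. exact: linearZr_LR. Qed.

Lemma ip_suml I (s : seq I) (S : pred I) (F : I -> H) z :
  ip (\sum_(i <- s | S i) F i) z = \sum_(i <- s | S i) ip (F i) z.
Proof. exact: linear_sumlz. Qed.

Lemma ip_sumr I (s : seq I) (S : pred I) (F : I -> H) z :
  ip z (\sum_(i <- s | S i) F i) = \sum_(i <- s | S i) ip z (F i).
Proof. exact: raddf_sum. Qed.

Lemma ipBl x y z : ip (x - y) z = ip x z - ip y z.
Proof. exact: linearBl. Qed.

Lemma ipBr x y z : ip z (x - y) = ip z x - ip z y.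
Proof. exact: raddfB. Qed.

Lemma ipDl x y z : ip (x + y) z = ip x z + ip y z.
Proof. exact: linearDl. Qed.

Lemma ipDr x y z : ip z (x + y) = ip z x + ip z y.
Proof. exact: raddfD. Qed.

Lemma ReD (x y : R[i]) : complex.Re (x + y) = complex.Re x + complex.Re y.
Proof. by case: x y => ? ? []. Qed.

Lemma ReN (x : R[i]) : complex.Re (- x) = - complex.Re x.
Proof. by case: x. Qed.

Lemma Re_sum I (s : seq I) (S : pred I) (F : I -> R[i]) :
  complex.Re (\sum_(i <- s | S i) F i) = \sum_(i <- s | S i) complex.Re (F i).
Proof. exact: (big_morph (@complex.Re R) ReD). Qed.

Lemma Re_conj (x : R[i]) : complex.Re (x^*%C) = complex.Re x.
Proof. by case: x. Qed.

Lemma Re_realM (c : R) (x : R[i]) : complex.Re (c%:C * x) = c * complex.Re x.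
Proof. by case: x => ? ? /=; rewrite mul0r subr0. Qed.

Lemma orthonormal_ip s u v : orthonormal ip s -> u \in s -> v \in s ->
  ip u v = (u == v)%:R.
Proof. by move=> /orthonormalP[_ h] us vs; rewrite h. Qed.

Lemma orthonormal_uniq s : orthonormal ip s -> uniq s.
Proof. by move=> /orthonormalP[]. Qed.

Lemma ip_sum_orthonormal s (c : H -> R[i]) v : orthonormal ip s -> v \in s ->
  ip (\sum_(e <- s) c e *: e) v = c v.
Proof.
move=> os vs; rewrite ip_suml (bigD1_seq v)//= ?orthonormal_uniq//.
rewrite ipZl (orthonormal_ip os)// eqxx mulr1 big_seq_cond big1 ?addr0//.
move=> e /andP[es ev]; rewrite ipZl (orthonormal_ip os)//.
by rewrite (negbTE ev) mulr0.
Qed.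

Lemma dnorm_sum_orthonormal s (c : H -> R[i]) : orthonormal ip s ->
  ip (\sum_(e <- s) c e *: e) (\sum_(e <- s) c e *: e) =
  \sum_(e <- s) c e * (c e)^*%C.
Proof.
move=> os; rewrite ip_sumr; apply: eq_big_seq => v vs.
by rewrite ipZr ip_sum_orthonormal// mulrC.
Qed.

Lemma bessel s x : orthonormal ip s ->
  \sum_(e <- s) ip x e * (ip x e)^*%C <= ip x x.
Proof.
move=> os; have := dnorm_ge0 ip (x - \sum_(e <- s) ip x e *: e).
set p := \sum_(e <- s) _; set q := \sum_(e <- s) _.
have xp : ip x p = q.
  by rewrite ip_sumr; apply: eq_bigr => e _; rewrite ipZr mulrC.
have qq : q^*%C = q.
  rewrite raddf_sum; apply: eq_bigr => e _ /=.
  by rewrite rmorphM /= conjcK mulrC.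
have px : ip p x = q by rewrite ip_conj xp.
have pp : ip p p = q by rewrite /p dnorm_sum_orthonormal.
rewrite ipBl !ipBr pp xp px.
by rewrite subrr subr0 subr_ge0.
Qed.

(** The span is recorded through the expansions of the vectors of [X], the form that [trace_le]
    consumes; [W] confines the family to a subspace, as [hs_sq] over [W] requires. *)
Lemma gram_schmidt (W : set H) (X : seq H) :
  W 0 -> (forall (a : R[i]) x y, W x -> W y -> W (a *: x + y)) ->
  (forall x, x \in X -> W x) ->
  exists f, [/\ orthonormal ip f, forall e, e \in f -> W e &
    forall x, x \in X -> x = \sum_(e <- f) ip x e *: e].
Proof.
move=> W0 WD; elim: X => [|x X IH] WX.
  by exists [::]; split=> //; apply/orthonormalP.
have [y yX|f [of_ fW fX]] := IH; first by apply: WX; rewrite inE yX orbT.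
pose p := \sum_(e <- f) ip x e *: e.
(* A vector already in the span of [f] adds no element, since its residue cannot be normalized. *)
have [xp0|xp0] := eqVneq (x - p) 0.
  exists f; split=> // y; rewrite inE => /orP[/eqP ->|/fX//].
  by apply/eqP; rewrite -subr_eq0; apply/eqP.
have WpP : W p.
  rewrite /p; have : {subset f <= f} by [].
  elim: {1 3}f => [|e f' IH'] sf; first by rewrite big_nil.
  rewrite big_cons; apply: (WD); first by apply: fW; apply: sf; rewrite inE eqxx.
  by apply: IH' => z zf; apply: sf; rewrite inE zf orbT.
have xpf v : v \in f -> ip (x - p) v = 0.
  by move=> vf; rewrite ipBl ip_sum_orthonormal// subrr.
pose a := sqrtC (ip (x - p) (x - p)).
have a0 : a != 0 by rewrite sqrt_dnorm_eq0.
pose u := a^-1 *: (x - p).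
have uu : ip u u = 1.
  rewrite dnormZ ger0_norm ?invr_ge0 ?sqrt_dnorm_ge0// exprVn sqrtCK mulVf//.
  by rewrite dnorm_eq0.
have uf v : v \in f -> ip u v = 0 by move=> vf; rewrite ipZl xpf// mulr0.
have fu v : v \in f -> ip v u = 0 by move=> vf; rewrite ip_conj uf// conjc0.
have unf : u \notin f.
  by apply/negP => /uf; rewrite uu => /eqP; rewrite oner_eq0.
exists (u :: f); split.
- apply/orthonormalP; split; first by rewrite /= unf orthonormal_uniq.
  move=> v w; rewrite !inE => /orP[/eqP ->|vf] /orP[/eqP ->|wf].
  + by rewrite uu eqxx.
  + by rewrite uf// ; case: eqP => // uw; move: unf; rewrite uw wf.
  + by rewrite fu// ; case: eqP => // uw; move: unf; rewrite -uw vf.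
  + exact: (orthonormal_ip of_).
- move=> e; rewrite inE => /orP[/eqP ->|/fW//].
  rewrite -[u]addr0; apply: (WD) => //; rewrite addrC -scaleN1r; apply: (WD) => //.
  by apply: WX; rewrite inE eqxx.
move=> y; rewrite inE big_cons => /orP[/eqP ->|yX].
  have -> : ip x u = a.
    rewrite -{1}(subrK p x).
    rewrite ipDl (_ : ip p u = 0) ?addr0; last first.
      rewrite ip_suml big_seq big1// => e ef.
      by rewrite ipZl fu// mulr0.
    have xpu : x - p = a *: u by rewrite scalerA mulfV// scale1r.
    by rewrite xpu ipZl uu mulr1.
  by rewrite -/p scalerA mulfV// scale1r subrK.
have -> : ip y u = 0.
  rewrite (fX y yX) ip_suml big_seq big1// => e ef.
  by rewrite ipZl fu// mulr0.
by rewrite scale0r add0r -fX.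
Qed.

Lemma gram_schmidtT (X : seq H) : exists2 f, orthonormal ip f &
    forall x, x \in X -> x = \sum_(e <- f) ip x e *: e.
Proof. by have [//|//|//|f [? _ ?]] := @gram_schmidt setT X; exists f. Qed.

Lemma dnorm_span f x : orthonormal ip f -> x = \sum_(e <- f) ip x e *: e ->
  ip x x = \sum_(e <- f) ip x e * (ip x e)^*%C.
Proof. by move=> of_ {1 2}->; rewrite dnorm_sum_orthonormal. Qed.

Lemma linear_sum_seq (T : H -> H) I (s : seq I) (c : I -> R[i]) (v : I -> H) :
  linear T -> T (\sum_(i <- s) c i *: v i) = \sum_(i <- s) c i *: T (v i).
Proof.
move=> lT; have T0 : T 0 = 0.
  by have := lT (-1) 0 0; rewrite scaler0 addr0 scaleN1r addNr.
elim: s => [|i s IH]; first by rewrite !big_nil.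
by rewrite !big_cons lT IH.
Qed.

(* Expand the T e along an orthonormal basis g of their span and use Bessel's
   inequality for s, once for each element of g. *)
Lemma trace_le (T : H -> H) s f :
  orthonormal ip s -> orthonormal ip f ->
  (forall e, e \in s -> T e = \sum_(u <- f) ip e u *: T u) ->
  \sum_(e <- s) ip (T e) (T e) <= \sum_(u <- f) ip (T u) (T u).
Proof.
move=> os of_ Ts.
have [g og gX] := gram_schmidtT (map T s ++ map T f).
pose w v := \sum_(u <- f) (ip (T u) v)^*%C *: u.
have Tw e v : e \in s -> ip (T e) v = ip e (w v).
  move=> es; rewrite Ts// ip_suml /w ip_sumr; apply: eq_bigr => u _.
  by rewrite ipZl ipZr conjcK mulrC.
rewrite (eq_big_seq (fun e => \sum_(v <- g) ip e (w v) * (ip e (w v))^*%C)).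
  rewrite [leRHS](eq_big_seq
    (fun u => \sum_(v <- g) ip (T u) v * (ip (T u) v)^*%C)).
    rewrite exchange_big [leRHS]exchange_big /=; apply: ler_sum => v _.
    rewrite (eq_bigr (fun e => ip (w v) e * (ip (w v) e)^*%C)); last first.
      by move=> e _; rewrite (ip_conj e) conjcK mulrC.
    apply: le_trans (bessel _ os) _; rewrite dnorm_sum_orthonormal//.
    by apply: ler_sum => u _; rewrite conjcK mulrC.
  by move=> u uf; apply: dnorm_span => //; apply: gX; rewrite mem_cat (map_f _ uf) orbT.
move=> e es; rewrite (@dnorm_span g)//; last by apply: gX; rewrite mem_cat (map_f _ es).
by apply: eq_bigr => v _; rewrite Tw.
Qed.

End InnerProduct.


(** * The Hilbert-Schmidt inner product *)

Section HSInnerProduct.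
Context {R : realType} {H : lmodType R[i]}.
Variable ip : {dot H for Num.conj}.

Definition hsum (s : seq H) (T U : H -> H) : R :=
  \sum_(e <- s) complex.Re (ip (T e) (U e)).

Lemma hs_linear (T : hs ip) : linear T. Proof. exact: (hs_funK T).1. Qed.

Lemma hsD (T U : hs ip) x : (T + U) x = T x + U x. Proof. by []. Qed.
Lemma hsB (T U : hs ip) x : (T - U) x = T x - U x. Proof. by []. Qed.
Lemma hsZ (c : R) (T : hs ip) x : (c *: T) x = c%:C *: T x. Proof. by []. Qed.

Lemma hs_sum I (s : seq I) (S : pred I) (F : I -> hs ip) x :
  (\sum_(i <- s | S i) F i) x = \sum_(i <- s | S i) F i x.
Proof. by elim/big_rec2: _ => // i y T _ <-. Qed.

Lemma hs_ext (T U : hs ip) : T =1 U -> T = U.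
Proof. by move=> TU; apply/val_inj/funext. Qed.

Lemma hsum_trace_le (T : H -> H) s f : orthonormal ip s -> orthonormal ip f ->
  (forall e, e \in s -> T e = \sum_(u <- f) ip e u *: T u) ->
  hsum s T T <= hsum f T T.
Proof.
by move=> os of_ /(trace_le os of_); rewrite lecE !Re_sum => /andP[].
Qed.

Lemma hsum_le (T : hs ip) s : orthonormal ip s -> hsum s T T <= `|T| ^+ 2.
Proof. by move=> os; exact: (sum_hs_le (hs_funK T)). Qed.

(** Near-optimal families for the single operators are concatenated and orthonormalized; by
    [hsum_trace_le] no sum decreases, since the new family spans the old ones. *)
Lemma hsum_approx (l : seq (hs ip)) (e : R) : 0 < e ->
  exists2 s, orthonormal ip s & forall T, T \in l -> `|T| ^+ 2 - e <= hsum s T T.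
Proof.
move=> e0.
have [X hX] : exists X : seq H, forall T, T \in l -> exists s,
    [/\ orthonormal ip s, {subset s <= X} & `|T| ^+ 2 - e <= hsum s T T].
  elim: l => [|T l [X hX]]; first by exists [::].
  have : ((`|T| ^+ 2 - e)%:E < hs_sq ip setT T)%E.
    by rewrite (hs_nrm2 (hs_funK T)) lte_fin ltrBlDr ltrDl.
  move/ereal_sup_gt => [_ [s [os _] <-]]; rewrite lte_fin => /ltW les.
  exists (s ++ X) => U; rewrite inE => /orP[/eqP ->|/hX[s' [os' sX le']]].
    by exists s; split=> // x xs; rewrite mem_cat xs.
  by exists s'; split=> // x /sX xX; rewrite mem_cat xX orbT.
have [f of_ fX] := gram_schmidtT ip X.
exists f => // T /hX[s [os sX le]]; apply: le_trans le _.
apply: hsum_trace_le => // u us; rewrite {1}(fX u) ?sX//.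
exact/linear_sum_seq/hs_linear.
Qed.

Lemma hs_op_bounded (T : H -> H) (c : R) : linear T -> 0 <= c ->
  (forall s, orthonormal ip s -> hsum s T T <= c ^+ 2) ->
  hs_op ip T /\ hs_nrm ip T <= c.
Proof.
move=> lT c0 h.
have le : (hs_sq ip setT T <= (c ^+ 2)%:E)%E by apply/hs_sqP => // s os _; exact: h.
have hT : hs_op ip T by split=> //; exact: le_lt_trans le (ltry _).
by split=> //; exact: hs_nrm_le.
Qed.

(** The supremum defining the norm runs over all families, so the single unit vector x / |x| already
    bounds the operator norm by the Hilbert-Schmidt norm. *)
Lemma hs_bound (T : hs ip) x :
  complex.Re (ip (T x) (T x)) <= `|T| ^+ 2 * complex.Re (ip x x).
Proof.
have [f of_ fX] := gram_schmidtT ip [:: x].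
have [x0|x0] := eqVneq x 0.
  rewrite x0; have := hs_linear T (-1) 0 0.
  by rewrite scaler0 addr0 scaleN1r addNr => ->; rewrite !linear0l mulr0.
pose a := sqrtC (ip x x).
have a0 : a != 0 by rewrite sqrt_dnorm_eq0.
have aa : ip (a^-1 *: x) (a^-1 *: x) = 1.
  rewrite dnormZ ger0_norm ?invr_ge0 ?sqrt_dnorm_ge0// exprVn sqrtCK mulVf//.
  by rewrite dnorm_eq0.
have o1 : orthonormal ip [:: a^-1 *: x].
  apply/orthonormalP; split=> // u v; rewrite !inE => /eqP -> /eqP ->.
  by rewrite eqxx aa.
have := hsum_le T o1; rewrite /hsum big_seq1 => le1.
have {1 2}-> : x = a *: (a^-1 *: x) by rewrite scalerA mulfV// scale1r.
have T0 : T 0 = 0.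
  by have := hs_linear T (-1) 0 0; rewrite scaler0 addr0 scaleN1r addNr.
rewrite -[a *: _]addr0 hs_linear T0 addr0 dnormZ ger0_norm ?sqrt_dnorm_ge0//.
rewrite sqrtCK; have := dnorm_ge0 ip x.
case: (ip x x) => u v; rewrite lecE /= => /andP[/eqP -> u0].
rewrite (_ : u +i* 0 = u%:C)// Re_realM mulrC.
exact: ler_wpM2r.
Qed.

(** The real part of the trace pairing, defined by polarization so that no infinite sum over a basis
    has to converge. *)
Definition hsip (T U : hs ip) : R := (`|T + U| ^+ 2 - `|T - U| ^+ 2) / 4.

Lemma hsumB s T U : hsum s (T \+ U) (T \+ U) - hsum s (T \- U) (T \- U) =
  4 * hsum s T U.
Proof.
rewrite /hsum -sumrB mulr_sumr; apply: eq_bigr => e _ /=.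
rewrite ipBl !ipBr ipDl !ipDr !(ReD, ReN).
rewrite (_ : complex.Re (ip (U e) (T e)) = complex.Re (ip (T e) (U e))).
  by ring.
by rewrite ip_conj Re_conj.
Qed.

(** Bilinearity of [hsip] is read off from the finite sums [hsum], for which it is clear: one family
    approximates all the pairings that occur in an identity. *)
Lemma hsip_approx (l : seq (hs ip * hs ip)) (e : R) : 0 < e ->
  exists2 s, orthonormal ip s &
    forall p, p \in l -> `|hsip p.1 p.2 - hsum s p.1 p.2| <= e.
Proof.
move=> e0; have [s os hS] := hsum_approx
  ([seq p.1 + p.2 | p <- l] ++ [seq p.1 - p.2 | p <- l]) e0.
exists s => // -[T U] pl /=.
have := hS _ (_ : T + U \in _); rewrite mem_cat (map_f (fun p => p.1 + p.2) pl).
move=> /(_ isT).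
have := hS _ (_ : T - U \in _); rewrite mem_cat.
rewrite (map_f (fun p => p.1 - p.2) pl) orbT => /(_ isT).
have := hsum_le (T + U) os; have := hsum_le (T - U) os.
have := hsumB s T U.
rewrite (_ : T \+ U = (T + U : hs ip) :> (H -> H))//.
rewrite (_ : T \- U = (T - U : hs ip) :> (H -> H))// /hsip.
move: (hsum s T U) (hsum s (T + U)%R _) (hsum s (T - U)%R _)=> a b c.
clear -e0; by move=> h1 h2 h3 h4 h5; rewrite ler_norml; apply/andP; split; lra.
Qed.

Lemma le_eps_eq0 (x : R) : (forall e, 0 < e -> `|x| <= e) -> x = 0.
Proof.
move=> h; apply/eqP; rewrite -normr_le0; apply/ler_addgt0Pr => e e0.
by rewrite add0r h.
Qed.

Lemma hsipC T U : hsip T U = hsip U T.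
Proof. by rewrite /hsip (addrC T) distrC. Qed.

Lemma hsip_norm T : hsip T T = `|T| ^+ 2.
Proof.
rewrite /hsip subrr normr0 expr0n subr0 -mulr2n -scaler_nat normrZ.
by rewrite ger0_norm// exprMn; field.
Qed.

Lemma hsipDl T T' U : hsip (T + T') U = hsip T U + hsip T' U.
Proof.
apply/eqP; rewrite -subr_eq0; apply/eqP/le_eps_eq0 => e e0.
have e3 : 0 < e / 3 by rewrite divr_gt0.
have [s os hS] := hsip_approx [:: (T + T', U); (T, U); (T', U)] e3.
have := hS (T + T', U); have := hS (T, U); have := hS (T', U).
rewrite !inE !eqxx !orbT /= => /(_ isT) h1 /(_ isT) h2 /(_ isT) h3.
have E : hsum s (T + T')%R U = hsum s T U + hsum s T' U.
  by rewrite /hsum -big_split; apply: eq_bigr => x _; rewrite hsD ipDl ReD.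
move: h1 h2 h3; rewrite E; move: (hsip (T + T')%R U) (hsip T U) (hsip T' U).
move: (hsum s T U) (hsum s T' U); clear -e0 => a b x y z.
rewrite !ler_norml => /andP[? ?] /andP[? ?] /andP[? ?].
by apply/andP; split; lra.
Qed.

Lemma hsipZl (c : R) T U : hsip (c *: T) U = c * hsip T U.
Proof.
apply/eqP; rewrite -subr_eq0; apply/eqP/le_eps_eq0 => e e0.
have c1 : 0 < 1 + `|c| by rewrite ltr_pwDl.
(* The error of the second pairing is multiplied by |c|, so the two errors together amount to 1 +
   |c| times this bound. *)
have e3 : 0 < e / (1 + `|c|) by rewrite divr_gt0.
have [s os hS] := hsip_approx [:: (c *: T, U); (T, U)] e3.
have := hS (c *: T, U); have := hS (T, U).
rewrite !inE !eqxx !orbT /= => /(_ isT) h1 /(_ isT) h2.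
have E : hsum s (c *: T)%R U = c * hsum s T U.
  by rewrite /hsum mulr_sumr; apply: eq_bigr => x _; rewrite hsZ ipZl Re_realM.
move: h1 h2; rewrite E; move: (hsip (c *: T) U) (hsip T U) (hsum s T U).
clear -e0 c1 => a b x h1 h2.
rewrite (_ : _ - _ = (a - c * x) - c * (b - x)); last by ring.
rewrite (le_trans (ler_normB _ _))// normrM.
have -> : e = e / (1 + `|c|) + `|c| * (e / (1 + `|c|)).
  by field; rewrite gt_eqF.
by rewrite lerD// ler_wpM2l.
Qed.

Lemma hsipDr T U U' : hsip T (U + U') = hsip T U + hsip T U'.
Proof. by rewrite hsipC hsipDl !(hsipC _ T). Qed.

Lemma hsipZr (c : R) T U : hsip T (c *: U) = c * hsip T U.
Proof. by rewrite hsipC hsipZl hsipC. Qed.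

Lemma hsipNl T U : hsip (- T) U = - hsip T U.
Proof. by rewrite -scaleN1r hsipZl mulN1r. Qed.

Lemma hsipNr T U : hsip T (- U) = - hsip T U.
Proof. by rewrite -scaleN1r hsipZr mulN1r. Qed.

(** With the polarization formula Cauchy-Schwarz becomes two triangle inequalities: (|T| + |U|)^2 -
    (|T| - |U|)^2 = 4 |T| |U|. *)
Lemma hsip_le T U : `|hsip T U| <= `|T| * `|U|.
Proof.
have h : forall T, hsip T U <= `|T| * `|U|.
  move=> {}T; rewrite /hsip ler_pdivrMr//.
  have n1 : `|T + U| ^+ 2 <= (`|T| + `|U|) ^+ 2.
    by rewrite lerXn2r ?nnegrE ?addr_ge0// ler_normD.
  have n2 : (`|T| - `|U|) ^+ 2 <= `|T - U| ^+ 2.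
    rewrite -[X in X <= _]real_normK ?num_real// lerXn2r ?nnegrE//.
    exact: ler_dist_dist.
  rewrite (le_trans (lerB n1 n2))//; move: `|T| `|U| => a b.
by rewrite le_eqVlt; apply/orP; left; apply/eqP; ring.
rewrite ler_norml h andbT lerNl -hsipNl.
by rewrite (le_trans (h _))// normrN.
Qed.

End HSInnerProduct.


(** * Reflections, blocks and adjoints of Hilbert-Schmidt operators *)

Section HSOperations.
Context {R : realType} {H : lmodType R[i]}.
Variable ip : {dot H for Num.conj}.

Lemma to_hsE (T : H -> H) : hs_op ip T -> to_hs ip T = T :> (H -> H).
Proof. by move=> hT; rewrite /to_hs insubdK//; exact/hs_predP. Qed.

Lemma ip_ext x y : (forall z, ip x z = ip y z) -> x = y.
Proof.
move=> xy; apply/eqP; rewrite -subr_eq0 -(dnorm_eq0 ip); apply/eqP.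
by rewrite {1}ipBl xy subrr.
Qed.

Lemma ipNl x z : ip (- x) z = - ip x z.
Proof. exact: linearNl. Qed.

Lemma ip0l z : ip 0 z = 0.
Proof. exact: linear0l. Qed.

Let ipE := (ipBl ip, ipDl ip, ipNl, ipZl ip, ip0l).

Lemma linear_fun0 (T : H -> H) : linear T -> T 0 = 0.
Proof. by move=> lT; have := lT (-1) 0 0; rewrite scaler0 addr0 scaleN1r addNr. Qed.

Lemma linear_funD (T : H -> H) x y : linear T -> T (x + y) = T x + T y.
Proof. by move=> lT; have := lT 1 x y; rewrite !scale1r. Qed.

Lemma linear_funZ (T : H -> H) a x : linear T -> T (a *: x) = a *: T x.
Proof. by move=> lT; have := lT a x 0; rewrite (linear_fun0 lT) !addr0. Qed.

Lemma linear_funN (T : H -> H) x : linear T -> T (- x) = - T x.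
Proof. by move=> lT; rewrite -scaleN1r (linear_funZ _ _ lT) scaleN1r. Qed.

Lemma linear_funB (T : H -> H) x y : linear T -> T (x - y) = T x - T y.
Proof. by move=> lT; rewrite linear_funD// linear_funN. Qed.

Lemma hs0 (T : hs ip) : T 0 = 0.
Proof. exact/linear_fun0/hs_linear. Qed.

Lemma hs_addr (T : hs ip) x y : T (x + y) = T x + T y.
Proof. exact/linear_funD/hs_linear. Qed.

Lemma hs_subr (T : hs ip) x y : T (x - y) = T x - T y.
Proof. exact/linear_funB/hs_linear. Qed.

Lemma hs_scaler (T : hs ip) a x : T (a *: x) = a *: T x.
Proof. exact/linear_funZ/hs_linear. Qed.

Lemma linear_comp (S T : H -> H) : linear S -> linear T -> linear (S \o T).
Proof. by move=> lS lT a x y /=; rewrite lT lS. Qed.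

Lemma hs_op_contractL (B : H -> H) (c : R) (T : hs ip) : linear B -> 0 <= c ->
  (forall x, complex.Re (ip (B x) (B x)) <= c ^+ 2 * complex.Re (ip x x)) ->
  hs_op ip (B \o T) /\ hs_nrm ip (B \o T) <= c * `|T|.
Proof.
move=> lB c0 h; apply: hs_op_bounded; last 1 first.
- move=> s os; rewrite exprMn.
  apply: le_trans (ler_wpM2l _ (hsum_le T os)); last exact: sqr_ge0.
  by rewrite /hsum mulr_sumr; apply: ler_sum => e _; exact: h.
- exact: linear_comp (hs_linear T).
- by rewrite mulr_ge0.
Qed.

(** An isometry carries orthonormal families to orthonormal families, so the sums for [T \o J] are
    among the sums for [T]. *)
Lemma hs_op_isoR (J : H -> H) (T : hs ip) : linear J ->
  (forall x y, ip (J x) (J y) = ip x y) ->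
  hs_op ip (T \o J) /\ hs_nrm ip (T \o J) <= `|T|.
Proof.
move=> lJ iJ; apply: hs_op_bounded => //; first exact: linear_comp (hs_linear T) lJ.
move=> s os; rewrite /hsum; under eq_bigr do rewrite /=.
rewrite -(big_map J xpredT (fun e => complex.Re (ip (T e) (T e)))).
apply: hsum_le; apply/orthonormalP; split.
  rewrite map_inj_in_uniq ?(orthonormal_uniq os)// => x y xs ys Jxy.
  have := orthonormal_ip os xs ys; rewrite -iJ Jxy iJ (orthonormal_ip os)// eqxx.
  by case: eqP => // _ /eqP; rewrite oner_eq0.
move=> _ _ /mapP[x xs ->] /mapP[y ys ->]; rewrite iJ (orthonormal_ip os)//.
case: eqP => [->|xy]; first by rewrite eqxx.
case: eqP => // Jxy; have := orthonormal_ip os xs ys.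
rewrite -iJ Jxy iJ (orthonormal_ip os)// eqxx.
by case: eqP => // _ /eqP; rewrite oner_eq0.
Qed.

Definition hcomp (S T : hs ip) : hs ip := to_hs ip (S \o T).

Lemma hcomp_subproof (S T : hs ip) :
  hs_op ip (S \o T) /\ hs_nrm ip (S \o T) <= `|S| * `|T|.
Proof.
exact: hs_op_contractL (hs_linear S) (normr_ge0 S) (hs_bound S).
Qed.

Lemma hcompE S T x : hcomp S T x = S (T x).
Proof. by rewrite /hcomp to_hsE//; case: (hcomp_subproof S T). Qed.

Lemma hcomp_le S T : `|hcomp S T| <= `|S| * `|T|.
Proof.
have [h le] := hcomp_subproof S T.
by rewrite -[`|hcomp S T|]/(hs_nrm ip (hcomp S T)) to_hsE.
Qed.

(** Purely algebraic, with no reference to the range: the same predicate covers the zero operator,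
    sums of orthogonal projections and the perturbed projections [proj_at]. *)
Definition orth_proj (P : H -> H) : Prop :=
  [/\ linear P, forall x y, ip (P x) y = ip x (P y) & forall x, P (P x) = P x].

Section Projection.
Variables (P : H -> H) (PP : orth_proj P).

Let lP : linear P. Proof. by case: PP. Qed.
Let sP x y : ip (P x) y = ip x (P y). Proof. by case: PP. Qed.
Let PK x : P (P x) = P x. Proof. by case: PP. Qed.

(** The reflection 1 - 2P is a unitary involution, so composing with it on either side preserves the
    Hilbert-Schmidt norm and hence [hsip]. Blocks with respect to P become eigenspaces of these
    isometries. *)
Definition refl x := x - (P x + P x).

Lemma refl_linear : linear refl.
Proof.
move=> a x y; apply: ip_ext => z.
by rewrite /refl !lP !ipE; ring.
Qed.

Lemma refl_ip x y : ip (refl x) (refl y) = ip x y.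
Proof.
rewrite /refl !ipBl !ipBr !ipDl !ipDr !sP !PK.
move: (ip x y) (ip x (P y)) => a b.
ring.
Qed.

Lemma reflK x : refl (refl x) = x.
Proof.
apply: ip_ext => z.
by rewrite /refl !(linear_funB _ _ lP) !(linear_funD _ _ lP) !PK !ipE; ring.
Qed.

Lemma hs_op_reflR (T : hs ip) : hs_op ip (T \o refl) /\ hs_nrm ip (T \o refl) <= `|T|.
Proof. by apply: hs_op_isoR; [exact: refl_linear|exact: refl_ip]. Qed.

Lemma hs_op_reflL (T : hs ip) : hs_op ip (refl \o T) /\ hs_nrm ip (refl \o T) <= `|T|.
Proof.
rewrite -[leRHS]mul1r; apply: hs_op_contractL => //; first exact: refl_linear.
by move=> x; rewrite refl_ip expr1n mul1r.
Qed.

Definition hrefl (T : hs ip) : hs ip := to_hs ip (refl \o T).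
Definition hreflr (T : hs ip) : hs ip := to_hs ip (T \o refl).

Lemma hreflE T x : hrefl T x = refl (T x).
Proof. by rewrite /hrefl to_hsE//; case: (hs_op_reflL T). Qed.

Lemma hreflrE T x : hreflr T x = T (refl x).
Proof. by rewrite /hreflr to_hsE//; case: (hs_op_reflR T). Qed.

Lemma hreflK : involutive hrefl.
Proof. by move=> T; apply: hs_ext => x; rewrite !hreflE reflK. Qed.

Lemma hreflrK : involutive hreflr.
Proof. by move=> T; apply: hs_ext => x; rewrite !hreflrE reflK. Qed.

Lemma hrefl_norm T : `|hrefl T| = `|T|.
Proof.
have le U : `|hrefl U| <= `|U|.
  have [h le] := hs_op_reflL U.
  by rewrite -[`|hrefl U|]/(hs_nrm ip (hrefl U)) to_hsE.
by apply/eqP; rewrite eq_le le -{1}(hreflK T) le.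
Qed.

Lemma hreflr_norm T : `|hreflr T| = `|T|.
Proof.
have le U : `|hreflr U| <= `|U|.
  have [h le] := hs_op_reflR U.
  by rewrite -[`|hreflr U|]/(hs_nrm ip (hreflr U)) to_hsE.
by apply/eqP; rewrite eq_le le -{1}(hreflrK T) le.
Qed.

Lemma hrefl_ip A B : hsip (hrefl A) (hrefl B) = hsip A B.
Proof.
have D : hrefl (A + B) = hrefl A + hrefl B.
  by apply: hs_ext => x; rewrite hsD !hreflE hsD (linear_funD _ _ refl_linear).
have S : hrefl (A - B) = hrefl A - hrefl B.
  by apply: hs_ext => x; rewrite hsB !hreflE hsB (linear_funB _ _ refl_linear).
by rewrite /hsip -D -S !hrefl_norm.
Qed.

Lemma hreflr_ip A B : hsip (hreflr A) (hreflr B) = hsip A B.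
Proof.
have D : hreflr (A + B) = hreflr A + hreflr B.
  by apply: hs_ext => x; rewrite hsD !hreflrE hsD.
have S : hreflr (A - B) = hreflr A - hreflr B.
  by apply: hs_ext => x; rewrite hsB !hreflrE hsB.
by rewrite /hsip -D -S !hreflr_norm.
Qed.

Lemma hsip_eq0_refl A B : hrefl A = A -> hrefl B = - B -> hsip A B = 0.
Proof.
move=> A1 B1; have := hrefl_ip A B; rewrite A1 B1 hsipNr => h.
by lra.
Qed.

(* Conjugation by the reflection 1 - 2P is an isometry fixing A and negating B. *)
Lemma hsip_offdiag_eq0 (A B : hs ip) : (forall x, P (A x) = A (P x)) ->
  (forall x, B x = P (B x) + B (P x)) -> hsip A B = 0.
Proof.
move=> PA PB.
have A1 : hrefl (hreflr A) = A.
  apply: hs_ext => x; rewrite hreflE hreflrE /refl hs_subr hs_addr.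
  rewrite !(linear_funB _ _ lP) !(linear_funD _ _ lP) !PA !PK.
  by apply: ip_ext => z; rewrite !ipE; ring.
have B1 : hrefl (hreflr B) = - B.
  apply: hs_ext => x; rewrite hreflE hreflrE.
  have PBP : P (B (P x)) = 0.
    have /(congr1 (fun y => y - B (P x))) := PB (P x).
    by rewrite PK subrr addrK => <-.
  rewrite /refl hs_subr hs_addr (_ : (- B)%R x = - B x)//.
  rewrite !(linear_funB _ _ lP) !(linear_funD _ _ lP) !PBP.
  have -> : P (B x) = B x - B (P x) by rewrite [X in X - _]PB addrK.
  by apply: ip_ext => z; rewrite !ipE; ring.
have := hrefl_ip (hreflr A) (hreflr B); rewrite A1 B1 hreflr_ip hsipNr.
by move=> h; lra.
Qed.

Definition hmulr (T : hs ip) : hs ip := to_hs ip (T \o P).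
Definition hmull (T : hs ip) : hs ip := to_hs ip (P \o T).

(** P = (1 - [refl]) / 2, which reduces right multiplication by P to the isometry [hreflr]. *)
Let half_refl (T : hs ip) x : T (P x) = (2^-1 *: (T - hreflr T) : hs ip) x.
Proof.
rewrite hsZ hsB hreflrE /refl hs_subr hs_addr opprB addrCA.
rewrite subrr addr0 -{2 3}[T (P x)]scale1r -scalerDl scalerA.
rewrite (_ : _ * _ = 1) ?scale1r// -(rmorph1 (real_complex R)) -rmorphD -rmorphM.
by congr (_%:C); field.
Qed.

Lemma hmulrE T x : hmulr T x = T (P x).
Proof.
suff E : (T \o P) = (2^-1 *: (T - hreflr T) : hs ip) :> (H -> H).
  by rewrite /hmulr to_hsE E//; exact: hs_funK.
by apply/funext => y; rewrite -half_refl.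
Qed.

Lemma hmulr_add (S T : hs ip) : hmulr (S + T) = hmulr S + hmulr T.
Proof. by apply: hs_ext => x; rewrite hsD !hmulrE. Qed.

Lemma hmulr_scale c (T : hs ip) : hmulr (c *: T) = c *: hmulr T.
Proof. by apply: hs_ext => x; rewrite hsZ !hmulrE. Qed.

Lemma hmulr_le (T : hs ip) : `|hmulr T| <= `|T|.
Proof.
have -> : hmulr T = 2^-1 *: (T - hreflr T).
  by apply: hs_ext => y; rewrite hmulrE half_refl.
rewrite normrZ ger0_norm// -ler_pdivlMl// invrK (le_trans (ler_normB _ _))//.
by rewrite hreflr_norm mulr_natl mulr2n.
Qed.

Lemma hs_op_projL (T : hs ip) : hs_op ip (P \o T).
Proof.
have [//|x|//] := @hs_op_contractL P 1 T lP.
rewrite expr1n mul1r; have := dnorm_ge0 ip (x - P x).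
rewrite ipBl !ipBr !sP !PK subrr subr0 subr_ge0 lecE => /andP[_].
by [].
Qed.

Lemma hmullE T x : hmull T x = P (T x).
Proof. by rewrite /hmull to_hsE//; exact: hs_op_projL. Qed.

(** Here A = (1 - P) X P and B = P X (1 - P). An off-diagonal operator is their sum, and left
    multiplication by 1 - 2P, which fixes A and negates B, makes them orthogonal. *)
Lemma hmull_hmulr_offdiag (X : hs ip) :
  (forall x, X x = P (X x) + X (P x)) ->
  let A := hmulr X - hmull (hmulr X) in
  let B := hmull X - hmulr (hmull X) in
  [/\ X = A + B, hrefl A = A & hrefl B = - B].
Proof.
move=> hX A B.
have PXP x : P (X (P x)) = 0.
  have /(congr1 (fun y => y - X (P x))) := hX (P x).
  by rewrite PK subrr addrK => <-.
have AE x : A x = X (P x) by rewrite hsB hmullE hmulrE PXP subr0.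
have BE x : B x = P (X x) by rewrite hsB hmulrE !hmullE PXP subr0.
split; apply: hs_ext => x; first by rewrite hsD AE BE addrC -hX.
- by rewrite hreflE AE /refl PXP addr0 subr0.
- rewrite hreflE BE /refl PK (_ : (- B)%R x = - B x)// BE.
  by rewrite opprD addrA subrr sub0r.
Qed.

End Projection.

(** |A e|^2 is expanded along an orthonormal basis of the span of the images. Each coefficient <A e,
    u> equals <e, B u>, and Bessel's inequality over the e turns the double sum into the sum of the
    |B u|^2. *)
Lemma hs_adj_le (A B : hs ip) : (forall x y, ip (A x) y = ip x (B y)) ->
  `|A| <= `|B|.
Proof.
move=> AB; have [||s os|_] := @hs_op_bounded _ _ ip A `|B|.
- exact: hs_linear.
- by [].
- have [f of_ fX] := gram_schmidtT ip (map A s).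
  apply: le_trans (hsum_le B of_).
  suff : \sum_(e <- s) ip (A e) (A e) <= \sum_(u <- f) ip (B u) (B u).
    by rewrite lecE !Re_sum => /andP[].
  rewrite (eq_big_seq (fun e => \sum_(u <- f) ip (A e) u * (ip (A e) u)^*%C)).
    rewrite exchange_big /=; apply: ler_sum => u _.
    rewrite (eq_bigr (fun e => ip (B u) e * (ip (B u) e)^*%C)).
      exact: bessel.
    by move=> e _; rewrite AB (ip_conj ip e) conjcK mulrC.
  by move=> e es; apply: dnorm_span => //; apply: fX; exact: map_f.
- by [].
Qed.

Lemma hs_adj_norm (A B : hs ip) : (forall x y, ip (A x) y = ip x (B y)) ->
  `|A| = `|B|.
Proof.
move=> AB; apply/eqP; rewrite eq_le !hs_adj_le// => x y.
by rewrite ip_conj -AB -ip_conj.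
Qed.

Section Subspace.
Variables (P : H -> H) (PP : orth_proj P) (W : set H).
Hypotheses (W0 : W 0) (WD : forall (a : R[i]) x y, W x -> W y -> W (a *: x + y)).
Hypotheses (PW : forall x, W (P x)) (PWid : forall x, W x -> P x = x).

(** As T = T P, replacing a family of H by an orthonormal basis of the span of its projections,
    which lies in W, does not decrease the sum; so the two suprema agree. *)
Lemma hs_sq_range (T : hs ip) : (forall x, T (P x) = T x) ->
  hs_sq ip W T = (`|T| ^+ 2)%:E.
Proof.
move=> TP; rewrite -[RHS](hs_nrm2 (hs_funK T)).
apply/eqP; rewrite eq_le; apply/andP; split.
  by apply: le_ereal_sup => _ [s [os _] <-]; exists s.
apply: ge_ereal_sup => _ [s [os _] <-].
have [//|//|x|f [of_ fW fX]] := @gram_schmidt _ _ ip W (map P s).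
  by case/mapP => y _ ->.
apply: (@le_trans _ _ (hsum ip f T T)%:E).
  rewrite lee_fin; apply: hsum_trace_le => // e es.
  rewrite -TP {1}(fX (P e)) ?map_f// (linear_sum_seq _ _ _ (hs_linear T)).
  apply: eq_big_seq => u uf; congr (_ *: _).
  have [_ sP _] := PP; by rewrite sP PWid//; exact: fW.
by apply: ereal_sup_ubound; exists f.
Qed.

(* The two off-diagonal blocks of a self-adjoint X are adjoint and orthogonal. *)
Lemma hs_sq_offdiag (X : hs ip) :
  (forall x, X x = P (X x) + X (P x)) -> (forall x y, ip (X x) y = ip x (X y)) ->
  hs_sq ip W (fun x => X (P x) - P (X (P x))) = (`|X| ^+ 2 / 2)%:E.
Proof.
move=> hX sX; have [_ sP PK] := PP.
have [XAB A1 B1] := hmull_hmulr_offdiag PP hX.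
set A := hmulr P X - _ in XAB A1; set B := hmull P X - _ in XAB B1.
have AE x : A x = X (P x) - P (X (P x)).
  by rewrite hsB (hmullE PP) !(hmulrE PP).
have BE x : B x = P (X x) - P (X (P x)).
  by rewrite hsB (hmulrE PP) !(hmullE PP).
have AB : `|A| = `|B|.
  apply: hs_adj_norm => x y; by rewrite AE BE ipBl ipBr !sP !sX !sP.
have -> : (fun x => X (P x) - P (X (P x))) = A by apply/funext => x; rewrite AE.
rewrite hs_sq_range; last by move=> x; rewrite !AE PK.
clearbody A B; congr (_%:E); rewrite XAB -!hsip_norm hsipDl !hsipDr (hsipC B A).
by rewrite (hsip_eq0_refl PP A1 B1) !hsip_norm AB; field.
Qed.

End Subspace.
End HSOperations.


(** * Calculus of operator-valued maps *)

Section DirectionalDerivative.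
Context {R : realType}.
Implicit Types V W : normedModType R.

Lemma is_deriveP V W (f : V -> W) (x v : V) (d : W) :
  is_derive x v f d <->
  (h^-1 *: (f (h *: v + x) - f x) @[h --> 0^'] --> d).
Proof.
split=> [[df <-]|fd]; first exact: df.
by split; [apply/cvg_ex; exists d|apply: cvg_lim].
Qed.

(** Directional derivatives are derivatives along lines; this carries the mean value theorem and the
    chain rule of one variable over to any normed space. *)
Lemma is_derive_line V W (f : V -> W) (x v : V) (d : W) (t : R) :
  is_derive (t *: v + x) v f d <-> is_derive t 1 (fun s => f (s *: v + x)) d.
Proof.
have E : (fun h : R => h^-1 *: (f (h *: v + (t *: v + x)) - f (t *: v + x))) =
  (fun h : R => h^-1 *: (f ((h *: 1 + t) *: v + x) - f (t *: v + x))).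
  by apply/funext => h; rewrite scalerDl -scalerA scale1r addrA.
by split=> /is_deriveP; [rewrite E|rewrite -E] => ?; apply/is_deriveP.
Qed.

Lemma is_derive_line0 V W (f : V -> W) (x v : V) (d : W) :
  is_derive x v f d <-> is_derive (0 : R) 1 (fun s => f (s *: v + x)) d.
Proof. by rewrite -is_derive_line scale0r add0r. Qed.

Lemma cvg_near W T (F : set_system T) {FF : Filter F} (f g : T -> W) (l : W) :
  (\forall x \near F, f x = g x) -> f @ F --> l -> g @ F --> l.
Proof.
move=> fg; apply: cvg_trans; apply: near_eq_cvg.
by apply: filterS fg => x ->.
Qed.

Lemma le_cvg0 W T (F : set_system T) {FF : Filter F} (f : T -> W) (k : T -> R) :
  (forall x, `|f x| <= k x) -> k @ F --> (0 : R) -> f @ F --> (0 : W).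
Proof.
move=> fk k0; apply/cvgr0Pnorm_lt => e e0.
have ke := @cvgr0_norm_lt _ _ _ F _ _ k0 e e0.
near=> x; apply: le_lt_trans (le_trans (fk x) (ler_norm _)) _.
near: x; exact: ke.
Unshelve. all: by end_near. Qed.

Lemma is_derive_line_cvg V W (f : V -> W) (x v : V) (d : W) :
  is_derive x v f d -> f (h *: v + x) @[h --> 0^'] --> f x.
Proof.
move=> /is_deriveP fd.
have h0 : (h : R) @[h --> 0^'] --> (0 : R) by exact: nbhs_dnbhs.
pose proof (cvgD (cvgZ h0 fd) (cvg_cst (f x))) as fx.
rewrite scale0r add0r in fx.
refine (cvg_near _ fx); near=> h; rewrite addrfctE.
rewrite scalerA mulfV ?scale1r ?subrK//; near: h.
exact: nbhs_dnbhs_neq.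
Unshelve. all: by end_near. Qed.

Lemma is_derive_near V W (f g : V -> W) (x v : V) (d : W) :
  (\forall y \near x, f y = g y) -> is_derive x v f d -> is_derive x v g d.
Proof.
move=> fg /is_deriveP fd; apply/is_deriveP; refine (cvg_near _ fd).
have hx : (h : R) *: v + x @[h --> 0^'] --> x.
  have h0 : (h : R) @[h --> 0^'] --> (0 : R) by exact: nbhs_dnbhs.
  by rewrite -[X in _ --> X]add0r -(scale0r v);
    apply: cvgD; [exact: cvgZr_tmp|exact: cvg_cst].
have fgx := nbhs_singleton fg.
near=> h; rewrite fgx; congr (_ *: (_ - _)).
by near: h; exact: (hx _ fg).
Unshelve. all: by end_near. Qed.

(** One product rule then serves composition, scalar multiplication, the pairing [hsip] and the
    evaluations <S a, T b>. *)
Record bounded_bilinear (U V W : normedModType R) (B : U -> V -> W) : Prop :=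
  BoundedBilinear {
    bilinDl : forall u u' w, B (u + u') w = B u w + B u' w;
    bilinZl : forall c u w, B (c *: u) w = c *: B u w;
    bilinDr : forall u w w', B u (w + w') = B u w + B u w';
    bilinZr : forall c u w, B u (c *: w) = c *: B u w;
    bilin_le : exists C, forall u w, `|B u w| <= C * (`|u| * `|w|) }.

Section Bilinear.
Context {U V W : normedModType R} {B : U -> V -> W}.
Hypothesis bB : bounded_bilinear B.

Lemma bilinBl u u' w : B (u - u') w = B u w - B u' w.
Proof. by rewrite (bilinDl bB) -scaleN1r (bilinZl bB) scaleN1r. Qed.

Lemma bilinBr u w w' : B u (w - w') = B u w - B u w'.
Proof. by rewrite (bilinDr bB) -scaleN1r (bilinZr bB) scaleN1r. Qed.

Lemma bilin_cvg T (F : set_system T) {FF : Filter F} (f : T -> U) (g : T -> V) u w :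
  f @ F --> u -> g @ F --> w -> B (f x) (g x) @[x --> F] --> B u w.
Proof.
move=> fu gw; have [C hC] := bilin_le bB.
have fu0 : `|f x - u| @[x --> F] --> (0 : R).
  by rewrite -(normr0 U) -(subrr u); apply: cvg_norm; apply: cvgB => //; exact: cvg_cst.
have gw0 : `|g x - w| @[x --> F] --> (0 : R).
  by rewrite -(normr0 V) -(subrr w); apply: cvg_norm; apply: cvgB => //; exact: cvg_cst.
have c1 : B (f x - u) (g x) @[x --> F] --> (0 : W).
  apply: (@le_cvg0 _ _ _ _ _ (fun x => C * (`|f x - u| * `|g x|))) => //.
  by rewrite -(mulr0 C) -(mul0r `|w|); apply: cvgMl_tmp; apply: cvgM => //; exact: cvg_norm.
have c2 : B u (g x - w) @[x --> F] --> (0 : W).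
  apply: (@le_cvg0 _ _ _ _ _ (fun x => C * (`|u| * `|g x - w|))) => //.
  by rewrite -(mulr0 C) -(mulr0 `|u|); apply: cvgMl_tmp; apply: cvgMl_tmp.
pose proof (cvgD (cvgD c1 c2) (cvg_cst (B u w))) as fgx; rewrite !add0r in fgx.
refine (cvg_near _ fgx); near=> x; rewrite !addrfctE bilinBl bilinBr.
by rewrite addrA !subrK.
Unshelve. all: by end_near. Qed.

Lemma is_derive_bilinear (X : normedModType R) (f : X -> U) (g : X -> V) x v df dg :
  is_derive x v f df -> is_derive x v g dg ->
  is_derive x v (fun y => B (f y) (g y)) (B df (g x) + B (f x) dg).
Proof.
move=> fd gd; apply/is_deriveP.
have gx := is_derive_line_cvg gd.
move/is_deriveP in fd; move/is_deriveP in gd.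
pose proof (cvgD (bilin_cvg fd gx) (bilin_cvg (cvg_cst (f x)) gd)) as fgx.
refine (cvg_near _ fgx); near=> h; rewrite addrfctE.
rewrite (bilinZl bB) (bilinZr bB) -scalerDr; congr (_ *: _).
by rewrite bilinBl bilinBr addrA subrK.
Unshelve. all: by end_near. Qed.

End Bilinear.

Record bounded_linear (U W : normedModType R) (L : U -> W) : Prop :=
  BoundedLinear {
    blinD : forall u u', L (u + u') = L u + L u';
    blinZ : forall c u, L (c *: u) = c *: L u;
    blin_le : exists C, forall u, `|L u| <= C * `|u| }.

(** A linear map is treated as a bilinear one whose second argument is the constant 1, so that the
    linear rules are instances of the bilinear ones. *)
Lemma bounded_linear_bilinear (U W : normedModType R) (L : U -> W) :
  bounded_linear L -> bounded_bilinear (fun (u : U) (c : R^o) => c *: L u).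
Proof.
move=> [LD LZ [C LC]]; split.
- by move=> u u' w; rewrite LD scalerDr.
- by move=> c u w; rewrite LZ !scalerA mulrC.
- by move=> u w w'; rewrite scalerDl.
- by move=> c u w; rewrite scalerA.
- by exists C => u w; rewrite normrZ mulrA mulrC ler_wpM2r.
Qed.

Section Linear.
Context {U W : normedModType R} {L : U -> W}.
Hypothesis bL : bounded_linear L.

Lemma blin_cvg T (F : set_system T) {FF : Filter F} (f : T -> U) u :
  f @ F --> u -> L (f x) @[x --> F] --> L u.
Proof.
move=> fu.
pose proof (bilin_cvg (bounded_linear_bilinear bL) fu (cvg_cst (1 : R^o))) as h.
move: h; by under eq_fun do rewrite scale1r; rewrite scale1r.
Qed.

Lemma is_derive_linear (X : normedModType R) (f : X -> U) x v df :
  is_derive x v f df -> is_derive x v (fun y => L (f y)) (L df).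
Proof.
move=> fd; have := is_derive_bilinear (bounded_linear_bilinear bL) fd
  (is_derive_cst (1 : R^o) x v).
rewrite scale1r scale0r addr0; apply: is_derive_near.
by near=> y; rewrite /= scale1r.
Unshelve. all: by end_near. Qed.

End Linear.
End DirectionalDerivative.


(** * Mean values and the symmetry of mixed derivatives *)

Section MeanValue.
Context {R : realType}.

Lemma mvt_closed (f df : R -> R) (a b : R) : a <= b ->
  (forall x, a <= x <= b -> is_derive x 1 f (df x)) ->
  exists2 c, a <= c <= b & f b - f a = df c * (b - a).
Proof.
move=> ab fd; have [x||c cab E] := @MVT_segment R f df a b ab.
- by rewrite in_itv /= => /andP[ax xb]; apply: fd; rewrite !ltW.
- apply: derivable_within_continuous => x; rewrite in_itv /= => /fd.
  by case.
by exists c => //; move: cab; rewrite in_itv.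
Qed.

Section Schwarz.
Context {V : normedModType R}.
Variables (F Fa Fb Fab Fba : V -> R) (a b x : V) (d : R).
Let p s t := s *: a + (t *: b + x).
Hypothesis Fd : forall s t, 0 <= s <= d -> 0 <= t <= d ->
  is_derive (p s t) a (F : V -> R^o) (Fa (p s t)).
Hypothesis Fad : forall s t, 0 <= s <= d -> 0 <= t <= d ->
  is_derive (p s t) b (Fa : V -> R^o) (Fab (p s t)).

(** The mean value theorem is applied to s |-> F (p s h) - F (p s 0) and then to [Fa] in the
    direction b. The second difference on the left is symmetric in a and b, which is the source of
    Schwarz's theorem. *)
Lemma double_mean_value h : 0 <= h <= d ->
  exists s t, [/\ 0 <= s <= h, 0 <= t <= h &
    F (p h h) - F (p h 0) - (F (p 0 h) - F (p 0 0)) = h ^+ 2 * Fab (p s t)].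
Proof.
move=> /andP[h0 hd].
have D1 (s : R) : 0 <= s <= h -> is_derive s (1 : R) (fun s => F (p s h) : R^o) (Fa (p s h)).
  move=> /andP[s0 sh].
  have sd : 0 <= s <= d by rewrite s0 (le_trans sh).
  have hd0 : 0 <= h <= d by rewrite h0.
  exact: (proj1 (@is_derive_line R V R^o F (h *: b + x) a _ s) (Fd sd hd0)).
have D2 (s : R) : 0 <= s <= h -> is_derive s (1 : R) (fun s => F (p s 0) : R^o) (Fa (p s 0)).
  move=> /andP[s0 sh].
  have sd : 0 <= s <= d by rewrite s0 (le_trans sh).
  have hd0 : 0 <= (0 : R) <= d by apply/andP; split=> //; exact: le_trans h0 hd.
  exact: (proj1 (@is_derive_line R V R^o F (0 *: b + x) a _ s) (Fd sd hd0)).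
have [s|s /andP[s0 sh]] := @mvt_closed
  (fun s => F (p s h) - F (p s 0)) (fun s => Fa (p s h) - Fa (p s 0)) 0 h h0.
  by move=> sh; exact: (is_deriveB (D1 s sh) (D2 s sh)).
rewrite subr0 => ->.
have D3 (t : R) : 0 <= t <= h -> is_derive t (1 : R) (fun t => Fa (p s t) : R^o) (Fab (p s t)).
  move=> /andP[t0 th].
  have -> : (fun t => Fa (p s t)) = (fun t => Fa (t *: b + (s *: a + x))).
    by apply/funext => u; rewrite /p addrCA.
  have sd : 0 <= s <= d by rewrite s0 (le_trans sh).
  have td : 0 <= t <= d by rewrite t0 (le_trans th).
  have := Fad sd td; rewrite /p addrCA.
  exact: (proj1 (@is_derive_line R V R^o Fa (s *: a + x) b _ t)).
have [t /andP[t0 th]] := mvt_closed h0 D3.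
rewrite subr0 => ->; exists s, t; split; rewrite ?s0 ?t0//.
by move: (Fab _) => z; ring.
Qed.

End Schwarz.

Lemma near_segments {V : normedModType R} (a b x : V) (P : V -> Prop) :
  (\forall y \near x, P y) -> exists2 d : R, 0 < d &
    forall s t, 0 <= s <= d -> 0 <= t <= d -> P (s *: a + (t *: b + x)).
Proof.
move=> /nbhs_normP[e /= e0 he].
(* The summand 1 allows the division also when a and b are both 0. *)
have c0 : 0 < `|a| + `|b| + 1 by rewrite ltr_wpDl// addr_ge0.
exists (e / 2 / (`|a| + `|b| + 1)); first by rewrite !divr_gt0.
move=> s t /andP[s0 sd] /andP[t0 td]; apply: he => /=.
rewrite (_ : x - _ = - (s *: a + t *: b)); last first.
  by rewrite addrA opprD addrCA subrr addr0.
rewrite normrN (le_lt_trans (ler_normD _ _))// !normrZ !ger0_norm//.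
have ea : s * `|a| + t * `|b| <= e / 2 / (`|a| + `|b| + 1) * (`|a| + `|b|).
  by rewrite mulrDr lerD// ler_wpM2r.
apply: le_lt_trans ea _; rewrite -mulrA.
apply: (@lt_le_trans _ _ (e / 2 * 2)); last by rewrite divfK.
rewrite ltr_pM2l ?divr_gt0//.
apply: (@le_lt_trans _ _ 1) => //; first by rewrite mulrC ler_pdivrMr// mul1r lerDl.
by rewrite ltr1n.
Qed.

Lemma schwarz_real {V : normedModType R} (F Fa Fb Fab Fba : V -> R) (a b x : V) :
  (\forall y \near x, [/\ is_derive y a (F : V -> R^o) (Fa y),
     is_derive y b (F : V -> R^o) (Fb y), is_derive y b (Fa : V -> R^o) (Fab y) &
     is_derive y a (Fb : V -> R^o) (Fba y)]) ->
  {for x, continuous Fab} -> {for x, continuous Fba} -> Fab x = Fba x.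
Proof.
move=> Fd cab cba; apply/eqP; rewrite -subr_eq0; apply/eqP/le_eps_eq0 => e e0.
have e2 : 0 < e / 2 by rewrite divr_gt0.
have nab : \forall y \near x, `|Fab x - Fab y| < e / 2 by move/cvgrPdist_lt: cab; apply.
have nba : \forall y \near x, `|Fba x - Fba y| < e / 2 by move/cvgrPdist_lt: cba; apply.
have [d d0 hd] := near_segments a b (filterI Fd (filterI nab nba)).
have dd : 0 <= d <= d by rewrite lexx ltW.
have [s [t [sd td E1]]] : exists s t, [/\ 0 <= s <= d, 0 <= t <= d &
    F (d *: a + (d *: b + x)) - F (d *: a + (0 *: b + x)) -
    (F (0 *: a + (d *: b + x)) - F (0 *: a + (0 *: b + x))) =
    d ^+ 2 * Fab (s *: a + (t *: b + x))].
  by apply: (@double_mean_value V F Fa Fab a b x d _ _ d dd) => s t sd td;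
    have [[]] := hd s t sd td.
have [t' [s' [td' sd' E2]]] : exists s t, [/\ 0 <= s <= d, 0 <= t <= d &
    F (d *: b + (d *: a + x)) - F (d *: b + (0 *: a + x)) -
    (F (0 *: b + (d *: a + x)) - F (0 *: b + (0 *: a + x))) =
    d ^+ 2 * Fba (s *: b + (t *: a + x))].
  by apply: (@double_mean_value V F Fb Fba b a x d _ _ d dd) => s' t' sd' td';
    rewrite addrCA; have [[]] := hd t' s' td' sd'.
have {E1 E2} E : Fab (s *: a + (t *: b + x)) = Fba (s' *: a + (t' *: b + x)).
  rewrite addrCA; apply: (@mulfI _ (d ^+ 2)); first by rewrite expf_neq0// gt_eqF.
  rewrite addrCA -E1 [in RHS]addrCA -E2 !scale0r !add0r (addrCA (d *: a)).
  by rewrite !opprB addrACA [RHS]addrACA; congr (_ + _); rewrite addrC.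
have [_ [h1 _]] := hd s t sd td; have [_ [_ h2]] := hd s' t' sd' td'.
rewrite (_ : _ - _ = (Fab x - Fab (s *: a + (t *: b + x))) -
    (Fba x - Fba (s' *: a + (t' *: b + x)))); last by rewrite E; ring.
by rewrite (le_trans (ler_normB _ _))// (splitr e) lerD ?ltW.
Qed.

End MeanValue.



Section HSCalculus.
Context {R : realType} {H : lmodType R[i]}.
Variable ip : {dot H for Num.conj}.

Lemma hsip_bilinear : bounded_bilinear (fun T U : hs ip => hsip T U : R^o).
Proof.
split=> *; rewrite ?hsipDl ?hsipDr ?hsipZl ?hsipZr//.
by exists 1 => T U; rewrite mul1r hsip_le.
Qed.

Lemma hsip_linear (U : hs ip) : bounded_linear (fun T : hs ip => hsip T U : R^o).
Proof.
split=> *; rewrite ?hsipDl ?hsipZl//.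
by exists `|U| => T; rewrite mulrC hsip_le.
Qed.

Lemma hcomp_bilinear : bounded_bilinear (@hcomp R H ip).
Proof.
split.
- by move=> S S' T; apply: hs_ext => x; rewrite hsD !hcompE hsD.
- by move=> c S T; apply: hs_ext => x; rewrite hsZ !hcompE hsZ.
- by move=> S T T'; apply: hs_ext => x; rewrite hsD !hcompE hsD hs_addr.
- by move=> c S T; apply: hs_ext => x; rewrite hsZ !hcompE hsZ hs_scaler.
- by exists 1 => S T; rewrite mul1r hcomp_le.
Qed.

Lemma hmulr_linear P : orth_proj ip P -> bounded_linear (@hmulr R H ip P).
Proof.
move=> PP; split=> *; [exact: hmulr_add|exact: hmulr_scale|].
by exists 1 => T; rewrite mul1r hmulr_le.
Qed.

Lemma scale_bilinear : bounded_bilinear (fun (c : R^o) (T : hs ip) => c *: T).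
Proof.
split=> *; rewrite ?scalerDl ?scalerDr ?scalerA//; first by rewrite mulrC.
by exists 1 => c T; rewrite mul1r normrZ.
Qed.

Definition rip (x y : H) : R := complex.Re (ip x y).

Lemma ripDl x y z : rip (x + y) z = rip x z + rip y z.
Proof. by rewrite /rip ipDl ReD. Qed.

Lemma ripDr x y z : rip z (x + y) = rip z x + rip z y.
Proof. by rewrite /rip ipDr ReD. Qed.

Lemma ripZl (c : R) x y : rip (c%:C *: x) y = c * rip x y.
Proof. by rewrite /rip ipZl Re_realM. Qed.

Lemma ripC x y : rip x y = rip y x.
Proof. by rewrite /rip ip_conj Re_conj. Qed.

Lemma ripZr (c : R) x y : rip y (c%:C *: x) = c * rip y x.
Proof. by rewrite ripC ripZl ripC. Qed.

Lemma ripNl x y : rip (- x) y = - rip x y.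
Proof. by rewrite /rip (ipNl ip) ReN. Qed.

Lemma ripNr x y : rip y (- x) = - rip y x.
Proof. by rewrite ripC ripNl ripC. Qed.

Lemma rip_ge0 x : 0 <= rip x x. Proof. exact: dot_ge0. Qed.

Lemma rip_cauchy x y : `|rip x y| <= Num.sqrt (rip x x) * Num.sqrt (rip y y).
Proof.
have sqr t : 0 <= rip x x - 2 * t * rip x y + t ^+ 2 * rip y y.
  have := rip_ge0 (x - t%:C *: y).
  rewrite !(ripDl, ripDr, ripNl, ripNr, ripZl, ripZr) (ripC y x).
  by move=> h; rewrite (le_trans h)// le_eqVlt; apply/orP; left; apply/eqP; ring.
rewrite -sqrtrM ?rip_ge0// -sqrtr_sqr ler_wsqrtr//.
have [y0|y0] := eqVneq (rip y y) 0.
  have [->|xy0] := eqVneq (rip x y) 0.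
    by rewrite expr0n mulr_ge0 ?rip_ge0.
  have := sqr ((rip x x + 1) / (2 * rip x y)); rewrite y0 mulr0 addr0.
  rewrite (_ : 2 * _ * _ = rip x x + 1); last by field.
  by rewrite opprD addrA subrr sub0r oppr_ge0 real_leNgt ?num_real// ltr01.
have y1 : 0 < rip y y by rewrite lt_neqAle eq_sym y0 rip_ge0.
have := sqr (rip x y / rip y y); rewrite -(ler_pM2r y1) mul0r => h.
rewrite -subr_ge0 (le_trans h)// le_eqVlt; apply/orP; left; apply/eqP; field.
exact: y0.
Qed.

Lemma hs_rip_bound (T : hs ip) x : Num.sqrt (rip (T x) (T x)) <= `|T| * Num.sqrt (rip x x).
Proof.
apply: le_trans (ler_wsqrtr (hs_bound T x)) _.
by rewrite sqrtrM ?sqr_ge0// sqrtr_sqr normr_id.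
Qed.

Lemma rip_eval_linear a b : bounded_linear (fun T : hs ip => rip (T a) b : R^o).
Proof.
split=> [S T|c T|]; rewrite ?ripDl ?ripZl//.
exists (Num.sqrt (rip a a) * Num.sqrt (rip b b)) => T.
rewrite (le_trans (rip_cauchy _ _))// [leRHS]mulrAC.
by rewrite ler_wpM2r ?sqrtr_ge0// mulrC hs_rip_bound.
Qed.

Lemma rip_eval_bilinear a b :
  bounded_bilinear (fun S T : hs ip => rip (S a) (T b) : R^o).
Proof.
split=> *; rewrite ?ripDl ?ripDr ?ripZl ?ripZr//.
exists (Num.sqrt (rip a a) * Num.sqrt (rip b b)) => S T.
rewrite (le_trans (rip_cauchy _ _))// [leRHS]mulrC mulrACA.
by rewrite ler_pM ?sqrtr_ge0 ?hs_rip_bound.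
Qed.

Lemma rip_ext x y : (forall z, rip x z = rip y z) -> x = y.
Proof.
move=> xy; apply/eqP; rewrite -subr_eq0 -(dnorm_eq0 ip).
have := xy (x - y) => /eqP; rewrite -subr_eq0 -ripNl -ripDl /rip.
have := dnorm_ge0 ip (x - y); case: (ip _ _) => u v; rewrite lecE /=.
by move=> /andP[/eqP -> _] /eqP ->.
Qed.

(** Pairing everything with the difference U of the two mixed derivatives reduces to the real case,
    which gives |U|^2 = 0. *)
Lemma schwarz (V : normedModType R) (f fa fb fab fba : V -> hs ip) (a b x : V) :
  (\forall y \near x, [/\ is_derive y a f (fa y), is_derive y b f (fb y),
     is_derive y b fa (fab y) & is_derive y a fb (fba y)]) ->
  {for x, continuous fab} -> {for x, continuous fba} -> fab x = fba x.
Proof.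
move=> fd cab cba; apply/eqP; rewrite -subr_eq0 -normr_eq0 -sqrf_eq0 -hsip_norm.
set U := fab x - fba x; have lU := hsip_linear U.
rewrite {1}/U hsipDl hsipNl subr_eq0; apply/eqP.
apply: (@schwarz_real R V (fun y => hsip (f y) U) (fun y => hsip (fa y) U)
  (fun y => hsip (fb y) U) (fun y => hsip (fab y) U) (fun y => hsip (fba y) U) a b x).
- apply: filterS fd => y [h1 h2 h3 h4].
  by split; apply: (is_derive_linear lU).
- exact: (blin_cvg lU cab).
- exact: (blin_cvg lU cba).
Qed.

(** A mean value equality is available for real functions only; it is applied to the pairing of f
    with U = f 1 - f 0. *)
Lemma mean_value_ineq (f df : R -> hs ip) (C : R) :
  (forall t : R, 0 <= t <= 1 -> is_derive t 1 f (df t)) ->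
  (forall t : R, 0 <= t <= 1 -> `|df t| <= C) -> `|f 1 - f 0| <= C.
Proof.
move=> fd fC; set U := f 1 - f 0; have lU := hsip_linear U.
have [c c01 E] := @mvt_closed R (fun t => hsip (f t) U) (fun t => hsip (df t) U)
  0 1 ler01 (fun (t : R) t01 => is_derive_linear lU (fd t t01)).
have {E} UE : `|U| ^+ 2 = hsip (df c) U.
  by rewrite -hsip_norm {1}/U hsipDl hsipNl E subr0 mulr1.
have [->|U0] := eqVneq U 0; first by rewrite normr0 (le_trans (normr_ge0 (df c))) ?fC.
have {}U0 : 0 < `|U| by rewrite normr_gt0.
rewrite -(ler_pM2r U0) -expr2 UE (le_trans (ler_norm _))//.
by rewrite (le_trans (hsip_le _ _))// ler_wpM2r// fC.
Qed.

(** Only the two coordinate directions and the first order are asked for: fields cut off by bump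
    functions are of this kind, whereas [smooth_on] demands all orders. *)
Definition C1_at (f : R * R -> hs ip) (v : R * R) : Prop :=
  [/\ \forall y \near v, derivable f y (1, 0) /\ derivable f y (0, 1),
      {for v, continuous ('D_(1, 0) f)} & {for v, continuous ('D_(0, 1) f)}].

Lemma is_derive_scale (V W : normedModType R) (f : V -> W) (x v : V) (c : R) (d : W) :
  is_derive x v f d -> is_derive x (c *: v) f (c *: d).
Proof.
have [->|c0] := eqVneq c 0; first by rewrite !scale0r => _; exact: is_derive0.
move=> /is_deriveP fd; apply/is_deriveP.
have k0 : (h : R) * c @[h --> 0^'] --> (0 : R)^'.
  move=> A /= /nbhs_normP[e /= e0 he]; apply/nbhs_normP => /=.
  exists (e / `|c|); first by rewrite /= divr_gt0// normr_gt0.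
  move=> h /=; rewrite sub0r normrN => hc h0; apply: he; last by rewrite mulf_neq0.
  by rewrite /= sub0r normrN normrM -ltr_pdivlMr// normr_gt0.
pose proof (@cvgZl_tmp _ _ _ _ _ c _ _ (cvg_comp _ _ k0 fd)) as cfd.
refine (cvg_near _ cfd); near=> h => /=.
by rewrite scalerA invfM mulrCA mulfV// mulr1 -scalerA.
Unshelve. all: by end_near. Qed.

Lemma is_derive_segment (f : R * R -> hs ip) (y w : R * R) (d D : hs ip) (t : R) :
  is_derive (t *: w + y) w f d ->
  is_derive t (1 : R) (fun s => f (s *: w + y) - s *: D) (d - D).
Proof.
move=> fd; have h1 := proj1 (is_derive_line f y w d t) fd.
apply: (is_deriveB h1).
have h2 := is_derive_bilinear scale_bilinear (is_derive_id t (1 : R^o)) (is_derive_cst D t (1 : R^o)).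
by move: h2; rewrite scaler0 addr0 scale1r.
Qed.

Lemma pair_ext (T U : Type) (a b : T * U) : a.1 = b.1 -> a.2 = b.2 -> a = b.
Proof. by case: a b => ? ? [? ?] /= -> ->. Qed.

(** The increment is split into a horizontal and a vertical segment; on each, f minus its linear
    part at v has a small derivative, and [mean_value_ineq] applies. *)
Lemma C1_at_total (f : R * R -> hs ip) (v : R * R) (e : R) : C1_at f v -> 0 < e ->
  \forall w \near (0 : R * R),
    `|f (w + v) - f v - (w.1 *: 'D_(1, 0) f v + w.2 *: 'D_(0, 1) f v)| <= e * `|w|.
Proof.
move=> [fd c1 c2] e0; have e2 : 0 < e / 2 by rewrite divr_gt0.
have n1 : \forall y \near v, `|'D_(1, 0) f v - 'D_(1, 0) f y| < e / 2.
  by move/cvgrPdist_lt: c1; apply.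
have n2 : \forall y \near v, `|'D_(0, 1) f v - 'D_(0, 1) f y| < e / 2.
  by move/cvgrPdist_lt: c2; apply.
pose proof (filterI fd (filterI n1 n2)) as hd.
move: hd => /nbhs_normP[d /= d0 hd].
apply/nbhs_normP; exists d => //= w; rewrite /= sub0r normrN => wd.
have w1 : `|w.1| <= `|w| by rewrite prod_normE le_max lexx.
have w2 : `|w.2| <= `|w| by rewrite prod_normE le_max lexx orbT.
have near_v (s t : R) : 0 <= s <= 1 -> 0 <= t <= 1 ->
    ball_ Num.norm v d (s *: (w.1, 0) + (t *: (0, w.2) + v)).
  move=> /andP[s0 s1] /andP[t0 t1] /=; rewrite prod_normE /=.
  apply: le_lt_trans wd; rewrite ge_max !scaler0 !add0r; apply/andP; split.
    rewrite opprD addrCA subrr addr0 normrN normrZ ger0_norm//.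
    by rewrite (le_trans _ w1)// ler_piMl.
  rewrite opprD addrCA subrr addr0 normrN normrZ ger0_norm//.
  by rewrite (le_trans _ w2)// ler_piMl.
have i0 : 0 <= (0 : R) <= 1 by rewrite lexx ler01.
have i1 : 0 <= (1 : R) <= 1 by rewrite lexx ler01.
pose D1 := 'D_(1, 0) f v; pose D2 := 'D_(0, 1) f v.
have w1E : (w.1, 0) = w.1 *: (1, 0) :> R * R.
  by apply: pair_ext; [exact/esym/mulr1|exact/esym/mulr0].
have w2E : (0, w.2) = w.2 *: (0, 1) :> R * R.
  by apply: pair_ext; [exact/esym/mulr0|exact/esym/mulr1].
have hd1 (t : R) : 0 <= t <= 1 -> derivable f (t *: (w.1, 0) + ((0, w.2) + v)) (1, 0) /\
    `|D1 - 'D_(1, 0) f (t *: (w.1, 0) + ((0, w.2) + v))| <= e / 2.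
  move=> t01; have := near_v t 1 t01 i1.
  by rewrite scale1r => /hd[[h _] [/ltW h' _]]; exact: conj h h'.
have hd2 (t : R) : 0 <= t <= 1 -> derivable f (t *: (0, w.2) + v) (0, 1) /\
    `|D2 - 'D_(0, 1) f (t *: (0, w.2) + v)| <= e / 2.
  move=> t01; have := near_v 0 t i0 t01.
  by rewrite scale0r add0r => /hd[[_ h] [_ /ltW h']]; exact: conj h h'.
clear hd near_v.
have b1 : `|f ((w.1, 0) + ((0, w.2) + v)) - f ((0, w.2) + v) - w.1 *: D1| <= e / 2 * `|w|.
  have := @mean_value_ineq (fun s => f (s *: (w.1, 0) + ((0, w.2) + v)) - s *: (w.1 *: D1))
    (fun s => w.1 *: 'D_(1, 0) f (s *: (w.1, 0) + ((0, w.2) + v)) - w.1 *: D1) (e / 2 * `|w|).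
  rewrite !scale1r !scale0r subr0 add0r (addrAC _ (- f _)); apply.
    move=> t t01; apply: is_derive_segment; rewrite {2}w1E; apply: is_derive_scale.
    exact: (derivableP (proj1 (hd1 t t01))).
  move=> t t01; rewrite -scalerBr normrZ mulrC ler_pM//.
  by rewrite distrC; exact: (proj2 (hd1 t t01)).
have b2 : `|f ((0, w.2) + v) - f v - w.2 *: D2| <= e / 2 * `|w|.
  have := @mean_value_ineq (fun s => f (s *: (0, w.2) + v) - s *: (w.2 *: D2))
    (fun s => w.2 *: 'D_(0, 1) f (s *: (0, w.2) + v) - w.2 *: D2) (e / 2 * `|w|).
  rewrite !scale1r !scale0r subr0 add0r (addrAC _ (- f _)); apply.
    move=> t t01; apply: is_derive_segment; rewrite {2}w2E; apply: is_derive_scale.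
    exact: (derivableP (proj1 (hd2 t t01))).
  move=> t t01; rewrite -scalerBr normrZ mulrC ler_pM//.
  by rewrite distrC; exact: (proj2 (hd2 t t01)).
clear hd1 hd2.
have -> : w + v = (w.1, 0) + ((0, w.2) + v).
  rewrite addrA; congr (_ + _).
  by apply: pair_ext; rewrite /= ?addr0 ?add0r.
rewrite (_ : _ - _ - _ = (f ((w.1, 0) + ((0, w.2) + v)) - f ((0, w.2) + v) - w.1 *: D1)
    + (f ((0, w.2) + v) - f v - w.2 *: D2)); last first.
  by rewrite opprD [RHS]addrACA [in RHS](addrA (_ - _)) subrK.
apply: le_trans (ler_normD _ _) _; rewrite [in leRHS](splitr e) mulrDl.
exact: lerD b1 b2.
Qed.

(** Serves for changes of charts, where the curve is the image of a real line under a holomorphic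
    transition. [C1_at_total] makes the remainder small against |w h|, and |w h| / |h| stays below
    [K]. *)
Lemma is_derive_curve (f : R * R -> hs ip) (c1 c2 : R -> R) (a1 a2 : R) :
  C1_at f (c1 0, c2 0) ->
  is_derive (0 : R) 1 (c1 : R -> R^o) a1 -> is_derive (0 : R) 1 (c2 : R -> R^o) a2 ->
  is_derive (0 : R) 1 (fun t : R => f (c1 t, c2 t))
    (a1 *: 'D_(1, 0) f (c1 0, c2 0) + a2 *: 'D_(0, 1) f (c1 0, c2 0)).
Proof.
move=> fC1 d1 d2; apply/is_deriveP; set v := (c1 0, c2 0).
set D1 := 'D_(1, 0) f v; set D2 := 'D_(0, 1) f v.
pose w (h : R) : R * R := (c1 h - c1 0, c2 h - c2 0).
have cc1 := is_derive_line_cvg d1; have cc2 := is_derive_line_cvg d2.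
move/is_deriveP: d1 => d1; move/is_deriveP: d2 => d2.
have hE (h : R) : h *: 1 + 0 = h by rewrite addr0; exact: mulr1.
have c1c : (c1 h : R^o) @[h --> 0^'] --> (c1 0 : R^o).
  by move: cc1; under eq_fun do rewrite hE.
have c2c : (c2 h : R^o) @[h --> 0^'] --> (c2 0 : R^o).
  by move: cc2; under eq_fun do rewrite hE.
have {}d1 : h^-1 *: (c1 h - c1 0 : R^o) @[h --> 0^'] --> (a1 : R^o).
  by move: d1; under eq_fun do rewrite hE.
have {}d2 : h^-1 *: (c2 h - c2 0 : R^o) @[h --> 0^'] --> (a2 : R^o).
  by move: d2; under eq_fun do rewrite hE.
clear cc1 cc2.
have w0 : w h @[h --> 0^'] --> (0 : R * R).
  apply/cvgr0Pnorm_lt => e e0.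
  move/cvgrPdist_lt: c1c => /(_ e e0) k1; move/cvgrPdist_lt: c2c => /(_ e e0) k2.
  near=> h; rewrite prod_normE gt_max; apply/andP; split; rewrite distrC.
    by near: h.
  by near: h.
have q0 : h^-1 *: (f (c1 h, c2 h) - f v - ((w h).1 *: D1 + (w h).2 *: D2))
    @[h --> 0^'] --> (0 : hs ip).
  apply/cvgr0Pnorm_lt => e e0.
  pose K := `|a1| + 1 + (`|a2| + 1).
  have K0 : 0 < K by rewrite addr_gt0// ltr_wpDl.
  have tot := C1_at_total fC1 (divr_gt0 e0 K0).
  have b1 : `|a1| < `|a1| + 1 by rewrite ltrDl.
  have b2 : `|a2| < `|a2| + 1 by rewrite ltrDl.
  pose proof (cvgr_norm_lt _ d1 _ b1) as n1; pose proof (cvgr_norm_lt _ d2 _ b2) as n2.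
  have nt := w0 _ tot.
  near=> h.
  have wh : `|f (w h + v) - f v - ((w h).1 *: D1 + (w h).2 *: D2)| <= e / K * `|w h|.
    by near: h.
  have wv : w h + v = (c1 h, c2 h) by apply: pair_ext; rewrite /= subrK.
  have k1 : `|h^-1 *: (c1 h - c1 0 : R^o)| < `|a1| + 1 by near: h.
  have k2 : `|h^-1 *: (c2 h - c2 0 : R^o)| < `|a2| + 1 by near: h.
  rewrite wv in wh; rewrite normrZ.
  apply: (le_lt_trans (ler_wpM2l (normr_ge0 _) wh)).
  rewrite mulrCA -[ltRHS](divfK (lt0r_neq0 K0)).
  rewrite ltr_pM2l ?divr_gt0// /K.
  apply: le_lt_trans (ltrD k1 k2); rewrite !normrZ -mulrDr ler_wpM2l//.
  by rewrite prod_normE ge_max /w /= lerDl lerDr !normr_ge0.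
pose proof (cvgD q0 (cvgD (cvgZr_tmp (a := D1) d1) (cvgZr_tmp (a := D2) d2))) as L; rewrite add0r in L.
refine (cvg_near _ L); near=> h; rewrite !addrfctE hE.
rewrite -!scalerA -!scalerDr; congr (_ *: _).
by rewrite subrK.
Unshelve. all: by end_near. Qed.

End HSCalculus.


(** * Classes of smooth maps on an open set *)

Section SmoothOn.
Context {R : realType} {V W : normedModType R}.
Variable O : set V.

Lemma smooth_on_derive (f : V -> W) e : smooth_on O f -> smooth_on O ('D_e f).
Proof. by move=> [S [Sf h]]; exists S; split=> //; have [_ /(_ e)[]] := h f Sf. Qed.

Lemma smooth_on_continuous (f : V -> W) x : smooth_on O f -> O x ->
  {for x, continuous f}.
Proof. by move=> [S [Sf h]] Ox; have [c _] := h f Sf; exact: c. Qed.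

Lemma smooth_on_is_derive (f : V -> W) x e : smooth_on O f -> O x ->
  is_derive x e f ('D_e f x).
Proof.
by move=> [S [Sf h]] Ox; have [_ /(_ e)[_ d]] := h f Sf; exact/derivableP/d.
Qed.

Lemma smooth_on_cst (a : W) : smooth_on O (fun=> a).
Proof.
exists (range (fun a : W => (fun _ : V => a))); split; first by exists a.
move=> _ [b _ <-]; split=> [x _|v]; first exact: cvg_cst.
split=> [|x _]; last exact: derivable_cst.
by exists 0 => //; apply/funext => x; rewrite derive_cst.
Qed.

Lemma smooth_on_add (f g h : V -> W) : open O -> smooth_on O f -> smooth_on O g ->
  (forall x, O x -> h x = f x + g x) -> smooth_on O h.
Proof.
move=> oO [S [Sf hS]] [S' [S'g hS']] hfg.
(* The sum formula is required on [O] only: nothing is known of [h] elsewhere, and openness of [O]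
   lets the formula pass to derivatives at its points. *)
exists [set k | exists p q, [/\ S p, S' q & forall x, O x -> k x = p x + q x]].
split; first by exists f, g.
move=> k [p [q [Sp S'q kE]]].
have kn x : O x -> \forall y \near x, p y + q y = k y.
  by move=> Ox; near=> y; rewrite kE//; near: y; exact: open_nbhs_nbhs.
split=> [x Ox|v].
  have := cvgD ((hS p Sp).1 x Ox) ((hS' q S'q).1 x Ox).
  rewrite -(kE x Ox) => pq; exact: (cvg_near (kn x Ox) (pq _)).
have kd x : O x -> is_derive x v k ('D_v p x + 'D_v q x).
  move=> Ox; apply: (is_derive_near (kn x Ox)).
  apply: is_deriveD; apply: derivableP.
    by have [_ /(_ v)[_]] := hS p Sp; exact.
  by have [_ /(_ v)[_]] := hS' q S'q; exact.
split; last by move=> x /kd[].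
exists ('D_v p), ('D_v q); split.
- by have [_ /(_ v)[]] := hS p Sp.
- by have [_ /(_ v)[]] := hS' q S'q.
- by move=> x /kd h'; exact: derive_val.
Unshelve. all: by end_near. Qed.

Lemma smooth_on_sum I (s : seq I) (P : pred I) (f : I -> V -> W) : open O ->
  (forall i, smooth_on O (f i)) -> smooth_on O (fun x => \sum_(i <- s | P i) f i x).
Proof.
move=> oO fs; elim: s => [|i s IH].
  by under eq_fun do rewrite big_nil; exact: smooth_on_cst.
have [Pi|Pi] := boolP (P i).
  by apply: (smooth_on_add oO (fs i) IH) => x _; rewrite big_cons Pi.
by under eq_fun do rewrite big_cons (negbTE Pi).
Qed.

Lemma smooth_on_ext (f g : V -> W) : open O -> smooth_on O f ->
  (forall x, O x -> g x = f x) -> smooth_on O g.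
Proof.
move=> oO fs gf; apply: (smooth_on_add oO fs (smooth_on_cst 0)) => x Ox.
by rewrite addr0 gf.
Qed.

End SmoothOn.

(** * Derivatives of moving projections *)

Section ProjectionDerivative.
Context {R : realType} {H : lmodType R[i]}.
Variable ip : {dot H for Num.conj}.

(** The vectors a + S u x stand for values of a moving projection whose fixed part has the value a;
    only scalar products of such values are differentiated. *)
Lemma is_derive_rip (V : normedModType R) (S T : V -> hs ip) (v e : V)
    (dS dT : hs ip) (a b x y : H) :
  is_derive v e S dS -> is_derive v e T dT ->
  is_derive v e (fun u => rip ip (a + S u x) (b + T u y) : R^o)
    (rip ip (dS x) (b + T v y) + rip ip (a + S v x) (dT y)).
Proof.
move=> Sd Td.
have h1 := is_derive_linear (rip_eval_linear ip x b) Sd.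
have h2 := is_derive_linear (rip_eval_linear ip y a) Td.
have h3 := is_derive_bilinear (rip_eval_bilinear ip x y) Sd Td.
have h := is_deriveD (is_deriveD (is_derive_cst (rip ip a b : R^o) v e) h1) (is_deriveD h2 h3).
apply: is_derive_eq; first apply: is_derive_near h.
  near=> u; rewrite !addrfctE /cst !(ripDl, ripDr) (ripC _ (T u y) a).
  by rewrite -!addrA; congr (_ + _); rewrite addrCA.
rewrite add0r !(ripDl, ripDr) (ripC _ (dT y) a) -!addrA; congr (_ + _).
by rewrite addrCA.
Unshelve. all: by end_near. Qed.

Lemma is_derive_unique (V W : normedModType R) (f g : V -> W) (v e : V) (d d' : W) :
  (\forall u \near v, f u = g u) ->
  is_derive v e f d -> is_derive v e g d' -> d = d'.
Proof.
move=> fg fd gd; have fd' := is_derive_near fg fd.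
by rewrite -(@derive_val _ _ _ _ _ _ _ fd') (@derive_val _ _ _ _ _ _ _ gd).
Qed.

Variable V : normedModType R.

(** A moving projection as a fixed operator plus a Hilbert-Schmidt perturbation; only the
    perturbation takes values in the normed space [hs] and has a derivative there. *)
Definition proj_at (p : H -> H) (T : V -> hs ip) (v : V) (x : H) : H := p x + T v x.

Lemma derive_selfadjoint (p : H -> H) (T : V -> hs ip) (v e : V) (X : hs ip) :
  orth_proj ip p -> (\forall u \near v, orth_proj ip (proj_at p T u)) ->
  is_derive v e T X -> forall x y, rip ip (X x) y = rip ip x (X y).
Proof.
move=> [_ sp _] PP Td x y.
rewrite (ripC _ x); apply: (is_derive_unique (V := V) (W := R^o) _
  (is_derive_linear (rip_eval_linear ip x y) Td)
  (is_derive_linear (rip_eval_linear ip y x) Td)).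
apply: filterS PP => u [_ sP _].
have := congr1 (@complex.Re R) (sP x y); rewrite -!/(rip _ _ _) ripDl ripDr.
rewrite (_ : rip ip (p x) y = rip ip x (p y)) ?(ripC _ x (T u y)); last first.
  by rewrite /rip sp.
exact: addrI.
Qed.

(** Leibniz rule for Q P = 0, tested in the form <P x, Q z> = 0. *)
Lemma derive_orthogonal (p q : H -> H) (S T : V -> hs ip) (v e : V) (X Y : hs ip) :
  (\forall u \near v, [/\ orth_proj ip (proj_at p S u),
     orth_proj ip (proj_at q T u) &
     forall x, proj_at q T u (proj_at p S u x) = 0]) ->
  orth_proj ip q ->
  is_derive v e S X -> is_derive v e T Y ->
  forall x, proj_at q T v (X x) + Y (proj_at p S v x) = 0.
Proof.
move=> PQ q0 Sd Td x; apply: (@rip_ext _ _ ip) => z.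
have sY : forall x y, rip ip (Y x) y = rip ip x (Y y).
  by apply: derive_selfadjoint q0 _ Td; apply: filterS PQ => u [].
have [_ [_ sT _] _] := nbhs_singleton PQ.
have := is_derive_unique (V := V) (W := R^o) _ (is_derive_rip (p x) (q z) x z Sd Td)
  (is_derive_cst (0 : R^o) v e).
rewrite -/(proj_at p S v x) -/(proj_at q T v z) => h.
rewrite ripDl /rip sT -/(rip _ _ _) -/(rip _ _ _) sY h; last first.
  near=> u.
  have [_ [_ sTu _] PQu] : [/\ orth_proj ip (proj_at p S u),
     orth_proj ip (proj_at q T u) & forall x, proj_at q T u (proj_at p S u x) = 0].
    by near: u.
  by rewrite -/(proj_at p S u x) -/(proj_at q T u z) /rip -sTu PQu linear0l.
by rewrite /rip linear0l.
Unshelve. all: by end_near. Qed.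

(** Leibniz rule for P P = P, tested in the form <P x, P z> = <P x, z>: the velocity of a projection
    has no diagonal blocks. *)
Lemma derive_offdiag (p : H -> H) (T : V -> hs ip) (v e : V) (X : hs ip) :
  (\forall u \near v, orth_proj ip (proj_at p T u)) -> orth_proj ip p ->
  is_derive v e T X ->
  forall x, X x = proj_at p T v (X x) + X (proj_at p T v x).
Proof.
move=> PP p0 Td x; apply: (@rip_ext _ _ ip) => z.
have sX := derive_selfadjoint p0 PP Td.
have [_ sT _] := nbhs_singleton PP.
have := is_derive_unique (V := V) (W := R^o) _ (is_derive_rip (p x) (p z) x z Td Td)
  (is_derive_rip (p x) z x z Td (is_derive_cst (0 : hs ip) v e)).
rewrite /= addr0 (_ : rip ip _ 0 = 0) ?addr0; last by rewrite /rip linear0r.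
rewrite -/(proj_at p T v x) -/(proj_at p T v z) => <-; last first.
  near=> u.
  have [_ sPu PPu] : orth_proj ip (proj_at p T u) by near: u.
  by rewrite ?addr0 -/(proj_at p T u x) -/(proj_at p T u z) /rip -sPu PPu.
rewrite ripDl; congr (_ + _); last by rewrite sX.
by rewrite /rip -sT.
Unshelve. all: by end_near. Qed.

End ProjectionDerivative.


(** * Flags of projections satisfying the J2 equations *)

Section UnitScalars.
Context {R : realType} {H : lmodType R[i]}.
Variable ip : {dot H for Num.conj}.

(** [Jc b] is i times [sgnb b]. The boolean records whether a block is of type (1,0), and the J2
    equation says that its y-derivative is [Jc b] times its x-derivative. *)
Definition Jc (b : bool) : R[i] := if b then 0 +i* 1 else 0 -i* 1.
Definition sgnb (b : bool) : R := if b then 1 else -1.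

Lemma rip_JJ b c x y : rip ip (Jc b *: x) (Jc c *: y) = sgnb b * sgnb c * rip ip x y.
Proof.
rewrite /rip ipZl ipZr; case: (ip x y) => u v.
by case: b; case: c => /=; ring.
Qed.

Lemma Jc_mul b c : Jc b * Jc c = (- (sgnb b * sgnb c))%:C.
Proof. by case: b; case: c; apply/eqP; rewrite eq_complex /=; apply/andP; split; apply/eqP; ring. Qed.

Lemma rip_J2 b c x y : rip ip (Jc b *: (Jc c *: x)) y = - (sgnb b * sgnb c) * rip ip x y.
Proof. by rewrite scalerA Jc_mul ripZl. Qed.

Lemma rip_ip (x y : H) : ip x y = (rip ip x y) +i* (rip ip x (Jc true *: y)).
Proof. by rewrite /rip ipZr; case: (ip x y) => u v /=; congr (_ +i* _); ring. Qed.

(** Replacing y by i y recovers the imaginary part, T being complex linear. *)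
Lemma selfadjoint_ip (T : hs ip) : (forall x y, rip ip (T x) y = rip ip x (T y)) ->
  forall x y, ip (T x) y = ip x (T y).
Proof. by move=> h x y; rewrite !rip_ip !h hs_scaler. Qed.

Lemma sgnb2 b : sgnb b * sgnb b = 1.
Proof. by case: b => /=; ring. Qed.

(** Here u and w stand for blocks of x-derivatives, [Jc a *: u] and [Jc b *: w] for those of
    y-derivatives. In terms of the signs, the four terms add up to c^2 - 1 - (a + c)(b + c) times
    <u, w>. *)
Lemma quadratic_in_aux (a b c : bool) (u w : H) :
  (sgnb a + sgnb c) * (sgnb b + sgnb c) = 0 ->
  - rip ip (Jc a *: u) (Jc b *: w) + rip ip (Jc c *: (Jc a *: u)) w - rip ip u w -
  rip ip (Jc c *: u) (Jc b *: w) = 0.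
Proof.
move=> h; rewrite rip_J2 !rip_JJ.
transitivity (- ((sgnb a + sgnb c) * (sgnb b + sgnb c)) * rip ip u w +
  (sgnb c * sgnb c - 1) * rip ip u w); first by ring.
by rewrite h sgnb2 subrr oppr0 !mul0r addr0.
Qed.

(** The two terms with [Jc c] occur with signs opposite to those in [quadratic_in_aux], which turns
    the factor into c^2 - 1 + (c - a)(b - c). *)
Lemma quadratic_out_aux (a b c : bool) (u w : H) :
  (sgnb c - sgnb a) * (sgnb b - sgnb c) = 0 ->
  - rip ip (Jc a *: u) (Jc b *: w) + rip ip (Jc c *: u) (Jc b *: w) - rip ip u w -
  rip ip (Jc c *: (Jc a *: u)) w = 0.
Proof.
move=> h; rewrite rip_J2 !rip_JJ.
transitivity (((sgnb c - sgnb a) * (sgnb b - sgnb c)) * rip ip u w +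
  (sgnb c * sgnb c - 1) * rip ip u w); first by ring.
by rewrite h sgnb2 subrr !mul0r addr0.
Qed.

Lemma rip0l x : rip ip 0 x = 0. Proof. by rewrite /rip linear0l. Qed.
Lemma rip0r x : rip ip x 0 = 0. Proof. by rewrite /rip linear0r. Qed.

End UnitScalars.

Section FlagFamily.
Context {R : realType} {H : lmodType R[i]}.
Variable ip : {dot H for Num.conj}.
Variables (n : nat) (sigma : {set 'I_n}).
Variables (p : 'I_n -> H -> H) (T : 'I_n -> R * R -> hs ip) (O : set (R * R)).
Notation P i := (proj_at (p i) (T i)).
Notation ex := ((1, 0) : R * R).
Notation ey := ((0, 1) : R * R).

Hypothesis oO : open O.
Hypothesis p_proj : forall i, orth_proj ip (p i).
Hypothesis psigma_proj : orth_proj ip (fun x => \sum_(i in sigma) p i x).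
Hypothesis P_proj : forall i v, O v -> orth_proj ip (P i v).
Hypothesis P_orth : forall i j v x, O v -> i != j -> P i v (P j v x) = 0.
Hypothesis P_sum : forall v x, O v -> \sum_i P i v x = x.
Hypothesis T_smooth : forall i, smooth_on O (T i).
Hypothesis J2_eq : forall i j v x, O v -> i != j ->
  P i v ('D_ey (T j) v (P j v x)) =
  Jc (J2_type10 sigma i j) *: P i v ('D_ex (T j) v (P j v x)).

Definition Tsigma (v : R * R) : hs ip := \sum_(i in sigma) T i v.
Definition psigma (x : H) : H := \sum_(i in sigma) p i x.
Notation Q := (proj_at psigma Tsigma).

Lemma nearO v : O v -> \forall u \near v, O u.
Proof. by move=> Ov; exact: open_nbhs_nbhs. Qed.

Lemma QE v x : Q v x = \sum_(i in sigma) P i v x.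
Proof. by rewrite /proj_at /psigma /Tsigma hs_sum big_split. Qed.

Lemma P_linear i v : O v -> linear (P i v). Proof. by move=> Ov; case: (P_proj i Ov). Qed.
Lemma P_ip i v x y : O v -> ip (P i v x) y = ip x (P i v y).
Proof. by move=> Ov; case: (P_proj i Ov). Qed.
Lemma P_rip i v x y : O v -> rip ip (P i v x) y = rip ip x (P i v y).
Proof. by move=> Ov; rewrite /rip P_ip. Qed.
Lemma P_idem i v x : O v -> P i v (P i v x) = P i v x.
Proof. by move=> Ov; case: (P_proj i Ov). Qed.

Lemma linear_sumr (A : H -> H) I (s : seq I) (S : pred I) (F : I -> H) : linear A ->
  A (\sum_(i <- s | S i) F i) = \sum_(i <- s | S i) A (F i).
Proof.
move=> lA; elim/big_rec2: _ => [|i x y _ <-]; first exact: linear_fun0.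
by rewrite linear_funD.
Qed.

Lemma PQ_in i v x : O v -> i \in sigma -> P i v (Q v x) = P i v x.
Proof.
move=> Ov si; rewrite QE (linear_sumr _ _ _ (P_linear i Ov)) (bigD1 i)//= P_idem//.
by rewrite big1 ?addr0// => j /andP[_ ji]; rewrite P_orth// eq_sym.
Qed.

Lemma PQ_out j v x : O v -> j \notin sigma -> P j v (Q v x) = 0.
Proof.
move=> Ov sj; rewrite QE (linear_sumr _ _ _ (P_linear j Ov)) big1// => i si.
by rewrite P_orth//; apply: contraNneq sj => ->.
Qed.

Lemma QP_in i v x : O v -> i \in sigma -> Q v (P i v x) = P i v x.
Proof.
move=> Ov si; rewrite QE (bigD1 i)//= P_idem//.
by rewrite big1 ?addr0// => j /andP[_ ji]; rewrite P_orth.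
Qed.

Lemma QP_out j v x : O v -> j \notin sigma -> Q v (P j v x) = 0.
Proof.
move=> Ov sj; rewrite QE big1// => i si.
by rewrite P_orth//; apply: contraNneq sj => <-.
Qed.

Lemma Q_proj v : O v -> orth_proj ip (Q v).
Proof.
move=> Ov; split.
- move=> a x y; rewrite !QE scaler_sumr -big_split; apply: eq_bigr => i _.
  exact: P_linear.
- move=> x y; rewrite !QE ip_suml ip_sumr; apply: eq_bigr => i _; exact: P_ip.
- by move=> x; rewrite [LHS]QE [RHS]QE; apply: eq_bigr => i si; rewrite PQ_in.
Qed.

Lemma Tsigma_smooth : smooth_on O Tsigma.
Proof. by apply: smooth_on_sum oO _ => i; exact: T_smooth. Qed.

Lemma derive_Tsigma v e : O v -> 'D_e Tsigma v = \sum_(i in sigma) 'D_e (T i) v.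
Proof.
move=> Ov; suff h : is_derive v e Tsigma (\sum_(i in sigma) 'D_e (T i) v) by exact: derive_val.
rewrite /Tsigma; elim: (index_enum _) => [|i s IH].
  under eq_fun do rewrite big_nil; rewrite big_nil; exact: is_derive_cst.
under eq_fun do rewrite big_cons; rewrite big_cons; case: ifP => // si.
exact: (is_deriveD (smooth_on_is_derive e (T_smooth i) Ov) IH).
Qed.

Section Point.
Variables (v : R * R) (Ov : O v).
Let X e i : hs ip := 'D_e (T i) v.
Let D e : hs ip := 'D_e Tsigma v.

Let nP i : \forall u \near v, orth_proj ip (P i u).
Proof. by apply: filterS (nearO Ov) => u; exact: P_proj. Qed.

Let XX e i : is_derive v e (T i) (X e i).
Proof. exact: smooth_on_is_derive. Qed.

Let nQ : \forall u \near v, orth_proj ip (Q u).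
Proof. by apply: filterS (nearO Ov) => u; exact: Q_proj. Qed.

Let DD e : is_derive v e Tsigma (D e).
Proof. exact: smooth_on_is_derive Tsigma_smooth Ov. Qed.

Lemma X_offdiag e i x : X e i x = P i v (X e i x) + X e i (P i v x).
Proof. exact: derive_offdiag (nP i) (p_proj i) (XX e i) x. Qed.

Lemma X_orth e i j x : i != j -> P j v (X e i x) = - X e j (P i v x).
Proof.
move=> ij; apply/eqP; rewrite -addr_eq0; apply/eqP.
apply: (derive_orthogonal _ (p_proj j) (XX e i) (XX e j)).
apply: filterS (nearO Ov) => u Ou; split; [exact: P_proj|exact: P_proj|].
by move=> y; rewrite P_orth// eq_sym.
Qed.

Lemma X_diag e i x : P i v (X e i (P i v x)) = 0.
Proof.
have := X_offdiag e i (P i v x); rewrite P_idem// => /eqP.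
by rewrite -subr_eq subrr eq_sym => /eqP.
Qed.

Lemma D_selfadjoint e x y : rip ip (D e x) y = rip ip x (D e y).
Proof. exact: (derive_selfadjoint (p := psigma) psigma_proj nQ (DD e)). Qed.

Lemma D_offdiag e x : D e x = Q v (D e x) + D e (Q v x).
Proof. exact: (derive_offdiag (p := psigma) nQ psigma_proj (DD e)). Qed.

Lemma D_in_in e i m x : i \in sigma -> m \in sigma -> P m v (D e (P i v x)) = 0.
Proof.
move=> si sm; have := D_offdiag e (P i v x); rewrite QP_in// => /eqP.
rewrite -subr_eq subrr eq_sym => /eqP h.
by rewrite -(PQ_in _ Ov sm) h (linear_fun0 (P_linear m Ov)).
Qed.

Lemma D_out_out e j m x : j \notin sigma -> m \notin sigma -> P m v (D e (P j v x)) = 0.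
Proof. by move=> sj sm; rewrite D_offdiag QP_out// hs0 addr0 PQ_out. Qed.

(** The other c in sigma contribute P_m X_c P_i = - X_m P_c P_i = 0. *)
Lemma D_out_in e i m x : i \in sigma -> m \notin sigma ->
  P m v (D e (P i v x)) = P m v (X e i (P i v x)).
Proof.
move=> si sm; rewrite /D derive_Tsigma// hs_sum (linear_sumr _ _ _ (P_linear m Ov)).
rewrite (bigD1 i)//= big1 ?addr0// => c /andP[sc ci].
rewrite -/(X e c) X_orth ?P_orth ?hs0 ?oppr0//.
by apply: contraNneq sm => <-.
Qed.

(** Only the summand m contributes, and P_m X_m P_j = - P_m X_j P_j. So this block obeys the J2
    equation of the pair (m, j) as well, the sign being common to both sides. *)
Lemma D_in_out e j m x : j \notin sigma -> m \in sigma ->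
  P m v (D e (P j v x)) = - P m v (X e j (P j v x)).
Proof.
move=> sj sm; have jm : j != m by apply: contraNneq sj => ->.
rewrite /D derive_Tsigma// hs_sum (linear_sumr _ _ _ (P_linear m Ov)).
rewrite (bigD1 m)//= big1 ?addr0 => [|c /andP[sc cm]].
  have := X_orth e (P j v x) jm; rewrite P_idem// => /eqP.
  rewrite -eqr_oppLR => /eqP h; rewrite -/(X e m) -h.
  by rewrite (linear_funN _ (P_linear m Ov)) P_idem.
rewrite -/(X e c) X_orth ?P_orth ?hs0 ?oppr0//.
by apply: contraNneq sj => <-.
Qed.

Lemma rip_decomp x y : rip ip x y = \sum_m rip ip (P m v x) (P m v y).
Proof.
rewrite -{1}(P_sum x Ov) /rip ip_suml Re_sum; apply: eq_bigr => m _.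
by rewrite -{1}(P_idem m x Ov) P_ip.
Qed.

End Point.

(** The scalar of the J2 equation is shifted onto the vector a, so that both sides have the shape
    that [derive_weak] differentiates. *)
Lemma J2_weak u i j a b : O u -> i \in sigma -> j \notin sigma ->
  rip ip ('D_ey Tsigma u (P i u a)) (P j u b) =
  rip ip ('D_ex Tsigma u (P i u (Jc (J2_type10 sigma j i) *: a))) (P j u b).
Proof.
move=> Ou si sj; have ji : j != i by apply: contraNneq sj => ->.
rewrite -!(P_rip j _ _ Ou).
rewrite (D_out_in Ou ey a si sj).
rewrite (D_out_in Ou ex _ si sj).
rewrite (J2_eq _ Ou ji).
rewrite (linear_funZ _ _ (P_linear i Ou)).
rewrite hs_scaler.
rewrite (linear_funZ _ _ (P_linear j Ou)).
reflexivity.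
Qed.

Lemma derive_weak v e f i j a b : O v ->
  is_derive v e (fun u => rip ip ('D_f Tsigma u (P i u a)) (P j u b) : R^o)
    (rip ip ('D_e ('D_f Tsigma) v (P i v a) + 'D_f Tsigma v ('D_e (T i) v a)) (P j v b) +
     rip ip ('D_f Tsigma v (P i v a)) ('D_e (T j) v b)).
Proof.
move=> Ov.
have Fd := smooth_on_is_derive e (smooth_on_derive f Tsigma_smooth) Ov.
have Td i' := smooth_on_is_derive e (T_smooth i') Ov.
(* The operator 'D_f Tsigma u followed after p_i + T_i u is written as [hcomp] plus [hmulr], two
   differentiable families in [hs], because p_i alone need not be Hilbert-Schmidt. *)
have Sd := is_deriveD (is_derive_bilinear (hcomp_bilinear ip) Fd (Td i))
  (is_derive_linear (hmulr_linear (p_proj i)) Fd).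
have := is_derive_rip 0 (p j b) a b Sd (Td j).
have SE u : (0 + ((fun y => hcomp ('D_f Tsigma y) (T i y)) +
    (fun y => hmulr (p i) ('D_f Tsigma y))) u a) = 'D_f Tsigma u (P i u a).
  by rewrite add0r addrfctE hsD hcompE (hmulrE (p_proj i)) addrC -hs_addr.
move=> h; apply: is_derive_eq; first apply: is_derive_near h.
  by near=> u; rewrite SE.
rewrite SE !hsD !hcompE (hmulrE (p_proj i)) addrAC (addrC _ ('D_e ('D_f Tsigma) v _)) -hs_addr.
by [].
Unshelve. all: by end_near. Qed.

Definition laplacian_Tsigma (v : R * R) : hs ip :=
  'D_ex ('D_ex Tsigma) v + 'D_ey ('D_ey Tsigma) v.

Lemma derive_Tsigma_swap v : O v ->
  'D_ey ('D_ex Tsigma) v = 'D_ex ('D_ey Tsigma) v.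
Proof.
move=> Ov; have sT := Tsigma_smooth.
have sx := smooth_on_derive ex sT; have sy := smooth_on_derive ey sT.
apply: (@schwarz _ _ ip _ Tsigma ('D_ex Tsigma) ('D_ey Tsigma)
  ('D_ey ('D_ex Tsigma)) ('D_ex ('D_ey Tsigma)) ex ey v).
- apply: filterS (nearO Ov) => u Ou.
  by split; apply: (@smooth_on_is_derive _ _ _ O).
- exact: (smooth_on_continuous (smooth_on_derive ey sx) Ov).
- exact: (smooth_on_continuous (smooth_on_derive ex sy) Ov).
Qed.

(* The sign conditions are where the combinatorics of J2_type10 enters: the
   quadratic terms of the Laplacian cancel by them. *)
Lemma J2_sign_in i j m : i \in sigma -> m \in sigma -> j \notin sigma -> m != i ->
  let a := @sgnb R (J2_type10 sigma m i) in let b := @sgnb R (J2_type10 sigma m j) in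
  let c := @sgnb R (J2_type10 sigma j i) in (a + c) * (b + c) = 0.
Proof.
move=> si sm sj mi /=; rewrite /J2_type10 si sm (negbTE sj) /=.
have im : i != m :> nat by rewrite eq_sym.
have ij : i != j :> nat by apply: contraNneq sj => /val_inj <-.
have mj : m != j :> nat by apply: contraNneq sj => /val_inj <-.
(* The product is nonzero only if a, b and c agree, which would mean m < i < j < m or the reverse
   cycle. *)
rewrite /sgnb; case: (ltngtP i m) im => // im _; case: (ltngtP i j) ij => // ij _;
  case: (ltngtP m j) mj => // mj _; try ring; exfalso; clear -im ij mj; lia.
Qed.

Lemma J2_sign_out i j m : i \in sigma -> m \notin sigma -> j \notin sigma -> m != j ->
  let a := @sgnb R (J2_type10 sigma m i) in let b := @sgnb R (J2_type10 sigma m j) in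
  let c := @sgnb R (J2_type10 sigma j i) in (c - a) * (b - c) = 0.
Proof.
move=> si sm sj mj /=; rewrite /J2_type10 si (negbTE sm) (negbTE sj) /=.
have {}mj : m != j :> nat by [].
have ij : i != j :> nat by apply: contraNneq sj => /val_inj <-.
have im : i != m :> nat by apply: contraNneq sm => /val_inj <-.
(* A nonzero product needs a = b = - c, again a cyclic order of i, j and m. *)
rewrite /sgnb; case: (ltngtP i m) im => // im _; case: (ltngtP i j) ij => // ij _;
  case: (ltngtP m j) mj => // mj _; try ring; exfalso; clear -im ij mj; lia.
Qed.

Section Laplacian.
Variables (v : R * R) (Ov : O v) (i j : 'I_n) (si : i \in sigma) (sj : j \notin sigma).
Variables (a b : H) (Pa : P i v a = a) (Pb : P j v b = b).
Let X e i : hs ip := 'D_e (T i) v.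
Let D e : hs ip := 'D_e Tsigma v.
Let c := J2_type10 sigma j i.

Let neq_out m : m \notin sigma -> m != i.
Proof. by move=> sm; apply: contraNneq sm => ->. Qed.

Let neq_in m : m \in sigma -> m != j.
Proof. by move=> sm; apply: contraNneq sj => <-. Qed.

Let XJ f m : P m v (X f i (Jc c *: a)) = Jc c *: P m v (X f i a).
Proof. by rewrite hs_scaler (linear_funZ _ _ (P_linear m Ov)). Qed.

Let DJ f m : P m v (D f (Jc c *: a)) = Jc c *: P m v (D f a).
Proof. by rewrite hs_scaler (linear_funZ _ _ (P_linear m Ov)). Qed.

Let quadratic_sum (f g h k : 'I_n -> R) (w x y z : R) :
  w = \sum_m f m -> x = \sum_m g m -> y = \sum_m h m -> z = \sum_m k m ->
  (forall m, - f m + g m - h m - k m = 0) -> - w + x - y - z = 0.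
Proof.
move=> -> -> -> -> h0; rewrite -!sumrN -!big_split /= big1// => m _; exact: h0.
Qed.

(** These are the terms in which the projection onto E_i is differentiated. They are expanded over
    the summands E_m: m outside sigma drops out because D has no such block, m = i because X_i has
    no diagonal block, and the rest cancels for each m separately. *)
Lemma quadratic_in : - rip ip (D ey (X ey i a)) b + rip ip (D ex (X ey i (Jc c *: a))) b
  - rip ip (D ex (X ex i a)) b - rip ip (D ey (X ex i (Jc c *: a))) b = 0.
Proof.
have [U UE] : exists U : R * R -> 'I_n -> H, forall e m, U e m = P m v (X e i a) by exists (fun e m => P m v (X e i a)).
have [W WE] : exists W : R * R -> 'I_n -> H, forall e m, W e m = P m v (D e b) by exists (fun e m => P m v (D e b)).
have E e f : rip ip (D e (X f i a)) b = \sum_m rip ip (U f m) (W e m).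
  by rewrite (D_selfadjoint Ov) (rip_decomp Ov); apply: eq_bigr => m _; rewrite UE WE.
have E' e f : rip ip (D e (X f i (Jc c *: a))) b = \sum_m rip ip (Jc c *: U f m) (W e m).
  by rewrite (D_selfadjoint Ov) (rip_decomp Ov); apply: eq_bigr => m _; rewrite XJ UE WE.
apply: (quadratic_sum (E ey ey) (E' ex ey) (E ex ex) (E' ey ex)) => m.
have [sm|sm] := boolP (m \in sigma); last first.
  have W0 e : W e m = 0 by rewrite WE -Pb D_out_out.
  by rewrite (W0 ex) (W0 ey) !rip0r oppr0 !addr0.
have [mi|mi] := eqVneq m i.
  have U0 e : U e m = 0 by rewrite UE mi -Pa X_diag.
  by rewrite (U0 ex) (U0 ey) !scaler0 !rip0l oppr0 !addr0.
have -> : U ey m = Jc (J2_type10 sigma m i) *: U ex m.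
  by rewrite !UE -Pa; exact: J2_eq.
have -> : W ey m = Jc (J2_type10 sigma m j) *: W ex m.
  rewrite !WE -Pb (D_in_out Ov ey b sj sm) (D_in_out Ov ex b sj sm) scalerN.
  by congr (- _); apply: J2_eq => //; exact: neq_in.
exact/quadratic_in_aux/J2_sign_in.
Qed.

(** The terms in which the projection onto E_j is differentiated; now the indices m in sigma and m =
    j drop out. *)
Lemma quadratic_out : - rip ip (D ey a) (X ey j b) + rip ip (D ex (Jc c *: a)) (X ey j b)
  - rip ip (D ex a) (X ex j b) - rip ip (D ey (Jc c *: a)) (X ex j b) = 0.
Proof.
have [U UE] : exists U : R * R -> 'I_n -> H, forall e m, U e m = P m v (D e a) by exists (fun e m => P m v (D e a)).
have [W WE] : exists W : R * R -> 'I_n -> H, forall e m, W e m = P m v (X e j b) by exists (fun e m => P m v (X e j b)).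
have E e f : rip ip (D e a) (X f j b) = \sum_m rip ip (U e m) (W f m).
  by rewrite (rip_decomp Ov); apply: eq_bigr => m _; rewrite UE WE.
have E' e f : rip ip (D e (Jc c *: a)) (X f j b) = \sum_m rip ip (Jc c *: U e m) (W f m).
  by rewrite (rip_decomp Ov); apply: eq_bigr => m _; rewrite DJ UE WE.
apply: (quadratic_sum (E ey ey) (E' ex ey) (E ex ex) (E' ey ex)) => m.
have [sm|sm] := boolP (m \in sigma).
  have U0 e : U e m = 0 by rewrite UE -Pa D_in_in.
  by rewrite (U0 ex) (U0 ey) !scaler0 !rip0l oppr0 !addr0.
have [mj|mj] := eqVneq m j.
  have W0 e : W e m = 0 by rewrite WE mj -Pb X_diag.
  by rewrite (W0 ex) (W0 ey) !rip0r oppr0 !addr0.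
have -> : U ey m = Jc (J2_type10 sigma m i) *: U ex m.
  rewrite !UE -Pa (D_out_in Ov ey a si sm) (D_out_in Ov ex a si sm).
  by apply: J2_eq => //; exact: neq_out.
have -> : W ey m = Jc (J2_type10 sigma m j) *: W ex m.
  by rewrite !WE -Pb; exact: J2_eq.
exact/quadratic_out_aux/J2_sign_out.
Qed.

(** The identity [J2_weak] for a is differentiated in y, the one for [Jc c *: a] in x. Since [Jc c]
    squares to -1, adding them collects both pure second derivatives with the same sign and the
    mixed one with opposite signs. *)
Lemma laplacian_out_in : rip ip (laplacian_Tsigma v a) b = 0.
Proof.
have PaJ : P i v (Jc c *: a) = Jc c *: a by rewrite (linear_funZ _ _ (P_linear i Ov)) Pa.
have Ja : Jc c *: (Jc c *: a) = - a.
  rewrite scalerA Jc_mul /sgnb (_ : - _ = -1); last by case: (c); ring.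
  by rewrite rmorphN1 scaleN1r.
have W : \forall u \near v, rip ip ('D_ey Tsigma u (P i u a)) (P j u b) =
    rip ip ('D_ex Tsigma u (P i u (Jc c *: a))) (P j u b).
  by apply: filterS (nearO Ov) => u Ou; exact: J2_weak.
have W' : \forall u \near v, rip ip ('D_ey Tsigma u (P i u (Jc c *: a))) (P j u b) =
    rip ip ('D_ex Tsigma u (P i u (- a))) (P j u b).
  by apply: filterS (nearO Ov) => u Ou; rewrite (J2_weak _ _ Ou si sj) Ja.
have Ey := is_derive_unique (W := R^o) W (derive_weak ey ey i j a b Ov)
  (derive_weak ey ex i j (Jc c *: a) b Ov).
have Ex := is_derive_unique (W := R^o) W' (derive_weak ex ey i j (Jc c *: a) b Ov)
  (derive_weak ex ex i j (- a) b Ov).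
have PaN : P i v (- a) = - a by rewrite (linear_funN _ (P_linear i Ov)) Pa.
move: Ey Ex; rewrite Pa PaJ PaN Pb derive_Tsigma_swap//.
move: quadratic_in quadratic_out; rewrite /laplacian_Tsigma /D /X.
generalize ('D_ey ('D_ey Tsigma) v) ('D_ex ('D_ex Tsigma) v) ('D_ex ('D_ey Tsigma) v).
generalize ('D_ex Tsigma v) ('D_ey Tsigma v) ('D_ex (T i) v) ('D_ey (T i) v).
generalize ('D_ex (T j) v) ('D_ey (T j) v) (Jc c *: a).
clear W W' PaJ Ja PaN => xj yj a' dx dy xi yi dyy dxx dxy.
have hN (S : hs ip) x : S (- x) = - S x by exact: linear_funN (hs_linear S).
rewrite (hN dxx) (hN xi) (hN dx) (hN dx) hsD !ripDl !ripNl.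
move: (rip _ _ _) (rip _ _ _) (rip _ _ _) (rip _ _ _) (rip _ _ _) (rip _ _ _)
  (rip _ _ _) (rip _ _ _) (rip _ _ _) (rip _ _ _) (rip _ _ _).
move=> x1 x2 x3 x4 x5 x6 x7 x8 x9 x10 x11; lra.
Qed.

End Laplacian.

Lemma derive2_selfadjoint v e x y : O v ->
  rip ip ('D_e ('D_e Tsigma) v x) y = rip ip x ('D_e ('D_e Tsigma) v y).
Proof.
move=> Ov; rewrite (ripC _ x).
have Fd := smooth_on_is_derive e (smooth_on_derive e Tsigma_smooth) Ov.
have E : \forall u \near v, rip ip ('D_e Tsigma u x) y = rip ip ('D_e Tsigma u y) x.
  by apply: filterS (nearO Ov) => u Ou; rewrite (D_selfadjoint Ou) ripC.
exact: (is_derive_unique (W := R^o) E (is_derive_linear (rip_eval_linear ip x y) Fd)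
  (is_derive_linear (rip_eval_linear ip y x) Fd)).
Qed.

Lemma laplacian_selfadjoint v x y : O v ->
  rip ip (laplacian_Tsigma v x) y = rip ip x (laplacian_Tsigma v y).
Proof.
move=> Ov; rewrite /laplacian_Tsigma !hsD ripDl ripDr.
by congr (_ + _); exact: derive2_selfadjoint.
Qed.

Lemma laplacian_block v x y : O v ->
  rip ip (laplacian_Tsigma v (Q v x)) y = rip ip (laplacian_Tsigma v (Q v x)) (Q v y).
Proof.
move=> Ov.
have -> : y = Q v y + \sum_(j | j \notin sigma) P j v y.
  by rewrite -{1}(P_sum y Ov) (bigID (fun i => i \in sigma)) /= QE.
have [lQ _ QK] := Q_proj Ov.
have Q0 : Q v (\sum_(j | j \notin sigma) P j v y) = 0.
  by rewrite (linear_sumr _ _ _ lQ) big1// => j sj; rewrite QP_out.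
rewrite (linear_funD _ _ lQ) Q0 QK addr0 ripDr.
set z := (X in _ + X); suff -> : z = 0 by rewrite addr0.
rewrite /z [in X in laplacian_Tsigma v X]QE (linear_sumr _ _ _ (hs_linear _)).
rewrite /rip ip_suml Re_sum big1// => i si.
rewrite ip_sumr Re_sum big1// => j sj.
exact: (laplacian_out_in Ov si sj (P_idem i x Ov) (P_idem j y Ov)).
Qed.

(** By [laplacian_block] the Laplacian preserves the range of Q; being self-adjoint it commutes with
    Q, and such operators are orthogonal to the off-diagonal ones. *)
Lemma J2_laplacian_orth v (V : hs ip) : O v ->
  (forall x, V x = Q v (V x) + V (Q v x)) -> hsip (laplacian_Tsigma v) V = 0.
Proof.
move=> Ov hV; apply: (hsip_offdiag_eq0 (Q_proj Ov)) => // x.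
have [_ sQ _] := Q_proj Ov.
apply: (@rip_ext _ _ ip) => y.
rewrite {1}/rip sQ -/(rip ip _ _) laplacian_selfadjoint// ripC laplacian_block//.
by rewrite [RHS]laplacian_block// [RHS]laplacian_selfadjoint// [RHS]ripC.
Qed.

End FlagFamily.


(** * Orthogonal projections and the Grassmannian *)

Section OrthogonalProjection.
Context {R : realType} {H : completeNormedModType R[i]}.
Variable ip : {dot H for Num.conj}.

Section Subspace.
Variables (W : set H).
Hypotheses (W0 : W 0) (WD : forall (a : R[i]) x y, W x -> W y -> W (a *: x + y)).

Lemma subspace_sub x y : W x -> W y -> W (x - y).
Proof. by move=> Wx Wy; rewrite addrC -scaleN1r; exact: WD. Qed.

Lemma oproj_unique x y z : W y -> W z ->
  (forall w, W w -> ip (x - y) w = 0) -> (forall w, W w -> ip (x - z) w = 0) -> y = z.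
Proof.
move=> Wy Wz hy hz; apply/eqP; rewrite -subr_eq0 -(dnorm_eq0 ip).
have Wyz := subspace_sub Wy Wz.
rewrite (_ : y - z = (x - z) - (x - y)) in Wyz *; last by rewrite opprB [RHS]addrC addrA subrK.
by rewrite ipBl hz ?hy ?subrr.
Qed.

Lemma oprojE x y : W y -> (forall w, W w -> ip (x - y) w = 0) -> oproj ip W x = y.
Proof.
move=> Wy hy; rewrite /oproj; set S := [set _ | _].
have [Wz hz] : S (get S) by apply: (getI (x := y)).
exact: oproj_unique Wz Wy hz hy.
Qed.

Hypothesis exP : forall x, exists y, W y /\ forall w, W w -> ip (x - y) w = 0.

Lemma oprojP x : W (oproj ip W x) /\ forall w, W w -> ip (x - oproj ip W x) w = 0.
Proof.
have [y hy] := exP x.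
exact: (@getI _ [set y | W y /\ forall w, W w -> ip (x - y) w = 0] y hy).
Qed.

Lemma oproj_id x : W x -> oproj ip W x = x.
Proof. by move=> Wx; apply: oprojE => // w _; rewrite subrr linear0l. Qed.

Lemma oproj_orth_proj : orth_proj ip (oproj ip W).
Proof.
split.
- move=> a x y; apply: oprojE.
    by apply: WD; [exact: (oprojP x).1|exact: (oprojP y).1].
  move=> w Ww; rewrite opprD addrACA -scalerBr ipDl ipZl.
  by rewrite (oprojP x).2// (oprojP y).2// mulr0 addr0.
- move=> x y; have [Wx hx] := oprojP x; have [Wy hy] := oprojP y.
  have := hx _ Wy; rewrite ipBl => /eqP; rewrite subr_eq0 => /eqP ->.
  have := hy _ Wx; rewrite ipBl => /eqP; rewrite subr_eq0 => /eqP h.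
  by rewrite ip_conj h -ip_conj.
- by move=> x; exact/oproj_id/(oprojP x).1.
Qed.

End Subspace.

(* Where the orthogonal projection does not exist, oproj takes a fixed value;
   for a linear oproj this forces W = 0, for which it does exist. *)
Lemma linear_oproj_exists (W : set H) : W 0 ->
  (forall (a : R[i]) x y, W x -> W y -> W (a *: x + y)) -> linear (oproj ip W) ->
  forall x, exists y, W y /\ forall w, W w -> ip (x - y) w = 0.
Proof.
move=> W0 WD lW x; apply: contrapT => nx.
have empty z : W z -> forall a : R[i], a != 0 -> oproj ip W (a *: x + z) = point.
  move=> Wz a a0; rewrite /oproj getPN// => y [Wy hy]; apply: nx.
  exists (a^-1 *: (y - z)); split.
    by rewrite -[X in W X]addr0; apply: (WD) => //; exact: subspace_sub.
  move=> w Ww; have -> : x - a^-1 *: (y - z) = a^-1 *: (a *: x + z - y).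
    rewrite -[x in LHS]scale1r -(mulVf a0) -scalerA -scalerBr opprB.
    by rewrite addrA.
  by rewrite ipZl hy// mulr0.
have p0 : point = 0 :> H.
  have h1 := empty 0 W0 1 (oner_neq0 _).
  have h2 := empty 0 W0 2 (lt0r_neq0 (ltr0n _ 2)).
  move: h1 h2; rewrite !addr0 scale1r (linear_funZ _ _ lW) => ->.
  rewrite -[X in _ = X]scale1r => /eqP; rewrite -subr_eq0 -scalerBl.
  rewrite (_ : 2 - 1 = 1) ?scale1r; last by ring.
  by move=> /eqP.
have ox : oproj ip W x = 0.
  by have := empty 0 W0 1 (oner_neq0 _); rewrite addr0 scale1r p0.
have Wz z : W z -> z = 0.
  move=> Wz; have := empty z Wz 1 (oner_neq0 _).
  by rewrite scale1r (linear_funD _ _ lW) ox add0r oproj_id// p0.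
apply: nx; exists 0; split; first exact: W0.
by move=> w /Wz ->; rewrite linear0r.
Qed.

Hypothesis ip_norm : forall x : H, ip x x = `|x| ^+ 2.

(** If P fixes y, then x - P x = (x - y) - P (x - y) has norm at most |x - y|. *)
Lemma orth_proj_closed (P : H -> H) : orth_proj ip P -> closed [set x | P x = x].
Proof.
move=> [lP sP PK] x xcl; apply/eqP; rewrite eq_sym -subr_eq0 -normr_le0.
apply/ler_addgt0Pr => e e0; rewrite add0r.
have [y [/= Py xy]] := xcl _ (nbhsx_ballx x e e0).
move: xy; rewrite -ball_normE /= => xy; apply: le_trans (ltW xy).
have -> : x - P x = (x - y) - P (x - y).
  by rewrite (linear_funB _ _ lP) Py opprB addrA subrK.
move: (x - y) => z; rewrite -(ler_pXn2r (n := 2)) ?nnegrE// -!ip_norm.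
by rewrite ipBl !ipBr !sP !PK subrr subr0 gerBl -{1}(PK z) -sP dnorm_ge0.
Qed.

End OrthogonalProjection.


(** * Additivity of the Fredholm index *)

Section FredholmIndex.
Context {R : realType} {H : completeNormedModType R[i]}.
Variable ip : {dot H for Num.conj}.
Implicit Types (U V W K : set H).

Let ipE := (ipBl ip, ipDl ip, ipNl ip, ipZl ip, ip0l ip).

(** Linear subspaces without closedness: the ranges and intermediate sums of the induction are
    treated purely algebraically. *)
Definition is_subspace W : Prop :=
  W 0 /\ forall (a : R[i]) x y, W x -> W y -> W (a *: x + y).

Lemma subspaceD W x y : is_subspace W -> W x -> W y -> W (x + y).
Proof. by move=> [_ WD] Wx Wy; rewrite -[x]scale1r; exact: WD. Qed.

Lemma subspaceZ W a x : is_subspace W -> W x -> W (a *: x).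
Proof. by move=> [W0 WD] Wx; rewrite -[_ *: _]addr0; exact: WD. Qed.

Lemma subspaceB W x y : is_subspace W -> W x -> W y -> W (x - y).
Proof. by move=> [W0 WD]; exact: subspace_sub. Qed.

Lemma subspace_sum W I (s : seq I) (S : pred I) (F : I -> H) : is_subspace W ->
  (forall i, S i -> W (F i)) -> W (\sum_(i <- s | S i) F i).
Proof.
move=> sW WF; elim/big_rec: _ => [|i x Si Wx]; first by case: sW.
by apply: subspaceD => //; exact: WF.
Qed.

Definition add_line W (x : H) : set H :=
  [set y | exists2 w, W w & exists c : R[i], y = w + c *: x].

Definition add_span W m (b : 'I_m -> H) : set H :=
  [set y | exists2 w, W w & exists a : 'I_m -> R[i], y = w + \sum_i a i *: b i].

(** Steinitz exchange modulo U: y has a nonzero coefficient [a i0], and y takes the place of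
    [b i0]. *)
Lemma quot_dim_add_line U V m y : is_subspace U -> quot_dim V U m -> V y -> ~ U y ->
  exists2 m', m = m'.+1 & quot_dim V (add_line U y) m'.
Proof.
move=> sU [b [Vb Ub Vs]] Vy nUy; have [a Uu0] := Vs y Vy.
have [i0 ai0] : exists i, a i != 0.
  apply: contrapT => na; apply: nUy; move: Uu0; rewrite big1 ?subr0// => i _.
  have [->|ai] := eqVneq (a i) 0; first by rewrite scale0r.
  by case: na; exists i.
case: m b Vb Ub Vs a Uu0 i0 ai0 => [? ? ? ? ? ? []//|m] b Vb Ub Vs a.
set u0 := y - _ => Uu0 i0 ai0.
exists m => //; exists (fun j => b (lift i0 j)); split.
- by move=> j; exact: Vb.
- move=> c [u Uu [t E]].
  (* Eliminating y through y = u0 + sum a_k b_k leaves a relation modulo U among the original b,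
     with coefficient - t a_i0 at i0; independence then forces t = 0. *)
  pose e k := (if unlift i0 k is Some j then c j else 0) - t * a k.
  have Ue : U (\sum_k e k *: b k).
    have -> : \sum_k e k *: b k = u + t *: u0.
      rewrite /u0 scalerBr scaler_sumr addrA -E.
      rewrite (eq_bigr (fun k => (if unlift i0 k is Some j then c j else 0) *: b k -
        t *: (a k *: b k))); last by move=> k _; rewrite scalerBl scalerA.
      rewrite sumrB (bigD1_ord i0)//= unlift_none scale0r add0r.
      by congr (_ - _); apply: eq_bigr => j _; rewrite liftK.
    by apply: subspaceD => //; exact: subspaceZ.
  have e0 := Ub _ Ue.
  have t0 : t = 0.
    have := e0 i0; rewrite /e unlift_none sub0r => /eqP.
    by rewrite oppr_eq0 mulf_eq0 (negbTE ai0) orbF => /eqP.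
  by move=> j; have := e0 (lift i0 j); rewrite /e liftK t0 mul0r subr0.
move=> x Vx; have [d Ud] := Vs x Vx.
(* Subtracting d_i0 / a_i0 times the expansion of y from that of x removes [b i0]. *)
exists (fun j => d (lift i0 j) - d i0 / a i0 * a (lift i0 j)).
exists (x - \sum_i d i *: b i - (d i0 / a i0) *: u0).
  by apply: subspaceB => //; exact: subspaceZ.
exists (d i0 / a i0); rewrite /u0 !(bigD1_ord i0)//=.
rewrite (eq_bigr (fun j => d (lift i0 j) *: b (lift i0 j) -
  (d i0 / a i0) *: (a (lift i0 j) *: b (lift i0 j)))); last first.
  by move=> j _; rewrite scalerBl scalerA.
rewrite sumrB -scaler_sumr; have dE : d i0 = d i0 / a i0 * a i0 by rewrite divfK.
move: dE; move: (d i0 / a i0) => D ->.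
move: (\sum_(j < m) _) (\sum_(j < m) _) => S1 S2.
by apply: (@ip_ext _ _ ip) => z; rewrite !ipE; ring.
Qed.

Lemma has_dim_add_line K z m : is_subspace K -> has_dim K m -> ~ K z ->
  has_dim (add_line K z) m.+1.
Proof.
move=> sK [b [Kb b0 bs]] nKz; have [K0 KD] := sK.
exists (fun i => if unlift ord0 i is Some j then b j else z); split.
- move=> i; case: unliftP => [j|] _.
    by exists (b j) => //; exists 0; rewrite scale0r addr0.
  by exists 0 => //; exists 1; rewrite add0r scale1r.
- move=> a; rewrite (bigD1_ord ord0)//= unlift_none => /= E.
  have a0 : a ord0 = 0.
    apply: contrapT => /eqP a0; apply: nKz.
    have -> : z = - (a ord0)^-1 *: (\sum_(j < m) a (lift ord0 j) *: b j).
      apply: (@scalerI _ _ (a ord0)) => //; rewrite scalerA mulrN mulfV// scaleN1r.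
      apply/eqP; rewrite -addr_eq0 -[X in _ == X]E; apply/eqP; congr (_ + _).
      by apply: eq_bigr => j _; rewrite liftK.
    by apply: subspaceZ => //; apply: subspace_sum => // j _; exact: subspaceZ.
  move=> i; case: (unliftP ord0 i) => [j ->|-> //].
  apply: (b0 (fun j => a (lift ord0 j))); rewrite /= -[RHS]E a0 scale0r add0r.
  by apply: eq_bigr => k _; rewrite liftK.
move=> x [k Kk [c ->]]; have [a E] := bs k Kk.
exists (fun i => if unlift ord0 i is Some j then a j else c).
rewrite (bigD1_ord ord0)//= unlift_none.
rewrite (_ : \sum_(i < m) _ = \sum_(i < m) a i *: b i); last first.
  by apply: eq_bigr => j _; rewrite liftK.
rewrite -[RHS]E; move: (\sum_(i < m) _) => S.
by apply: (@ip_ext _ _ ip) => y; rewrite !ipE; ring.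
Qed.

(** If T x = T w with w in W, the kernel gains the line of x - w and the range is unchanged.
    Otherwise the range gains a line, so its codimension drops by one, and the kernel is
    unchanged. *)
Lemma fredholm_add_line W V T d x : is_subspace W -> linear T -> (forall y, V (T y)) ->
  ~ W x -> fredholm W V T d -> fredholm (add_line W x) V T (d + 1).
Proof.
move=> sW lT VT nWx [a [b [Ka Rb ->]]]; have [W0 WD] := sW.
have sK : is_subspace (W `&` [set y | T y = 0]).
  split; first by split=> //; exact: linear_fun0.
  by move=> c y z [Wy Ty] [Wz Tz]; split; [exact: WD|rewrite /= lT Ty Tz scaler0 addr0].
have sR : is_subspace (T @` W).
  split; first by exists 0 => //; exact: linear_fun0.
  by move=> c _ _ [y Wy <-] [z Wz <-]; exists (c *: y + z); [exact: WD|rewrite lT].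
have [[w Ww Txw]|nR] := pselect ((T @` W) (T x)).
  exists a.+1, b; split; last by rewrite -addn1 PoszD addrAC.
    rewrite (_ : _ `&` _ = add_line (W `&` [set y | T y = 0]) (x - w)).
      apply: has_dim_add_line => //; case=> Wxw _; apply: nWx.
      by rewrite -(subrK w x); exact: subspaceD.
    apply/seteqP; split=> [_ [[w' Ww' [c ->]] /= Tc]|_ [k [Wk /= Tk] [c ->]]].
      exists (w' + c *: w).
        split; first by apply: subspaceD => //; exact: subspaceZ.
        by move: Tc; rewrite /= !(linear_funD _ _ lT) !(linear_funZ _ _ lT) Txw.
      by exists c; apply: (@ip_ext _ _ ip) => z; rewrite !ipE; ring.
    split; last by rewrite /= (linear_funD _ _ lT) (linear_funZ _ _ lT)
      (linear_funB _ _ lT) Tk Txw subrr scaler0 addr0.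
    exists (k - c *: w); first by apply: subspaceB => //; exact: subspaceZ.
    by exists c; apply: (@ip_ext _ _ ip) => z; rewrite !ipE; ring.
  rewrite (_ : T @` _ = T @` W)//.
  apply/seteqP; split=> [_ [_ [w' Ww' [c ->]] <-]|_ [y Wy <-]].
    exists (w' + c *: w); first by apply: subspaceD => //; exact: subspaceZ.
    by rewrite !(linear_funD _ _ lT) !(linear_funZ _ _ lT) Txw.
  by exists y => //; exists y => //; exists 0; rewrite scale0r addr0.
have [b' bE Rb'] := quot_dim_add_line sR Rb (VT x) nR.
exists a, b'; split; last by rewrite bE -addn1 PoszD; lia.
  rewrite (_ : _ `&` _ = W `&` [set y | T y = 0])//.
  apply/seteqP; split=> [_ [[w' Ww' [c ->]] /= Tc]|y [Wy Ty]]; last first.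
    by split=> //; exists y => //; exists 0; rewrite scale0r addr0.
  have [c0|c0] := eqVneq c 0.
    by move: Tc; rewrite c0 scale0r addr0.
  case: nR; exists (- c^-1 *: w'); first exact: subspaceZ.
  move: Tc; rewrite (linear_funD _ _ lT) !(linear_funZ _ _ lT) => /eqP.
  rewrite addr_eq0 => /eqP ->; rewrite scaleNr scalerN opprK scalerA.
  by rewrite mulVf// scale1r.
rewrite (_ : T @` _ = add_line (T @` W) (T x))//.
apply/seteqP; split=> [_ [_ [w' Ww' [c ->]] <-]|_ [_ [y Wy <-] [c ->]]].
  exists (T w'); first by exists w'.
  by exists c; rewrite (linear_funD _ _ lT) (linear_funZ _ _ lT).
exists (y + c *: x); last by rewrite (linear_funD _ _ lT) (linear_funZ _ _ lT).
by exists y => //; exists c.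
Qed.

End FredholmIndex.


(** * Sums of the subspaces of a flag *)

Section FlagSum.
Context {R : realType} {H : completeNormedModType R[i]}.
Variable ip : {dot H for Num.conj}.

(** Independence of b modulo W keeps each new vector outside the space built before it, as
    [fredholm_add_line] requires. *)
Lemma fredholm_add_span (W V : set H) T d m (b : 'I_m -> H) :
  is_subspace W -> linear T -> (forall y, V (T y)) ->
  (forall a : 'I_m -> R[i], W (\sum_i a i *: b i) -> forall i, a i = 0) ->
  fredholm W V T d -> fredholm (add_span W b) V T (d + m%:Z).
Proof.
move=> sW lT VT; have [W0 WD] := sW.
elim: m b => [|m IH] b bW fW.
  rewrite addr0 (_ : add_span W b = W)//; apply/seteqP; split.
    by move=> _ [w Ww [a ->]]; rewrite big_ord0 addr0.
  by move=> w Ww; exists w => //; exists (fun=> 0); rewrite big_ord0 addr0.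
pose b' := b \o lift ord0.
have b'W (a : 'I_m -> R[i]) : W (\sum_i a i *: b' i) -> forall i, a i = 0.
  move=> Wa i; pose a' k := if unlift ord0 k is Some j then a j else 0.
  have := bW a' _ (lift ord0 i); rewrite /a' liftK; apply.
  rewrite big_ord_recl unlift_none scale0r add0r.
  by under eq_bigr do rewrite liftK.
have sW' : is_subspace (add_span W b').
  split; first by exists 0 => //; exists (fun=> 0); rewrite big1 ?addr0// => i _; rewrite scale0r.
  move=> c _ _ [w Ww [a ->]] [w' Ww' [a' ->]]; exists (c *: w + w'); first exact: WD.
  exists (fun i => c * a i + a' i); rewrite scalerDr scaler_sumr addrACA.
  congr (_ + _); rewrite -big_split; apply: eq_bigr => i _ /=.
  by rewrite scalerA scalerDl.
have nb : ~ add_span W b' (b ord0).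
  move=> [w Ww [a E]]; pose a' k := if unlift ord0 k is Some j then - a j else 1.
  have := bW a' _ ord0; rewrite /a' unlift_none => h.
  suff /h/eqP : W (\sum_i a' i *: b i) by rewrite oner_eq0.
  rewrite big_ord_recl [a' ord0]/a' unlift_none scale1r E.
  rewrite [X in _ + X](eq_bigr (fun i => - (a i *: b' i))); last first.
    by move=> i _; rewrite /a' liftK scaleNr.
  by rewrite sumrN addrK.
have := fredholm_add_line ip sW' lT VT nb (IH _ b'W fW).
rewrite -addrA -PoszD addn1; congr (fredholm _ V T _).
apply/seteqP; split.
  move=> _ [_ [w Ww [a ->]] [c ->]]; exists w => //.
  exists (fun k => if unlift ord0 k is Some j then a j else c).
  rewrite big_ord_recl unlift_none -addrA [X in w + X]addrC.
  by under [in RHS]eq_bigr do rewrite liftK.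
move=> _ [w Ww [a ->]]; exists (w + \sum_i a (lift ord0 i) *: b' i).
  by exists w => //; exists (fun i => a (lift ord0 i)).
by exists (a ord0); rewrite big_ord_recl -addrA [X in w + X]addrC.
Qed.

Variables (n : nat) (E : 'I_n -> set H).
Hypothesis E_closed : forall i, closed_subspace (E i).
Hypothesis E_orth : forall i j, i != j -> orthogonal_sets ip (E i) (E j).
Hypothesis E_decomp : forall x, exists u : 'I_n -> H, (forall i, E i (u i)) /\ x = \sum_i u i.

Lemma E_subspace i : is_subspace (E i).
Proof. by case: (E_closed i). Qed.

Lemma E_exproj i x : exists y, E i y /\ forall w, E i w -> ip (x - y) w = 0.
Proof.
have [u [Eu ->]] := E_decomp x; exists (u i); split=> // w Ew.
rewrite (bigD1 i)//= addrC addrK ip_suml big1// => j ji.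
exact: (E_orth ji).
Qed.

Let E0 i : E i 0. Proof. by case: (E_subspace i). Qed.
Let ED i : forall (a : R[i]) x y, E i x -> E i y -> E i (a *: x + y).
Proof. by case: (E_subspace i). Qed.

Lemma E_oproj i : orth_proj ip (oproj ip (E i)).
Proof. exact: (oproj_orth_proj (@ED i) (E_exproj i)). Qed.

Lemma E_oproj_in i x : E i (oproj ip (E i) x).
Proof. by case: (oprojP (E_exproj i) x). Qed.

Lemma E_oproj_sum x : \sum_i oproj ip (E i) x = x.
Proof.
have [u [Eu xu]] := E_decomp x; rewrite [RHS]xu; apply: eq_bigr => i _.
apply: (oprojE (@ED i) (Eu i)) => w Ew.
rewrite xu (bigD1 i)//= addrC addrK ip_suml big1// => j ji.
exact: (E_orth ji).
Qed.

Lemma E_oproj_orth i j x : i != j -> oproj ip (E i) (oproj ip (E j) x) = 0.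
Proof.
move=> ij; apply: (oprojE (@ED i) (E0 i)) => w Ew; rewrite subr0.
by apply: (E_orth (i := j) (j := i)) => //; [rewrite eq_sym|exact: E_oproj_in].
Qed.

Lemma pi_sigma_subspace (sigma : {set 'I_n}) : is_subspace (pi_sigma sigma E).
Proof.
split; first by exists (fun=> 0) => //; rewrite big1.
move=> a _ _ [u Eu ->] [w Ew ->]; exists (fun i => a *: u i + w i).
  by move=> i si; apply: ED; [exact: Eu|exact: Ew].
by rewrite scaler_sumr -big_split.
Qed.

Lemma pi_sigma_exproj (sigma : {set 'I_n}) x :
  pi_sigma sigma E (\sum_(i in sigma) oproj ip (E i) x) /\
  forall w, pi_sigma sigma E w -> ip (x - \sum_(i in sigma) oproj ip (E i) x) w = 0.
Proof.
split; first by exists (fun i => oproj ip (E i) x) => // i _; exact: E_oproj_in.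
move=> _ [u Eu ->]; rewrite -{1}(E_oproj_sum x) (bigID (fun i => i \in sigma)) /=.
rewrite addrC addrK ip_suml big1// => j sj; rewrite ip_sumr big1// => i si.
have ji : j != i by apply: contraNneq sj => ->.
by apply: (E_orth ji); [exact: E_oproj_in|exact: Eu].
Qed.

Lemma pi_sigma_oproj (sigma : {set 'I_n}) x :
  oproj ip (pi_sigma sigma E) x = \sum_(i in sigma) oproj ip (E i) x.
Proof.
have [_ WD] := pi_sigma_subspace sigma; have [h1 h2] := pi_sigma_exproj sigma x.
exact: oprojE.
Qed.

Lemma pi_sigma_orth_proj (sigma : {set 'I_n}) : orth_proj ip (oproj ip (pi_sigma sigma E)).
Proof.
have [_ WD] := pi_sigma_subspace sigma.
by apply: oproj_orth_proj => // x; exists (\sum_(i in sigma) oproj ip (E i) x); exact: pi_sigma_exproj.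
Qed.

Lemma pi_sigma_closed (sigma : {set 'I_n}) : (forall x : H, ip x x = `|x| ^+ 2) ->
  closed_subspace (pi_sigma sigma E).
Proof.
move=> ip_norm; have [W0 WD] := pi_sigma_subspace sigma; split=> //.
rewrite (_ : pi_sigma sigma E = [set x | oproj ip (pi_sigma sigma E) x = x]).
  exact: orth_proj_closed (pi_sigma_orth_proj sigma).
apply/seteqP; split=> [x Wx|x /= <-]; first exact: oproj_id.
by rewrite pi_sigma_oproj; case: (pi_sigma_exproj sigma x).
Qed.

(** Indexing by a list allows an induction that adds one E_i at a time to the base space W. *)
Definition seq_sum (W : set H) (s : seq 'I_n) : set H :=
  [set y | exists2 w, W w & exists2 u : 'I_n -> H, forall i, i \in s -> E i (u i) &
    y = w + \sum_(i <- s) u i].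

Lemma fredholm_seq_sum (V : set H) T d (r : 'I_n -> int) k (s : seq 'I_n) :
  linear T -> (forall y, V (T y)) -> uniq s -> k \notin s ->
  (forall i, i \in s -> exists2 m : nat, r i = m%:Z & has_dim (E i) m) ->
  fredholm (E k) V T d -> fredholm (seq_sum (E k) s) V T (d + \sum_(i <- s) r i).
Proof.
move=> lT VT; elim: s => [|i s IH] /=.
  move=> _ _ _; rewrite big_nil addr0 (_ : seq_sum _ _ = E k)//.
  apply/seteqP; split=> [_ [w Ew [u _ ->]]|w Ew]; first by rewrite big_nil addr0.
  by exists w => //; exists (fun=> 0) => //; rewrite big_nil addr0.
move=> /andP[is_ us]; rewrite inE negb_or => /andP[ki ks] dims fE.
have [m rm [b [Eb b0 bs]]] := dims i (mem_head _ _).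
have sW : is_subspace (seq_sum (E k) s).
  split; first by exists 0 => //; exists (fun=> 0) => //; rewrite big1 ?addr0.
  move=> a _ _ [w Ew [u Eu ->]] [w' Ew' [u' Eu' ->]].
  exists (a *: w + w'); first exact: ED.
  exists (fun i => a *: u i + u' i); first by move=> j js; apply: ED; [exact: Eu|exact: Eu'].
  by rewrite scalerDr scaler_sumr addrACA -big_split.
have bW (a : 'I_m -> R[i]) : seq_sum (E k) s (\sum_j a j *: b j) -> forall j, a j = 0.
  (* A vector of E_i that lies in the sum of the other subspaces is orthogonal to itself, so its
     coefficients vanish. *)
  move=> [w Ew [u Eu e]]; apply: b0; rewrite /=.
  have Ev : E i (\sum_j a j *: b j).
    by apply: subspace_sum (E_subspace i) _ => j _; apply: subspaceZ (E_subspace i) (Eb j).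
  apply/eqP; rewrite -(dnorm_eq0 ip) {2}e ipDr ip_sumr.
  rewrite (_ : ip _ w = 0) ?add0r; last by apply: (E_orth (i := i) (j := k)); rewrite 1?eq_sym.
  rewrite big_seq big1// => j js; apply: (E_orth (i := i) (j := j)) => //; last exact: Eu.
  by apply: contraNneq is_ => ->.
have fs := IH us ks (fun j js => dims j (mem_behead (s := i :: s) js)) fE.
have := fredholm_add_span sW lT VT bW fs.
rewrite big_cons rm (addrC m%:Z) addrA; congr (fredholm _ V T _).
apply/seteqP; split=> [_ [_ [w Ew [u Eu ->]] [a ->]]|_ [w Ew [u Eu ->]]].
  exists w => //; exists (fun j => if j == i then \sum_j a j *: b j else u j).
    move=> j; rewrite inE; case: eqP => [-> _|_ /= js]; last exact: Eu.
    by apply: subspace_sum (E_subspace i) _ => l _; apply: subspaceZ (E_subspace i) (Eb l).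
  rewrite big_cons eqxx [X in _ = _ + X]addrC -addrA; congr (_ + (_ + _)).
  apply: eq_big_seq => j js; case: eqP => // ji; by move: is_; rewrite -ji js.
have [a /= ea] := bs (u i) (Eu i (mem_head _ _)).
exists (w + \sum_(j <- s) u j).
  by exists w => //; exists u => // j js; apply: Eu; rewrite inE js orbT.
exists a; rewrite big_cons -addrA [X in w + X]addrC; congr (_ + (_ + _)).
by apply/eqP; rewrite -subr_eq0; apply/eqP.
Qed.

Lemma pi_sigma_seq_sum (sigma : {set 'I_n}) k : k \in sigma ->
  pi_sigma sigma E = seq_sum (E k) (enum (sigma :\ k)).
Proof.
move=> sk; apply/seteqP; split=> [_ [u Eu ->]|_ [w Ew [u Eu ->]]].
  exists (u k); first exact: Eu.
  exists u; first by move=> i; rewrite mem_enum !inE => /andP[_ /Eu].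
  by rewrite (big_setD1 k)//= big_enum.
exists (fun i => if i == k then w else u i).
  move=> i si; case: eqP => [->//|/eqP ik]; apply: Eu.
  by rewrite mem_enum !inE ik.
rewrite (big_setD1 k)//= eqxx big_enum; congr (_ + _); apply: eq_bigr => i.
by rewrite !inE => /andP[/negbTE -> _].
Qed.

(** Projecting an orthonormal family onto E_i destroys orthonormality; [trace_le] compares the
    result with an orthonormal family inside E_i, whose sum the hypothesis bounds. *)
Lemma hs_op_range (i : 'I_n) (T : H -> H) : linear T ->
  (hs_sq ip (E i) T < +oo)%E -> hs_op ip (T \o oproj ip (E i)).
Proof.
move=> lT fT; have [lP sP PK] := E_oproj i; split; first exact: linear_comp.
apply: le_lt_trans fT; apply: ge_ereal_sup => _ [s [os _] <-].
have [x|f [of_ fW fX]] := @gram_schmidt _ _ ip (E i) (map (oproj ip (E i)) s) (E0 i) (@ED i).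
  by case/mapP => y _ ->; exact: E_oproj_in.
apply: (@le_trans _ _ (hsum ip f T T)%:E); last by apply: ereal_sup_ubound; exists f.
rewrite lee_fin.
suff : \sum_(e <- s) ip (T (oproj ip (E i) e)) (T (oproj ip (E i) e)) <=
    \sum_(u <- f) ip (T u) (T u).
  by rewrite lecE !Re_sum => /andP[].
rewrite (_ : \sum_(u <- f) _ = \sum_(u <- f) ip ((T \o oproj ip (E i)) u)
    ((T \o oproj ip (E i)) u)); last first.
  by apply: eq_big_seq => u uf /=; rewrite (oproj_id ip (@ED i) (fW _ uf)).
apply: trace_le => // e es /=.
rewrite {1}(fX (oproj ip (E i) e)) ?map_f// (linear_sum_seq _ _ _ lT).
apply: eq_big_seq => u uf; have Pu := oproj_id ip (@ED i) (fW _ uf).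
by rewrite Pu sP Pu.
Qed.

(** One orthonormal basis of the finite-dimensional E_i bounds the sums over all families in E_i, by
    [trace_le]. *)
Lemma hs_sq_finite_dim i m (T : H -> H) : linear T -> has_dim (E i) m ->
  (hs_sq ip (E i) T < +oo)%E.
Proof.
move=> lT [b [Eb _ bs]].
have [f of_ fX] := gram_schmidtT ip [seq b j | j <- enum 'I_m].
apply: le_lt_trans (ltry (hsum ip f T T)); apply: ge_ereal_sup => _ [s [os sE] <-].
rewrite lee_fin.
suff : \sum_(e <- s) ip (T e) (T e) <= \sum_(u <- f) ip (T u) (T u).
  by rewrite lecE !Re_sum => /andP[].
apply: trace_le => // e es.
have {1}-> : e = \sum_(u <- f) ip e u *: u.
  have [a /= /eqP] := bs e (sE e es); rewrite subr_eq0 => /eqP ->.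
  rewrite [LHS](eq_bigr (fun j => a j *: \sum_(u <- f) ip (b j) u *: u)); last first.
    by move=> j _; congr (_ *: _); apply: fX; apply: map_f; rewrite mem_enum.
  under eq_bigr do rewrite scaler_sumr.
  rewrite exchange_big; apply: eq_bigr => u _ /=; rewrite ip_suml scaler_suml.
  by apply: eq_bigr => j _; rewrite ipZl scalerA.
exact: linear_sum_seq.
Qed.

End FlagSum.


(** * The map to the Grassmannian *)

Section PiSigma.
Context {R : realType} {H : completeNormedModType R[i]}.
Variable ip : {dot H for Num.conj}.
Hypothesis ip_norm : forall x : H, ip x x = `|x| ^+ 2.
Variables (Hp Hm : set H).
Hypothesis pol : polarization ip Hp Hm.

Lemma polarization_exproj x :
  (exists y, Hp y /\ forall w, Hp w -> ip (x - y) w = 0) /\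
  (exists y, Hm y /\ forall w, Hm w -> ip (x - y) w = 0).
Proof.
have [_ _ o d] := pol; have [y [z [Hy Hz ->]]] := d x; split.
  exists y; split=> // w Hw; rewrite addrAC subrr add0r ip_conj.
  by rewrite (o w z)// conjc0.
by exists z; split=> // w Hw; rewrite addrK; exact: o.
Qed.

Lemma Hp_oproj : orth_proj ip (oproj ip Hp) /\ forall x, Hp (oproj ip Hp x).
Proof.
have [[[_ _ WD] _] _ _ _] := pol.
have ex x := (polarization_exproj x).1.
by split; [exact: oproj_orth_proj|move=> x; case: (oprojP ex x)].
Qed.

Lemma Hm_oproj : orth_proj ip (oproj ip Hm) /\ forall x, Hm (oproj ip Hm x).
Proof.
have [_ [[_ _ WD] _] _ _] := pol.
have ex x := (polarization_exproj x).2.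
by split; [exact: oproj_orth_proj|move=> x; case: (oprojP ex x)].
Qed.

Variables (n : nat) (r : 'I_n -> int) (k l : 'I_n).
Variables (sigma : {set 'I_n}) (k_sigma : k \in sigma) (l_sigma : l \notin sigma).

Lemma pi_sigma_grassmannian E : flag ip Hp Hm r k l E ->
  grassmannian ip Hp Hm (\sum_(i in sigma) r i) (pi_sigma sigma E).
Proof.
move=> [[Ecl Eo] Ed [_ fk hk] _ dims].
have [[lp _ _] pHp] := Hp_oproj; have [[lm _ _] _] := Hm_oproj.
have dim i : i \in sigma -> i != k -> exists2 m : nat, r i = m%:Z & has_dim (E i) m.
  by move=> si ik; apply: dims => //; apply: contraNneq l_sigma => <-.
split; first exact: (pi_sigma_closed Ecl Eo Ed).
  rewrite (pi_sigma_seq_sum E k_sigma) (big_setD1 k)//= -big_enum.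
  apply: (fredholm_seq_sum Ecl Eo lp pHp _ _ _ fk).
  - exact: enum_uniq.
  - by rewrite mem_enum !inE eqxx.
  - by move=> i; rewrite mem_enum !inE => /andP[ik si]; exact: dim.
have hT i : i \in sigma -> hs_op ip (oproj ip Hm \o oproj ip (E i)).
  move=> si; apply: (hs_op_range Ecl Eo Ed lm).
  have [->//|ik] := eqVneq i k; have [m _ hm] := dim i si ik.
  exact: hs_sq_finite_dim hm.
(* On the sum of the E_i the operator pr_- agrees with this finite sum of Hilbert-Schmidt operators
   pr_- P_i. *)
pose T : hs ip := \sum_(i in sigma) to_hs ip (oproj ip Hm \o oproj ip (E i)).
apply: le_lt_trans (hs_funK T).2; apply: ge_ereal_sup => _ [s [os sW] <-].
apply: ereal_sup_ubound; exists s => //; congr (_%:E).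
apply: eq_big_seq => e es; suff -> : T e = oproj ip Hm e by [].
rewrite /T hs_sum -[in RHS](oproj_id ip (pi_sigma_subspace Ecl sigma).2 (sW e es)).
rewrite (pi_sigma_oproj Ecl Eo Ed) (linear_sumr _ _ _ lm).
by apply: eq_bigr => i si; rewrite to_hsE//; exact: hT.
Qed.

(** Because k is in sigma and l is not, the references add up to pr_+; hence the embedding of the
    sum of subspaces is the sum of their embeddings. *)
Lemma sum_flag_ref x : \sum_(i in sigma) flag_ref ip Hp Hm k l i x = oproj ip Hp x.
Proof.
rewrite (big_setD1 k)//= /flag_ref eqxx big1 ?addr0// => i.
rewrite !inE => /andP[/negbTE -> si]; case: eqP => // il.
by move: l_sigma; rewrite -il si.
Qed.

Lemma gr_embed_pi_sigma E : flag ip Hp Hm r k l E ->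
  (forall i, hs_op ip (fun x => oproj ip (E i) x - flag_ref ip Hp Hm k l i x)) ->
  hs_op ip (fun x => oproj ip (pi_sigma sigma E) x - oproj ip Hp x) /\
  gr_embed ip Hp (pi_sigma sigma E) =
    \sum_(i in sigma) flag_embed ip Hp Hm k l i (E i).
Proof.
move=> [[Ecl Eo] Ed _ _ _] hE.
have E1 : (fun x => oproj ip (pi_sigma sigma E) x - oproj ip Hp x) =
    (\sum_(i in sigma) flag_embed ip Hp Hm k l i (E i) : hs ip).
  apply/funext => x; rewrite hs_sum (pi_sigma_oproj Ecl Eo Ed) -sum_flag_ref -sumrB.
  by apply: eq_bigr => i _; rewrite /flag_embed to_hsE.
have h : hs_op ip (fun x => oproj ip (pi_sigma sigma E) x - oproj ip Hp x).
  by rewrite E1; exact: hs_funK.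
by split=> //; apply: hs_ext => x; rewrite /gr_embed to_hsE//; exact: (congr1 (fun f : H -> H => f x) E1).
Qed.

End PiSigma.


Section GrassmannianSpeed.
Context {R : realType} {H : completeNormedModType R[i]}.
Variable ip : {dot H for Num.conj}.
Variables (Hp Hm : set H) (d : int).
Hypothesis pol : polarization ip Hp Hm.
Context {V : normedModType R}.
Variables (O : set V) (phi : V -> set H).
Hypothesis oO : open O.
Hypothesis phi_smooth : gr_smooth ip Hp Hm d O phi.

Let T v := gr_embed ip Hp (phi v).

(** Existence of the projection is obtained without a nearest-point argument: the Hilbert-Schmidt
    clause of [gr_smooth] makes [oproj] linear, and [linear_oproj_exists] applies. *)
Lemma gr_oproj v : O v ->
  [/\ orth_proj ip (oproj ip (phi v)), forall x, phi v (oproj ip (phi v) x) &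
      forall x, phi v x -> oproj ip (phi v) x = x].
Proof.
move=> Ov; have [gr hs_ _] := phi_smooth.
have [[_ W0 WD] _ _] := gr v Ov; have [[lp _ _] _] := Hp_oproj pol.
have lW : linear (oproj ip (phi v)).
  move=> a x y; have := (hs_ v Ov).1 a x y; rewrite lp => h.
  apply: (@addIr _ (- (a *: oproj ip Hp x + oproj ip Hp y))); rewrite h.
  by rewrite opprD scalerBr addrACA.
have ex := linear_oproj_exists W0 WD lW.
split; first exact: oproj_orth_proj; last by move=> x; exact: oproj_id.
by move=> x; case: (oprojP ex x).
Qed.

Lemma gr_proj_at v : O v -> proj_at (oproj ip Hp) T v = oproj ip (phi v).
Proof.
move=> Ov; have [_ hs_ _] := phi_smooth; apply/funext => x.
rewrite /proj_at /T /gr_embed (to_hsE (hs_ v Ov)).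
exact: subrKC.
Qed.

Let near_proj v : O v -> \forall u \near v, orth_proj ip (proj_at (oproj ip Hp) T u).
Proof.
move=> Ov; near=> u; have Ou : O u by near: u; exact: open_nbhs_nbhs.
by rewrite gr_proj_at//; case: (gr_oproj Ou).
Unshelve. all: by end_near. Qed.

Let Td v e : O v -> is_derive v e T ('D_e T v).
Proof. by move=> Ov; have [_ _ sT] := phi_smooth; exact: smooth_on_is_derive sT Ov. Qed.

Lemma gr_derive_offdiag v e x : O v ->
  'D_e T v x = oproj ip (phi v) ('D_e T v x) + 'D_e T v (oproj ip (phi v) x).
Proof.
move=> Ov; have [pp _] := Hp_oproj pol.
by rewrite -(gr_proj_at Ov); exact: (derive_offdiag (near_proj Ov) pp (Td e Ov)).
Qed.

(** The tangent vector is one off-diagonal block of the derivative of the embedding. The other block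
    is its adjoint and has the same norm, whence the factor 1/2. *)
Lemma gr_speed2E v e : O v ->
  gr_speed2 ip Hp phi v e = 2^-1 * hsip ('D_e T v) ('D_e T v).
Proof.
move=> Ov; have [PP PW PWid] := gr_oproj Ov; have [pp _] := Hp_oproj pol.
have [gr _ _] := phi_smooth; have [[_ W0 WD] _ _] := gr v Ov.
rewrite /gr_speed2 /gr_diff hsip_norm mulrC -[RHS]/(fine (_%:E)).
congr fine; apply: (hs_sq_offdiag PP) => //.
  by move=> x; exact: gr_derive_offdiag.
exact: selfadjoint_ip (derive_selfadjoint pp (near_proj Ov) (Td e Ov)).
Qed.

End GrassmannianSpeed.


(** * Charts and the Dirichlet density *)

Section ComplexTopology.
Context {R : realType}.

Lemma cvg_Re T (F : set_system T) {FF : Filter F} (f : T -> R[i]^o) (l : R[i]^o) :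
  f @ F --> l -> (complex.Re (f x) : R^o) @[x --> F] --> (complex.Re l : R^o).
Proof.
move=> fl; apply/cvgrPdist_lt => e e0.
have e0' : 0 < e%:C :> R[i] by rewrite ltcR.
move/cvgrPdist_lt: fl => /(_ _ e0') fl; near=> x.
rewrite -ltcR -ReN -ReD; apply: le_lt_trans (normc_ge_Re _) _.
by near: x.
Unshelve. all: by end_near. Qed.

Lemma cvg_Im T (F : set_system T) {FF : Filter F} (f : T -> R[i]^o) (l : R[i]^o) :
  f @ F --> l -> (complex.Im (f x) : R^o) @[x --> F] --> (complex.Im l : R^o).
Proof.
have ImE (z : R[i]) : complex.Im z = complex.Re ((0 -i* 1) * z).
  by case: z => a b /=; ring.
move=> fl; rewrite ImE; under eq_fun do rewrite ImE.
apply: cvg_Re; exact: cvgZl_tmp.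
Qed.

Lemma normc_le (z : R[i]) : `|z| <= (`|complex.Re z| + `|complex.Im z|)%:C.
Proof.
case: z => a b; rewrite normc_def lecR /=.
rewrite -[leRHS]ger0_norm ?addr_ge0// -sqrtr_sqr ler_wsqrtr//.
have := mulr_ge0 (normr_ge0 a) (normr_ge0 b).
by rewrite sqrrD !real_normK ?num_real// mulr2n => ?; lra.
Qed.

Lemma cvg_complex T (F : set_system T) {FF : Filter F} (f g : T -> R^o) (a b : R) :
  f @ F --> (a : R^o) -> g @ F --> (b : R^o) ->
  (f x +i* g x : R[i]^o) @[x --> F] --> (a +i* b : R[i]^o).
Proof.
(* A positive element of [R[i]] is real, so the radius has imaginary part 0. *)
move=> fa gb; apply/cvgrPdist_lt => -[e e']; rewrite ltcE /= => /andP[/eqP e'0 e0].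
rewrite e'0 in e0 *.
have e2 : 0 < e / 2 by rewrite divr_gt0.
move/cvgrPdist_lt: fa => /(_ _ e2) fa; move/cvgrPdist_lt: gb => /(_ _ e2) gb.
near=> x; apply: le_lt_trans (normc_le _) _; rewrite -[_ +i* 0]/(_%:C) ltcR /=.
by rewrite (splitr e) ltrD//; near: x.
Unshelve. all: by end_near. Qed.

(** Restricts a complex difference quotient to the increments t w with t real. *)
Lemma cvg_real_dnbhs (w : R[i]) : w != 0 ->
  (t%:C * w : R[i]^o) @[t --> (0 : R)^'] --> (0 : R[i]^o)^'.
Proof.
move=> w0 A /= /nbhs_normP[e /= e0 he].
have nw0 : 0 < `|w| by rewrite normr_gt0.
have [r r0 rE] : exists2 r : R, 0 < r & r%:C * `|w| <= e.
  move: nw0 e0; case: `|w| => u u'; case: e he => e e' he.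
  rewrite !ltcE /= => /andP[/eqP -> u0] /andP[/eqP -> e0].
  exists (e / u); first by rewrite divr_gt0.
  rewrite -[u +i* 0]/(u%:C) -rmorphM divfK ?gt_eqF//.
apply/nbhs_normP; exists r => //= t /=; rewrite sub0r normrN => tr t0.
apply: he => /=; last first.
  by rewrite mulf_neq0// eq_complex /= negb_and; apply/orP; left.
rewrite sub0r normrN normrM (lt_le_trans _ rE)// ltr_pM2r//.
by rewrite normc_def /= expr0n addr0 sqrtr_sqr ltcR.
Qed.

(* The real directional derivatives of a holomorphic function: multiply the
   complex difference quotient at the increment t w by w. *)
Lemma holomorphic_dir (h : R[i] -> R[i]) (z w : R[i]) : w != 0 ->
  derivable (h : R[i]^o -> R[i]^o) z 1 ->
  let D := w * 'D_1 (h : R[i]^o -> R[i]^o) z in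
  is_derive (0 : R) 1 (fun t : R => complex.Re (h (t%:C * w + z)) : R^o) (complex.Re D) /\
  is_derive (0 : R) 1 (fun t : R => complex.Im (h (t%:C * w + z)) : R^o) (complex.Im D).
Proof.
move=> w0 hd D.
pose q (t : R) : R[i]^o := (t^-1)%:C * (h (t%:C * w + z) - h z).
have qD : q t @[t --> (0 : R)^'] --> (D : R[i]^o).
  pose proof (@cvgZl_tmp _ _ _ _ _ w _ _ (cvg_comp _ _ (cvg_real_dnbhs w0) hd)) as L.
  refine (cvg_trans _ L); apply: near_eq_cvg; near=> t; rewrite /q /=.
  have t0 : t != 0 by near: t; exact: nbhs_dnbhs_neq.
  rewrite [_ *: 1]mulr1 [LHS]mulrA; congr (_ * _).
  rewrite invfM mulrCA mulfV// mulr1 -(rmorphV (real_complex R))//.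
  by rewrite unitfE.
have E0 : (0 : R)%:C * w + z = z by rewrite mul0r add0r.
have tE (t : R) : (t *: 1 + 0 : R) = t by rewrite addr0; exact: mulr1.
split; apply/is_deriveP; rewrite E0.
- refine (cvg_trans _ (cvg_Re qD)); apply: near_eq_cvg; near=> t.
  by rewrite tE /q Re_realM ReD ReN.
- refine (cvg_trans _ (cvg_Im qD)); apply: near_eq_cvg; near=> t.
  by rewrite tE /q; case: (h _) (h z) => ? ? [? ?] /=; rewrite mul0r addr0.
Unshelve. all: by end_near. Qed.

End ComplexTopology.


Section Charts.
Context {R : realType} {M : ptopologicalType}.
Variable S : riemann_surface R M.
Implicit Types (c : chart S) (p q : M) (v : R * R).

Definition toC (v : R * R) : R[i] := v.1 +i* v.2.

Lemma toC_xy c p : toC (xy c p) = chart_coord c p.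
Proof. by rewrite /toC /xy; case: (chart_coord c p). Qed.

Lemma of_xyK c p : chart_dom c p -> of_xy c (xy c p) = p.
Proof. by move=> cp; rewrite /of_xy -/(toC _) toC_xy rs_coordK. Qed.

Lemma chart_img_xy c p : chart_dom c p -> chart_img c (xy c p).
Proof. by move=> cp; exists p. Qed.

Lemma chart_imgP c v : chart_img c v -> chart_dom c (of_xy c v) /\ xy c (of_xy c v) = v.
Proof. by move=> [p cp <-]; rewrite of_xyK. Qed.

Lemma toC_cvg v : toC u @[u --> v] --> (toC v : R[i]^o).
Proof. by apply: cvg_complex; [exact: cvg_fst|exact: cvg_snd]. Qed.

Lemma xy_cvg c p : chart_dom c p -> xy c q @[q --> p] --> xy c p.
Proof.
move=> cp; have h := rs_coord_cont cp.
exact: (cvg_pair (cvg_Re h) (cvg_Im h)).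
Qed.

Lemma of_xy_cvg c v : chart_img c v -> of_xy c u @[u --> v] --> of_xy c v.
Proof.
move=> [p cp <-].
have cz : (chart_coord c @` chart_dom c) (toC (xy c p)) by exists p; rewrite ?toC_xy.
have h := rs_inv_cont cz.
have := cvg_comp _ _ (@toC_cvg (xy c p)) h.
by apply.
Qed.

Lemma chart_img_open c : open (chart_img c).
Proof.
rewrite (_ : chart_img c = toC @^-1` (chart_coord c @` chart_dom c)).
  apply: (@open_comp _ (R[i]^o : topologicalType)); last exact: rs_open_img.
  by move=> v _; exact: toC_cvg.
apply/seteqP; split=> [_ [p cp <-]|v [p cp]] /=; first by exists p; rewrite ?toC_xy.
by move=> pv; exists p => //; rewrite /xy pv; case: (v).
Qed.

Lemma near_chart c p : chart_dom c p -> \forall q \near p, chart_dom c q.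
Proof. by move=> cp; apply: open_nbhs_nbhs; split=> //; exact: rs_open_dom. Qed.

Lemma near_of_xy c p (P : M -> Prop) : chart_dom c p ->
  (\forall q \near p, P q) -> \forall u \near xy c p, P (of_xy c u).
Proof.
by move=> cp Pp; apply: (of_xy_cvg (chart_img_xy cp)); rewrite of_xyK.
Qed.

Lemma near_xy c p (P : R * R -> Prop) : chart_dom c p ->
  (\forall u \near xy c p, P u) -> \forall q \near p, P (xy c q).
Proof. by move=> cp; exact: xy_cvg. Qed.

Lemma near_chart_img c v : chart_img c v -> \forall u \near v, chart_img c u.
Proof. by move=> cv; apply: open_nbhs_nbhs; split=> //; exact: chart_img_open. Qed.

Definition transition c c' : R[i] -> R[i] := chart_coord c' \o chart_inv c.

Definition dtransition c c' p : R[i] :=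
  'D_1 (transition c c' : R[i]^o -> R[i]^o) (chart_coord c p).

Context {H : lmodType R[i]}.
Variable ip : {dot H for Num.conj}.
Implicit Types f g : M -> hs ip.

Definition pd (e : R * R) c f p : hs ip := 'D_e (f \o of_xy c) (xy c p).

(** Holomorphy gives the transition, along the line z + t w, the real derivatives Re and Im of w
    times its complex derivative; the chain rule [is_derive_curve] does the rest. *)
Lemma transition_derive c c' p f (w : R[i]) : chart_dom c p -> chart_dom c' p ->
  w != 0 -> C1_at (f \o of_xy c') (xy c' p) ->
  is_derive (xy c p) (complex.Re w, complex.Im w) (f \o of_xy c)
    (complex.Re (w * dtransition c c' p) *: pd (1, 0) c' f p +
     complex.Im (w * dtransition c c' p) *: pd (0, 1) c' f p).
Proof.
move=> cp c'p w0 fC1.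
set v := xy c p; set e := (_, _); set z := chart_coord c p.
have zin : (chart_coord c @` (chart_dom c `&` chart_dom c')) z by exists p.
have [hd _] := rs_transition zin.
have [h1 h2] := holomorphic_dir w0 hd.
have zE (s : R) : toC (s *: e + v) = s%:C * w + z.
  rewrite /z -toC_xy -/v /toC /e; case: (w) (v) => a b [x y] /=.
  by congr (_ +i* _); rewrite /= ?mul0r ?subr0 ?addr0 //.
have t0 : transition c c' (0%:C * w + z) = chart_coord c' p.
  by rewrite mul0r add0r /transition /= rs_coordK.
have xy0 : (complex.Re (transition c c' (0%:C * w + z)),
            complex.Im (transition c c' (0%:C * w + z))) = xy c' p by rewrite t0.
have := @is_derive_curve R H ip (f \o of_xy c') _ _ _ _ _ h1 h2.
rewrite -/(transition c c') xy0 => /(_ fC1) h.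
apply/is_derive_line0; apply: is_derive_near h.
have sv : (s : R) *: e + v @[s --> (0 : R)] --> v.
  have := cvgD (cvgZr_tmp (a := e) (@cvg_id _ (nbhs (0 : R)))) (@cvg_cst _ v _ (nbhs (0 : R)) _).
  by rewrite scale0r add0r; apply.
have n1 : \forall u \near v, chart_dom c' (of_xy c u).
  exact: near_of_xy cp (near_chart c'p).
have n2 : \forall u \near v, chart_img c u by exact/near_chart_img/chart_img_xy.
have n1s := sv _ n1; have n2s := sv _ n2.
near=> s.
have d1 : chart_dom c' (of_xy c (s *: e + v)) by near: s.
rewrite /= -[RHS](congr1 f (of_xyK d1)); congr (f (of_xy c' _)).
by rewrite /xy /of_xy -/(toC _) zE.
Unshelve. all: by end_near. Qed.

End Charts.


Section Pairing.
Context {R : realType} {M : ptopologicalType}.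
Variable S : riemann_surface R M.
Context {H : lmodType R[i]}.
Variable ip : {dot H for Num.conj}.
Implicit Types (c : chart S) (p q : M) (v : R * R) (f g : M -> hs ip).

(** Required at all points near p, so that the property passes to neighbouring points and can be
    moved to another chart. *)
Definition C1_chart c f p : Prop := \forall q \near p, C1_at (f \o of_xy c) (xy c q).

Let reI (z : R[i]) : complex.Re ((0 +i* 1) * z) = - complex.Im z.
Proof. by case: z => a b /=; ring. Qed.
Let imI (z : R[i]) : complex.Im ((0 +i* 1) * z) = complex.Re z.
Proof. by case: z => a b /=; ring. Qed.

Lemma transition_pd c c' p f : chart_dom c p -> chart_dom c' p ->
  C1_at (f \o of_xy c') (xy c' p) ->
  let t := dtransition c c' p in
  is_derive (xy c p) (1, 0) (f \o of_xy c)
    (complex.Re t *: pd (1, 0) c' f p + complex.Im t *: pd (0, 1) c' f p) /\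
  is_derive (xy c p) (0, 1) (f \o of_xy c)
    (- complex.Im t *: pd (1, 0) c' f p + complex.Re t *: pd (0, 1) c' f p).
Proof.
move=> cp c'p fC1 t; split.
  have := transition_derive cp c'p (oner_neq0 _) fC1.
  by rewrite mul1r; exact.
have i0 : (0 +i* 1) != 0 :> R[i] by rewrite eq_complex /= oner_eq0 andbF.
have := transition_derive cp c'p i0 fC1.
by rewrite reI imI; exact.
Qed.

(** The partial derivatives in c combine those in c' with coefficients taken from [dtransition],
    which are continuous because [holomorphic_on] includes continuity of the derivative. *)
Lemma C1_transition c c' p f : chart_dom c p -> chart_dom c' p ->
  C1_chart c' f p -> C1_chart c f p.
Proof.
move=> cp c'p fC1.
have n1 := near_chart cp; have n2 := near_chart c'p.
pose proof (filterI fC1 (filterI n1 n2)) as good.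
pose proof (near_join good) as good2.
rewrite /C1_chart; near=> q.
have gq : \forall r \near q, C1_at (f \o of_xy c') (xy c' r) /\ (chart_dom c r /\ chart_dom c' r).
  by near: q.
have [fq [cq c'q]] := nbhs_singleton gq.
have gv := near_of_xy cq gq.
have iv := near_chart_img (chart_img_xy cq).
pose t u := dtransition c c' (of_xy c u).
pose X u := pd (1, 0) c' f (of_xy c u); pose Y u := pd (0, 1) c' f (of_xy c u).
have ct : t u @[u --> xy c q] --> (t (xy c q) : R[i]^o).
  have zin : (chart_coord c @` (chart_dom c `&` chart_dom c')) (chart_coord c q) by exists q.
  have [_ ctau] := rs_transition zin.
  have cco : chart_coord c (of_xy c u) @[u --> xy c q] --> (chart_coord c q : R[i]^o).
    have h := rs_coord_cont cq; have h' := of_xy_cvg (chart_img_xy cq).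
    rewrite (of_xyK cq) in h'; exact: (cvg_comp _ _ h' h).
  have := cvg_comp _ _ cco ctau.
  by rewrite /t /dtransition of_xyK.
have [_ cX0 cY0] := fq.
have cxy : xy c' (of_xy c u) @[u --> xy c q] --> xy c' q.
  have h := xy_cvg c'q; have h' := of_xy_cvg (chart_img_xy cq).
  rewrite (of_xyK cq) in h'; exact: (cvg_comp _ _ h' h).
have cX : X u @[u --> xy c q] --> X (xy c q).
  by rewrite /X /pd (of_xyK cq); exact: (cvg_comp _ _ cxy cX0).
have cY : Y u @[u --> xy c q] --> Y (xy c q).
  by rewrite /Y /pd (of_xyK cq); exact: (cvg_comp _ _ cxy cY0).
have dv : \forall u \near xy c q,
    is_derive (u : R * R) ((1, 0) : R * R) (f \o of_xy c) (complex.Re (t u) *: X u + complex.Im (t u) *: Y u) /\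
    is_derive (u : R * R) ((0, 1) : R * R) (f \o of_xy c) (- complex.Im (t u) *: X u + complex.Re (t u) *: Y u).
  near=> u.
  have iu : chart_img c u by near: u.
  have [f1 [c1 c2]] : C1_at (f \o of_xy c') (xy c' (of_xy c u)) /\
    (chart_dom c (of_xy c u) /\ chart_dom c' (of_xy c u)) by near: u.
  by have := transition_pd c1 c2 f1; rewrite (chart_imgP iu).2.
pose proof (cvg_Re ct) as cRe; pose proof (cvg_Im ct) as cIm.
have v1 : \forall u \near xy c q, complex.Re (t u) *: X u + complex.Im (t u) *: Y u =
    'D_(1, 0) (f \o of_xy c) u.
  by apply: filterS dv => u [h _]; rewrite (@derive_val _ _ _ _ _ _ _ h).
have v2 : \forall u \near xy c q, - complex.Im (t u) *: X u + complex.Re (t u) *: Y u =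
    'D_(0, 1) (f \o of_xy c) u.
  by apply: filterS dv => u [_ h]; rewrite (@derive_val _ _ _ _ _ _ _ h).
split.
- by apply: filterS dv => u [[h1 _] [h2 _]]; exact: (conj h1 h2).
- rewrite /prop_for /continuous_at -(nbhs_singleton v1).
  apply: (cvg_near v1); exact: (cvgD (cvgZ cRe cX) (cvgZ cIm cY)).
- rewrite /prop_for /continuous_at -(nbhs_singleton v2).
  apply: (cvg_near v2); exact: (cvgD (cvgZ (cvgN cIm) cX) (cvgZ cRe cY)).
Unshelve. all: by end_near. Qed.

Definition dpair c f g p : R :=
  hsip (pd (1, 0) c f p) (pd (1, 0) c g p) + hsip (pd (0, 1) c f p) (pd (0, 1) c g p).

(** The Jacobian of a holomorphic transition is |t| times a rotation, so the pairing of gradients is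
    multiplied by |t|^2. *)
Lemma dpair_transition c c' p f g : chart_dom c p -> chart_dom c' p ->
  C1_at (f \o of_xy c') (xy c' p) -> C1_at (g \o of_xy c') (xy c' p) ->
  dpair c f g p = dpair c' f g p * complex.Re `|dtransition c c' p| ^+ 2.
Proof.
move=> cp c'p fC1 gC1.
have [f1 f2] := transition_pd cp c'p fC1; have [g1 g2] := transition_pd cp c'p gC1.
have E1 := @derive_val _ _ _ _ _ _ _ f1; have E2 := @derive_val _ _ _ _ _ _ _ f2.
have E3 := @derive_val _ _ _ _ _ _ _ g1; have E4 := @derive_val _ _ _ _ _ _ _ g2.
clear f1 f2 g1 g2 fC1 gC1.
rewrite /dpair [pd (1, 0) c f p]E1 [pd (0, 1) c f p]E2 [pd (1, 0) c g p]E3 [pd (0, 1) c g p]E4.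
clear E1 E2 E3 E4.
rewrite normc_def /= sqr_sqrtr ?addr_ge0 ?sqr_ge0//.
move: (complex.Re _) (complex.Im _) => a b.
move: (pd _ _ f p) (pd _ _ f p) (pd _ _ g p) (pd _ _ g p) => X Y X' Y'.
rewrite !hsipDl !hsipDr !hsipZl !hsipZr.
move: (hsip X X') (hsip X Y') (hsip Y X') (hsip Y Y') => x y z w.
ring.
Qed.

End Pairing.


Section C1Algebra.
Context {R : realType} {H : lmodType R[i]}.
Variable ip : {dot H for Num.conj}.
Implicit Types (F G : R * R -> hs ip) (v : R * R).

Lemma C1_at_derive F v : C1_at F v ->
  is_derive v ((1, 0) : R * R) F ('D_(1, 0) F v) /\ is_derive v ((0, 1) : R * R) F ('D_(0, 1) F v).
Proof.
move=> [/nbhs_singleton[h1 h2] _ _].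
exact: conj (derivableP h1) (derivableP h2).
Qed.

Lemma C1_at_intro F F1 F2 v :
  (\forall y \near v, is_derive (y : R * R) ((1, 0) : R * R) F (F1 y) /\
                      is_derive (y : R * R) ((0, 1) : R * R) F (F2 y)) ->
  {for v, continuous F1} -> {for v, continuous F2} -> C1_at F v.
Proof.
move=> Fd c1 c2.
have v1 : \forall y \near v, F1 y = 'D_(1, 0) F y.
  by apply: filterS Fd => y [h _]; rewrite (@derive_val _ _ _ _ _ _ _ h).
have v2 : \forall y \near v, F2 y = 'D_(0, 1) F y.
  by apply: filterS Fd => y [_ h]; rewrite (@derive_val _ _ _ _ _ _ _ h).
split.
- by apply: filterS Fd => y [[h1 _] [h2 _]]; exact: (conj h1 h2).
- by rewrite /prop_for /continuous_at -(nbhs_singleton v1); exact: (cvg_near v1).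
- by rewrite /prop_for /continuous_at -(nbhs_singleton v2); exact: (cvg_near v2).
Qed.

Lemma C1_at_near F v : C1_at F v -> \forall y \near v,
  is_derive (y : R * R) ((1, 0) : R * R) F ('D_(1, 0) F y) /\
  is_derive (y : R * R) ((0, 1) : R * R) F ('D_(0, 1) F y).
Proof.
move=> [Fd _ _]; apply: filterS Fd => y [h1 h2].
exact: (conj (derivableP h1) (derivableP h2)).
Qed.

Lemma C1_at_ext F G v : (\forall y \near v, F y = G y) -> C1_at F v -> C1_at G v.
Proof.
move=> FG Fv; have FG2 := near_join FG; have Fd := C1_at_near Fv.
have [_ c1 c2] := Fv; apply: (C1_at_intro _ c1 c2).
near=> y.
have [h1 h2] : is_derive (y : R * R) ((1, 0) : R * R) F ('D_(1, 0) F y) /\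
  is_derive (y : R * R) ((0, 1) : R * R) F ('D_(0, 1) F y) by near: y.
have FGy : \forall z \near y, F z = G z by near: y.
exact: (conj (is_derive_near FGy h1) (is_derive_near FGy h2)).
Unshelve. all: by end_near. Qed.

(** Directional derivatives at a point do not give continuity by themselves; [C1_at_total] supplies
    the bound |F (w + v) - F v| <= K |w| for small w. *)
Lemma C1_at_continuous F v : C1_at F v -> {for v, continuous F}.
Proof.
move=> Fv; have tot := C1_at_total Fv ltr01.
set D1 := 'D_(1, 0) F v in tot; set D2 := 'D_(0, 1) F v in tot.
pose K := `|D1| + `|D2| + 1; have K0 : 0 < K by rewrite ltr_wpDl// addr_ge0.
have bound : \forall w \near (0 : R * R), `|F (w + v) - F v| <= K * `|w|.
  apply: filterS tot => w; rewrite mul1r => tw.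
  have w1 : `|w.1| <= `|w| by rewrite prod_normE le_max lexx.
  have w2 : `|w.2| <= `|w| by rewrite prod_normE le_max lexx orbT.
  rewrite -(subrK (w.1 *: D1 + w.2 *: D2) (F (w + v) - F v)).
  apply: le_trans (ler_normD _ _) _; rewrite addrC /K 2!mulrDl mul1r.
  apply: lerD tw; apply: le_trans (ler_normD _ _) _; rewrite !normrZ.
  by apply: lerD; rewrite mulrC; apply: ler_wpM2l.
apply/cvgrPdist_lt => e e0.
move/nbhs_normP: bound => [r /= r0 hr].
suff : \forall y \near v, `|F v - F y| < e by [].
apply/nbhs_normP; exists (Num.min r (e / K)) => /=; first by rewrite lt_min r0 divr_gt0.
move=> y /=; rewrite lt_min => /andP[yr yK].
have := hr (y - v); rewrite /= sub0r normrN distrC subrK => /(_ yr) h.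
by rewrite distrC; apply: le_lt_trans h _; rewrite mulrC -ltr_pdivlMr.
Qed.

Lemma C1_at_sub F G v : C1_at F v -> C1_at G v -> C1_at (fun y => F y - G y) v.
Proof.
move=> Fv Gv; have Fd := C1_at_near Fv; have Gd := C1_at_near Gv.
have [_ f1 f2] := Fv; have [_ g1 g2] := Gv.
apply: (C1_at_intro _ (cvgB f1 g1) (cvgB f2 g2)).
near=> y.
have [h1 h2] : is_derive (y : R * R) ((1, 0) : R * R) F ('D_(1, 0) F y) /\
  is_derive (y : R * R) ((0, 1) : R * R) F ('D_(0, 1) F y) by near: y.
have [k1 k2] : is_derive (y : R * R) ((1, 0) : R * R) G ('D_(1, 0) G y) /\
  is_derive (y : R * R) ((0, 1) : R * R) G ('D_(0, 1) G y) by near: y.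
exact: (conj (is_deriveB h1 k1) (is_deriveB h2 k2)).
Unshelve. all: by end_near. Qed.

Lemma C1_at_scale (b b1 b2 : R * R -> R) F v :
  (forall y : R * R, is_derive y ((1, 0) : R * R) (b : R * R -> R^o) (b1 y) /\
                     is_derive y ((0, 1) : R * R) (b : R * R -> R^o) (b2 y)) ->
  {for v, continuous (b : R * R -> R^o)} ->
  {for v, continuous (b1 : R * R -> R^o)} -> {for v, continuous (b2 : R * R -> R^o)} ->
  C1_at F v -> C1_at (fun y => b y *: F y) v.
Proof.
move=> bd cb cb1 cb2 Fv; have Fd := C1_at_near Fv; have cF := C1_at_continuous Fv.
have [_ f1 f2] := Fv.
apply: (C1_at_intro _ (cvgD (cvgZ cb1 cF) (cvgZ cb f1)) (cvgD (cvgZ cb2 cF) (cvgZ cb f2))).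
near=> y.
have [h1 h2] : is_derive (y : R * R) ((1, 0) : R * R) F ('D_(1, 0) F y) /\
  is_derive (y : R * R) ((0, 1) : R * R) F ('D_(0, 1) F y) by near: y.
have [k1 k2] := bd y.
exact: (conj (is_derive_bilinear (scale_bilinear ip) k1 h1) (is_derive_bilinear (scale_bilinear ip) k2 h2)).
Unshelve. all: by end_near. Qed.

Lemma C1_at_cst T v : C1_at (fun=> T : hs ip) v.
Proof.
apply: (C1_at_intro (F1 := fun=> 0) (F2 := fun=> 0)); [|exact: cvg_cst|exact: cvg_cst].
by near=> y; exact: (conj (is_derive_cst T y _) (is_derive_cst T y _)).
Unshelve. all: by end_near. Qed.

Lemma smooth_on_C1_at (O : set (R * R)) F v : open O -> O v -> smooth_on O F -> C1_at F v.
Proof.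
move=> oO Ov sF.
have c1 := smooth_on_continuous (smooth_on_derive ((1, 0) : R * R) sF) Ov.
have c2 := smooth_on_continuous (smooth_on_derive ((0, 1) : R * R) sF) Ov.
apply: (C1_at_intro _ c1 c2).
near=> y; have Oy : O y by near: y; exact: open_nbhs_nbhs.
exact: (conj (smooth_on_is_derive _ sF Oy) (smooth_on_is_derive _ sF Oy)).
Unshelve. all: by end_near. Qed.

End C1Algebra.

Section Density.
Context {R : realType} {M : ptopologicalType}.
Variable S : riemann_surface R M.
Variable g : conformal_metric S.
Context {H : lmodType R[i]}.
Variable ip : {dot H for Num.conj}.
Implicit Types (c : chart S) (p q : M) (f h k : M -> hs ip).

Definition C1M f : Prop := forall c p, chart_dom c p -> C1_chart c f p.

Lemma C1M_at f c p : C1M f -> chart_dom c p -> C1_at (f \o of_xy c) (xy c p).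
Proof. by move=> fC cp; exact: nbhs_singleton (fC c p cp). Qed.

Lemma C1_chart_at c f p : chart_dom c p ->
  (\forall v \near xy c p, C1_at (f \o of_xy c) v) -> C1_chart c f p.
Proof. by move=> cp h; exact: (xy_cvg cp h). Qed.

Lemma C1M_intro f :
  (forall p, exists c, chart_dom c p /\ C1_chart c f p) -> C1M f.
Proof.
move=> h c p cp; have [c' [c'p fc']] := h p; exact: C1_transition cp c'p fc'.
Qed.

(** The pairing <df, dh> for the metric g. The factors |t|^2 of [dpair_transition] and
    [conf_transition] cancel, so any chart may replace [chart_at]. *)
Definition dens f h p : R :=
  dpair (chart_at S p) f h p / conf g (chart_at S p) (xy (chart_at S p) p).

Lemma dens_chart f h c p : C1M f -> C1M h -> chart_dom c p ->
  dens f h p = dpair c f h p / conf g c (xy c p).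
Proof.
move=> fC hC cp; rewrite /dens; set c' := chart_at S p.
have c'p : chart_dom c' p by exact: rs_cover.
rewrite (dpair_transition c'p cp (C1M_at fC cp) (C1M_at hC cp)).
have := conf_transition g c'p cp; rewrite -/(transition c' c) -/(dtransition c' c p) => E.
have := conf_gt0 g (chart_img_xy c'p); rewrite E.
set t := complex.Re _ ^+ 2; move: (dpair c f h p) => d.
have := conf_gt0 g (chart_img_xy cp); move: (conf g c (xy c p)) => x x0.
rewrite pmulr_rgt0// => t0; move: t t0 => t t0; clear E.
by field; rewrite !gt_eqF.
Qed.

Lemma pd_cvg e c f p : C1M f -> chart_dom c p -> e = (1, 0) \/ e = (0, 1) ->
  pd e c f q @[q --> p] --> pd e c f p.
Proof.
move=> fC cp; have [_ c1 c2] := C1M_at fC cp; have cx := xy_cvg cp.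
by move=> [->|->]; [exact: (cvg_comp _ _ cx c1)|exact: (cvg_comp _ _ cx c2)].
Qed.

Lemma dens_cvg f h p : C1M f -> C1M h -> (dens f h q : R^o) @[q --> p] --> (dens f h p : R^o).
Proof.
move=> fC hC; set c := chart_at S p; have cp : chart_dom c p by exact: rs_cover.
have cf e : e = (1, 0) \/ e = (0, 1) -> (hsip (pd e c f q) (pd e c h q) : R^o) @[q --> p]
    --> (hsip (pd e c f p) (pd e c h p) : R^o).
  move=> he; exact: (bilin_cvg (hsip_bilinear ip) (pd_cvg fC cp he) (pd_cvg hC cp he)).
have cv := smooth_on_continuous (conf_smooth g c) (chart_img_xy cp).
have cc : (conf g c (xy c q) : R^o) @[q --> p] --> (conf g c (xy c p) : R^o).
  exact: (cvg_comp _ _ (xy_cvg cp) cv).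
have c0 : conf g c (xy c p) != 0 by rewrite gt_eqF// conf_gt0//; exact: chart_img_xy.
pose proof (cvgM (cvgD (cf _ (or_introl erefl)) (cf _ (or_intror erefl))) (cvgV c0 cc)) as L.
have n1 : \forall q \near p, dpair c f h q / conf g c (xy c q) = dens f h q.
  by apply: filterS (near_chart cp) => q cq; rewrite (dens_chart fC hC cq).
rewrite -(nbhs_singleton n1); exact: (cvg_near (W := R^o) n1 L).
Qed.

Lemma dens_eq0 f h p : (\forall q \near p, h q = 0) -> dens f h p = 0.
Proof.
move=> h0; rewrite /dens; set c := chart_at S p.
have cp : chart_dom c p by exact: rs_cover.
have E e : pd e c h p = 0.
  have := near_of_xy cp h0 => h0'.
  apply: (@derive_val _ _ _ _ _ _ _ (is_derive_near _ (is_derive_cst (0 : hs ip) (xy c p) e))).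
  by apply: filterS h0' => u h0u; rewrite /= h0u.
have h00 (T : hs ip) : hsip T 0 = 0 by rewrite -(scale0r T) hsipZr mul0r.
by rewrite /dpair !E !h00 addr0 mul0r.
Qed.

Lemma densB f h k p : C1M h -> C1M k ->
  dens f (fun q => h q - k q) p = dens f h p - dens f k p.
Proof.
move=> hC kC; rewrite /dens; set c := chart_at S p.
have cp : chart_dom c p by exact: rs_cover.
have [h1 h2] := C1_at_derive (C1M_at hC cp); have [k1 k2] := C1_at_derive (C1M_at kC cp).
rewrite -mulrBl /dpair; congr (_ / _).
have E1 : pd (1, 0) c (fun q => h q - k q) p = pd (1, 0) c h p - pd (1, 0) c k p.
  exact: (@derive_val _ _ _ _ _ _ _ (is_deriveB h1 k1)).
have E2 : pd (0, 1) c (fun q => h q - k q) p = pd (0, 1) c h p - pd (0, 1) c k p.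
  exact: (@derive_val _ _ _ _ _ _ _ (is_deriveB h2 k2)).
rewrite E1 E2; clear.
move: (pd _ _ f p) (pd _ _ f p) (pd _ _ h p) (pd _ _ h p) (pd _ _ k p) (pd _ _ k p).
by move=> f1 f2 h1 h2 k1 k2; rewrite !hsipDr !hsipNr opprD addrACA.
Qed.

Lemma C1M_sub h k : C1M h -> C1M k -> C1M (fun q => h q - k q).
Proof.
move=> hC kC c p cp; apply: filterS (filterI (hC c p cp) (kC c p cp)) => q [h1 k1].
exact: (C1_at_sub h1 k1).
Qed.

End Density.


(** * Bump functions of class C^1 *)

Section Bump.
Context {R : realType}.

(** The positive part; its square is C^1, with the continuous derivative 2 [pos]. *)
Definition pos (x : R) : R := (x + `|x|) / 2.
Definition sqpos (x : R) : R := pos x ^+ 2.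

Lemma pos_ge0 x : 0 <= x -> pos x = x.
Proof. by move=> x0; rewrite /pos ger0_norm//; field. Qed.

Lemma pos_le0 x : x <= 0 -> pos x = 0.
Proof. by move=> x0; rewrite /pos ler0_norm// subrr mul0r. Qed.

Lemma pos_cvg T (F : set_system T) {FF : Filter F} (f : T -> R) (l : R) :
  (f x : R^o) @[x --> F] --> (l : R^o) -> (pos (f x) : R^o) @[x --> F] --> (pos l : R^o).
Proof. by move=> fl; exact: (cvgM (cvgD fl (cvg_norm fl)) (cvg_cst _)). Qed.

Lemma sqpos_cvg T (F : set_system T) {FF : Filter F} (f : T -> R) (l : R) :
  (f x : R^o) @[x --> F] --> (l : R^o) -> (sqpos (f x) : R^o) @[x --> F] --> (sqpos l : R^o).
Proof.
move=> fl; rewrite /sqpos expr2; under eq_fun do rewrite expr2.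
exact: (cvgM (pos_cvg fl) (pos_cvg fl)).
Qed.

(** A quadratic bound on the remainder, uniform in x, covers the kink of [pos] at 0 together with
    the other points. *)
Lemma sqpos_taylor x h : `|sqpos (h + x) - sqpos x - 2 * pos x * h| <= h ^+ 2.
Proof.
rewrite /sqpos ler_norml.
have [x0|x0] := leP 0 x; have [y0|y0] := leP 0 (h + x).
- by rewrite !pos_ge0//; apply/andP; split; nra.
- by rewrite (pos_ge0 x0) (pos_le0 (ltW y0)); apply/andP; split; nra.
- by rewrite (pos_ge0 y0) (pos_le0 (ltW x0)); apply/andP; split; nra.
- by rewrite (pos_le0 (ltW y0)) (pos_le0 (ltW x0)); apply/andP; split; nra.
Qed.

Lemma is_derive_sqpos x : is_derive x (1 : R) (sqpos : R -> R^o) (2 * pos x).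
Proof.
apply/is_deriveP; apply/cvgrPdist_lt => e e0; near=> h.
have h0 : h != 0 by near: h; exact: nbhs_dnbhs_neq.
have he : `|h| < e.
  near: h; apply: nbhs_dnbhs; apply/nbhs_normP; exists e => //= y /=.
  by rewrite sub0r normrN.
apply: le_lt_trans he; rewrite (_ : h *: 1 = h); last exact: mulr1.
have nh : 0 < `|h| by rewrite normr_gt0.
have -> : 2 * pos x - h^-1 *: (sqpos (h + x) - sqpos x) =
    - (h^-1 * (sqpos (h + x) - sqpos x - 2 * pos x * h)).
  by rewrite /GRing.scale /=; field.
rewrite normrN normrM normfV mulrC ler_pdivrMr// -normrM -expr2 normrX real_normK ?num_real//.
exact: sqpos_taylor.
Unshelve. all: by end_near. Qed.

Lemma is_derive_sqpos_comp (V : normedModType R) (F : V -> R) (v e : V) (d : R) :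
  is_derive v e (F : V -> R^o) d ->
  is_derive v e (fun u => sqpos (F u) : R^o) (2 * pos (F v) * d).
Proof.
move=> /is_derive_line0 Fd; apply/is_derive_line0.
have h := is_derive_sqpos (F (0 *: e + v)).
have := @is_derive1_comp R sqpos (fun s : R => F (s *: e + v)) 0 _ _ h Fd.
by rewrite scale0r add0r.
Qed.

Variables (a b rho : R) (rho0 : 0 < rho).

Let A (v : R * R) := 4 * rho ^+ 2 - (v.1 - a) ^+ 2.
Let B (v : R * R) := 4 * rho ^+ 2 - (v.2 - b) ^+ 2.
(* On the inner square A and B are at least 3 rho^2, so that A^2 B^2 >= 81 rho^8. *)
Let K := (81 * rho ^+ 8)^-1.

(** The function s |-> 1 - ((1 - s)_+)^2 is C^1, vanishes at 0 and is 1 for s >= 1. Here s = K A_+^2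
    B_+^2 is 0 outside the square of half-side 2 rho and at least 1 on the square of half-side
    rho. *)
Definition bump (v : R * R) : R := 1 - sqpos (1 - K * (sqpos (A v) * sqpos (B v))).
Definition dbump (e v : R * R) : R :=
  2 * pos (1 - K * (sqpos (A v) * sqpos (B v))) * (K *
    (2 * pos (A v) * (- (2 * (v.1 - a) * e.1)) * sqpos (B v) +
     sqpos (A v) * (2 * pos (B v) * (- (2 * (v.2 - b) * e.2))))).

Lemma bump1 v : `|v.1 - a| <= rho -> `|v.2 - b| <= rho -> bump v = 1.
Proof.
move=> h1 h2.
have sq x : `|x| <= rho -> x ^+ 2 <= rho ^+ 2.
  by move=> xr; rewrite -[x ^+ 2]real_normK ?num_real// lerXn2r// ?nnegrE// ltW.
have r2 : 0 < rho ^+ 2 by rewrite exprn_gt0.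
have big x : 3 * rho ^+ 2 <= x -> 9 * rho ^+ 4 <= sqpos x.
  move=> hx; have x0 : 0 <= x by apply: le_trans hx; rewrite mulr_ge0// ltW.
  rewrite /sqpos pos_ge0// (_ : 9 * rho ^+ 4 = (3 * rho ^+ 2) ^+ 2); last by ring.
  by rewrite lerXn2r// nnegrE// mulr_ge0// ltW.
have hA : 9 * rho ^+ 4 <= sqpos (A v) by apply: big; have := sq _ h1; rewrite /A => ?; lra.
have hB : 9 * rho ^+ 4 <= sqpos (B v) by apply: big; have := sq _ h2; rewrite /B => ?; lra.
rewrite /bump [sqpos (1 - _)]/sqpos pos_le0 ?expr0n ?subr0//.
rewrite subr_le0 /K mulrC ler_pdivlMr ?mulr_gt0 ?exprn_gt0// mul1r.
rewrite (_ : 81 * rho ^+ 8 = (9 * rho ^+ 4) * (9 * rho ^+ 4)); last by ring.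
by apply: ler_pM => //; rewrite mulr_ge0// exprn_ge0// ltW.
Qed.

Lemma bump0 v : 2 * rho <= `|v.1 - a| \/ 2 * rho <= `|v.2 - b| -> bump v = 0.
Proof.
have sq x : 2 * rho <= `|x| -> 4 * rho ^+ 2 - x ^+ 2 <= 0.
  move=> xr; rewrite subr_le0 -[x ^+ 2]real_normK ?num_real//.
  rewrite (_ : 4 * rho ^+ 2 = (2 * rho) ^+ 2); last by ring.
  by rewrite lerXn2r// nnegrE// mulr_ge0// ltW.
have z (x : R) : x <= 0 -> sqpos x = 0 by move=> x0; rewrite /sqpos pos_le0// expr0n.
rewrite /bump => -[/sq/z h|/sq/z h].
  by rewrite {1}/A h mul0r mulr0 subr0 /sqpos pos_ge0// expr1n subrr.
by rewrite {1}/B h !mulr0 subr0 /sqpos pos_ge0// expr1n subrr.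
Qed.

Lemma is_derive_fst (v e : R * R) : is_derive v e (fst : R * R -> R^o) e.1.
Proof.
apply/is_deriveP; refine (cvg_near _ (@cvg_cst _ (e.1 : R^o) _ (0 : R)^' _)); near=> h.
have h0 : h != 0 by near: h; exact: nbhs_dnbhs_neq.
by rewrite /= addrK; exact/esym/mulKf.
Unshelve. all: by end_near. Qed.

Lemma is_derive_snd (v e : R * R) : is_derive v e (snd : R * R -> R^o) e.2.
Proof.
apply/is_deriveP; refine (cvg_near _ (@cvg_cst _ (e.2 : R^o) _ (0 : R)^' _)); near=> h.
have h0 : h != 0 by near: h; exact: nbhs_dnbhs_neq.
by rewrite /= addrK; exact/esym/mulKf.
Unshelve. all: by end_near. Qed.

Lemma mul_bilinear : bounded_bilinear (fun x y : R^o => x * y : R^o).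
Proof.
split=> *; rewrite ?mulrDl ?mulrDr//; [exact/esym/mulrA|exact: mulrCA|].
by exists 1 => x y; rewrite mul1r normrM.
Qed.

Lemma bump_derive v e : is_derive v e (bump : R * R -> R^o) (dbump e v).
Proof.
have quad (p : R * R -> R) (c d : R) : is_derive v e (p : R * R -> R^o) d ->
    is_derive v e (fun u => 4 * rho ^+ 2 - (p u - c) ^+ 2 : R^o) (- (2 * (p v - c) * d)).
  move=> hp; have h := is_deriveB hp (is_derive_cst (c : R^o) v e).
  have h2 := is_deriveB (is_derive_cst (4 * rho ^+ 2 : R^o) v e)
    (is_derive_bilinear mul_bilinear h h).
  apply: (is_derive_eq h2); rewrite subr0 sub0r !addrfctE /=.
  by congr (- _); rewrite (mulrC d) -mulr2n -mulrA mulr_natl.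
have dA := is_derive_sqpos_comp (quad fst a _ (is_derive_fst v e)).
have dB := is_derive_sqpos_comp (quad snd b _ (is_derive_snd v e)).
have dAB := is_derive_bilinear mul_bilinear dA dB.
have dK := is_deriveB (is_derive_cst (1 : R^o) v e)
  (is_derive_bilinear mul_bilinear (is_derive_cst (K : R^o) v e) dAB).
have d1 := is_deriveB (is_derive_cst (1 : R^o) v e) (is_derive_sqpos_comp dK).
apply: (is_derive_eq d1); rewrite /dbump -/(A v) -/(B v) mul0r add0r !sub0r mulrN opprK.
by rewrite add0r.
Qed.

Lemma bump_cvg v : (bump u : R^o) @[u --> v] --> (bump v : R^o).
Proof.
have f1 : (u.1 : R^o) @[u --> v] --> (v.1 : R^o) by exact: cvg_fst.
have f2 : (u.2 : R^o) @[u --> v] --> (v.2 : R^o) by exact: cvg_snd.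
have quad (f : R * R -> R) (c l : R) : (f u : R^o) @[u --> v] --> (l : R^o) ->
    (sqpos (4 * rho ^+ 2 - (f u - c) ^+ 2) : R^o) @[u --> v] -->
      (sqpos (4 * rho ^+ 2 - (l - c) ^+ 2) : R^o).
  move=> fl; apply: sqpos_cvg; rewrite expr2; under eq_fun do rewrite (expr2 (_ - c)).
  have fc := cvgB fl (cvg_cst (c : R^o)).
  exact: (cvgB (cvg_cst (4 * rho ^+ 2 : R^o)) (cvgM (fc _ _) (fc _ _))).
apply: (cvgB (cvg_cst (1 : R^o))); apply: sqpos_cvg; apply: (cvgB (cvg_cst (1 : R^o))).
exact: (cvgM (cvg_cst (K : R^o)) (cvgM (quad _ a _ f1) (quad _ b _ f2))).
Qed.

Lemma dbump_cvg e v : (dbump e u : R^o) @[u --> v] --> (dbump e v : R^o).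
Proof.
have f1 : (u.1 : R^o) @[u --> v] --> (v.1 : R^o) by exact: cvg_fst.
have f2 : (u.2 : R^o) @[u --> v] --> (v.2 : R^o) by exact: cvg_snd.
have quad (f : R * R -> R) (c l : R) : (f u : R^o) @[u --> v] --> (l : R^o) ->
    (4 * rho ^+ 2 - (f u - c) ^+ 2 : R^o) @[u --> v] --> (4 * rho ^+ 2 - (l - c) ^+ 2 : R^o).
  move=> fl; rewrite expr2; under eq_fun do rewrite (expr2 (_ - c)).
  have fc := cvgB fl (cvg_cst (c : R^o)).
  exact: (cvgB (cvg_cst (4 * rho ^+ 2 : R^o)) (cvgM (fc _ _) (fc _ _))).
have cA := quad _ a _ f1; have cB := quad _ b _ f2.
have mA := sqpos_cvg cA; have mB := sqpos_cvg cB; have pA := pos_cvg cA; have pB := pos_cvg cB.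
have lin (f : R * R -> R) (c l d : R) : (f u : R^o) @[u --> v] --> (l : R^o) ->
    (- (2 * (f u - c) * d) : R^o) @[u --> v] --> (- (2 * (l - c) * d) : R^o).
  move=> fl; exact: (cvgN (cvgM (cvgM (cvg_cst (2 : R^o)) (cvgB fl (cvg_cst (c : R^o)))) (cvg_cst (d : R^o)))).
have cK : (pos (1 - K * (sqpos (A u) * sqpos (B u))) : R^o) @[u --> v] -->
    (pos (1 - K * (sqpos (A v) * sqpos (B v))) : R^o).
  by apply: pos_cvg; exact: (cvgB (cvg_cst (1 : R^o)) (cvgM (cvg_cst (K : R^o)) (cvgM (mA _) (mB _)))).
have c2 := cvg_cst (2 : R^o).
apply: (cvgM (cvgM (c2 _ _ _) cK) (cvgM (cvg_cst (K : R^o)) _)).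
apply: cvgD.
  exact: (cvgM (cvgM (cvgM (c2 _ _ _) (pA _)) (lin _ _ _ _ f1)) (mB _)).
exact: (cvgM (mA _) (cvgM (cvgM (c2 _ _ _) (pB _)) (lin _ _ _ _ f2))).
Qed.

End Bump.


Section BumpSurface.
Context {R : realType} {M : ptopologicalType}.
Variable S : riemann_surface R M.
Context {H : lmodType R[i]}.
Variable ip : {dot H for Num.conj}.
Variables (c : chart S) (a b rho : R).
Hypothesis rho0 : 0 < rho.

Definition box (r : R) : set (R * R) := `[a - r, a + r] `*` `[b - r, b + r].

Hypothesis box_sub : box (2 * rho) `<=` chart_img c.

Definition box_surface : set M := of_xy c @` box (2 * rho).

Definition bump_surface (p : M) : R :=
  if `[< chart_dom c p >] then bump a b rho (xy c p) else 0.

Lemma box_compact r : compact (box r).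
Proof. by apply: compact_setX; exact: segment_compact. Qed.

Lemma boxP r v : box r v <-> `|v.1 - a| <= r /\ `|v.2 - b| <= r.
Proof.
rewrite /box /= !in_itv /= !ler_norml.
by split=> -[/andP[? ?] /andP[? ?]]; split; apply/andP; split; lra.
Qed.

(** Compact sets are closed in the Hausdorff space M; this is what keeps the bump C^1 when it is
    extended by 0 outside the chart. *)
Lemma box_surface_closed : closed box_surface.
Proof.
apply: compact_closed; first exact: (rs_hausdorff S).
rewrite /box_surface; apply: continuous_compact; last exact: box_compact.
apply: continuous_in_subspaceT => v; rewrite inE => /box_sub cv.
exact: of_xy_cvg.
Qed.

Lemma box_surfaceE : box_surface = chart_dom c `&` xy c @^-1` box (2 * rho).
Proof.
apply/seteqP; split=> [_ [v bv <-]|p [cp bp]].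
  by have [? e] := chart_imgP (box_sub bv); split; rewrite //= e.
by exists (xy c p) => //; exact: of_xyK.
Qed.

Lemma bump_surface_out p : ~ box_surface p -> bump_surface p = 0.
Proof.
rewrite box_surfaceE /bump_surface; case: asboolP => // cp nb.
apply: bump0 => //.
have [h1|h1] := leP (2 * rho) `|(xy c p).1 - a|; first by left.
have [h2|h2] := leP (2 * rho) `|(xy c p).2 - b|; first by right.
by exfalso; apply: nb; split=> //; apply/boxP; split; exact: ltW.
Qed.

Lemma bump_surface_in p : chart_dom c p -> box rho (xy c p) -> bump_surface p = 1.
Proof.
move=> cp /boxP[h1 h2]; rewrite /bump_surface; case: asboolP => // _.
exact: bump1.
Qed.

Lemma near_out p : ~ box_surface p -> \forall q \near p, ~ box_surface q.
Proof.
move=> np; have := box_surface_closed; rewrite -openC => oC.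
exact: (open_nbhs_nbhs (conj oC np)).
Qed.

Lemma C1M_bump (f : M -> hs ip) : C1M S f -> C1M S (fun p => bump_surface p *: f p).
Proof.
move=> fC; apply: C1M_intro => p.
have [cp|ncp] := pselect (chart_dom c p).
  exists c; split=> //; have n2 := near_join (near_chart cp); have n1 := fC c p cp.
  rewrite /C1_chart; near=> q.
  have cq : chart_dom c q by near: q; exact: near_chart.
  have fq : C1_at (f \o of_xy c) (xy c q) by near: q.
  have E : \forall u \near xy c q, bump a b rho u *: (f \o of_xy c) u =
      ((fun p => bump_surface p *: f p) \o of_xy c) u.
    apply: filterS (near_chart_img (chart_img_xy cq)) => u /chart_imgP[du ue].
    by rewrite /= /bump_surface asboolT// ue.
  apply: (C1_at_ext E); apply: (C1_at_scale _ _ _ _ fq).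
  - move=> y; exact: (conj (bump_derive a b rho y (1, 0)) (bump_derive a b rho y (0, 1))).
  - exact: bump_cvg.
  - exact: dbump_cvg.
  - exact: dbump_cvg.
(* At a point outside the chart domain, the complement of the closed square is a neighbourhood on
   which the field is 0. *)
have np : ~ box_surface p by rewrite box_surfaceE => -[].
exists (chart_at S p); split; first exact: rs_cover.
set c' := chart_at S p; have cp : chart_dom c' p by exact: rs_cover.
have nO := near_join (near_out np).
rewrite /C1_chart; near=> q.
have cq : chart_dom c' q by near: q; exact: near_chart.
have nq : \forall r \near q, ~ box_surface r by near: q.
have E : \forall u \near xy c' q, (0 : hs ip) =
    ((fun p => bump_surface p *: f p) \o of_xy c') u.
  apply: filterS (near_of_xy cq nq) => u nu.
  by rewrite /= bump_surface_out// scale0r.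
exact: (C1_at_ext E (C1_at_cst _ _)).
Unshelve. all: by end_near. Qed.

End BumpSurface.


(** * Integration on charts *)

Section MeasurableContinuous.
Context {R : realType}.

Lemma measurable_fun_open d (X : measurableType d) (D : set X) (F : X -> R) :
  measurable D ->
  (forall V : set R, open V -> exists2 U, measurable U & D `&` F @^-1` V = D `&` U) ->
  measurable_fun D F.
Proof.
move=> mD h; apply: (measurability _ (RGenOpens.measurableE R)).
move=> _ [_ [a [b ->] <-]].
have [U mU ->] := h _ (@interval_open R (BRight a) (BLeft b) isT isT).
exact: measurableI.
Qed.

Notation R2 := (measurableTypeR R * measurableTypeR R)%type.

(** An open set is a countable union of rational squares, so the product sigma-algebra contains
    it. *)
Lemma open_measurable_prod (U : set (R * R)) : open U -> measurable (U : set R2).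
Proof.
move=> oU.
pose bx (q : rat * rat * rat) : set R2 :=
  `]ratr q.1.1 - ratr q.2, ratr q.1.1 + ratr q.2[ `*`
  `]ratr q.1.2 - ratr q.2, ratr q.1.2 + ratr q.2[.
pose F q := if `[< bx q `<=` U >] then bx q else set0.
have -> : U = \bigcup_q F q.
  apply/seteqP; split=> [v Uv|v [q _]]; last first.
    by rewrite /F; case: asboolP => // sub /sub.
  have /nbhs_normP[e /= e0 he] := open_nbhs_nbhs (conj oU Uv).
  (* The half-side is chosen between e/4 and e/2 and the centre within e/4 of v: the square then
     contains v and stays in the ball of radius e. *)
  have e4 : 0 < e / 4 by rewrite divr_gt0.
  have e42 : e / 4 < e / 2 by rewrite ltr_pM2l// ltf_pV2 ?posrE// ltr_nat.
  have [r] := @rat_in_itvoo R (e / 4) (e / 2) e42; rewrite in_itv /= => /andP[r1 r2].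
  have [x] := @rat_in_itvoo R (v.1 - e / 4) (v.1 + e / 4) (ltac:(lra)).
  rewrite in_itv /= => /andP[x1 x2].
  have [y] := @rat_in_itvoo R (v.2 - e / 4) (v.2 + e / 4) (ltac:(lra)).
  rewrite in_itv /= => /andP[y1 y2].
  exists ((x, y), r) => //; rewrite /F asboolT.
    by rewrite /bx /=; split; rewrite /= in_itv /=; apply/andP; split; lra.
  move=> w [/=]; rewrite !in_itv /= => /andP[w1 w2] /andP[w3 w4]; apply: he => /=.
  by rewrite prod_normE /= gt_max !ltr_norml; apply/andP; split; apply/andP; split; lra.
apply: countable_bigcupT_measurable => // q; rewrite /F; case: asboolP => // _.
by apply: measurableX; exact: measurable_itv.
Qed.

Lemma continuous_measurable_prod (D : set R2) (F : R * R -> R) :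
  measurable D -> (forall v, D v -> (F u : R^o) @[u --> (v : R * R)] --> (F v : R^o)) ->
  measurable_fun D (F : R2 -> R).
Proof.
move=> mD cF; apply: measurable_fun_open => // V oV.
(* F is continuous only at the points of D, so the preimage need not be open; its interior has the
   same trace on D. *)
exists ((F @^-1` V : set (R * R))°).
  by apply: open_measurable_prod; exact: open_interior.
apply/seteqP; split=> v [Dv h]; split=> //; last exact: (interior_subset h).
by apply: (cF v Dv); exact: (open_nbhs_nbhs (conj oV h)).
Qed.

Lemma continuous_measurable_borel (M : ptopologicalType) (D : set M) (F : M -> R) :
  measurable (D : set (g_sigma_algebraType (@open M))) ->
  (forall p, D p -> (F q : R^o) @[q --> p] --> (F p : R^o)) ->
  measurable_fun (D : set (g_sigma_algebraType (@open M))) (F : g_sigma_algebraType (@open M) -> R).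
Proof.
move=> mD cF; apply: measurable_fun_open => // V oV.
exists ((F @^-1` V : set M)°).
  by apply: sub_sigma_algebra; exact: open_interior.
apply/seteqP; split=> v [Dv h]; split=> //; last exact: (interior_subset h).
by apply: (cF v Dv); exact: (open_nbhs_nbhs (conj oV h)).
Qed.

End MeasurableContinuous.

Section ChangeOfVariables.
Local Open Scope ereal_scope.
Context d1 d2 (X : measurableType d1) (Y : measurableType d2) (R : realType).
Variables (mu : {measure set X -> \bar R}) (nu : {measure set Y -> \bar R}).
Variables (phi : X -> Y) (DX : set X) (D : set Y) (w : Y -> R).
Hypotheses (mDX : measurable DX) (mD : measurable D).
Hypotheses (mphi : measurable_fun DX phi) (phiD : forall x, DX x -> D (phi x)).
Hypotheses (mw : measurable_fun D w) (w0 : forall y, D y -> (0 <= w y)%R).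
Hypothesis density : forall B, measurable B -> B `<=` D ->
  mu (DX `&` phi @^-1` B) = \int[nu]_(y in B) (w y)%:E.

Import HBNNSimple.

(** The density hypothesis concerns sets; it passes to functions by approximation with simple
    functions and monotone convergence on both sides. *)
Lemma ge0_integral_density (f : Y -> \bar R) :
  measurable_fun D f -> (forall y, D y -> 0 <= f y) ->
  \int[mu]_(x in DX) f (phi x) = \int[nu]_(y in D) (f y * (w y)%:E).
Proof.
move=> mf f0.
pose f_ := nnsfun_approx mD mf.
have mfphi n : measurable_fun DX (fun x => (f_ n (phi x))%:E).
  apply/measurable_EFinP; apply: measurableT_comp => //.
transitivity (limn (fun n => \int[mu]_(x in DX) (f_ n (phi x))%:E)).
  rewrite -monotone_convergence//.
  - apply: eq_integral => x /[!inE] xD; apply/esym/cvg_lim => //.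
    by apply: cvg_nnsfun_approx => //; exact: phiD.
  - by move=> n x _; rewrite lee_fin.
  - by move=> x _ m n mn; rewrite lee_fin; exact/lefP/nd_nnsfun_approx.
have mwE : measurable_fun D (fun y => (w y)%:E) by exact/measurable_EFinP.
rewrite [X in limn X](_ : _ = (fun n => \int[nu]_(y in D) ((f_ n y)%:E * (w y)%:E))).
  rewrite -monotone_convergence//; last 3 first.
    - move=> n; apply: emeasurable_funM => //.
      by apply/measurable_EFinP; apply: measurable_funTS; exact: measurable_funP.
    - by move=> n y Dy; rewrite mule_ge0 ?lee_fin//; exact: w0.
    - move=> y Dy m n mn; apply: lee_wpmul2r; first by rewrite lee_fin; exact: w0.
      by rewrite lee_fin; exact/lefP/nd_nnsfun_approx.
  apply: eq_integral => y /[!inE] yD; apply/cvg_lim => //.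
  apply: cvgeZr => //.
  by apply: cvg_nnsfun_approx.
apply/funext => n; pose A k := f_ n @^-1` [set k].
have mA k : measurable (A k) by exact: measurable_funPTI.
have mAX k : measurable (DX `&` phi @^-1` A k) by exact: mphi.
have m1X k : measurable_fun DX (fun x => (\1_(A k) (phi x) : R)%:E).
  by apply/measurable_EFinP; apply: measurableT_comp => //; exact: measurable_indic.
have m1Y k : measurable_fun D (fun y => (\1_(A k) y : R)%:E).
  by apply/measurable_EFinP; apply: measurable_funTS; exact: measurable_indic.
have k0 k y : 0 <= k%:E * (\1_(A k) y : R)%:E by exact: nnfun_muleindic_ge0.
transitivity (\sum_(k \in range (f_ n)) \int[mu]_(x in DX) (k%:E * (\1_(A k) (phi x))%:E)).
  rewrite -ge0_integral_fsum//.
  - by apply: eq_integral => x _; rewrite fimfunE -fsumEFin//; under eq_fsbigr do rewrite EFinM.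
  - by move=> k; apply: measurable_funeM.
transitivity (\sum_(k \in range (f_ n))
    \int[nu]_(y in D) (k%:E * (\1_(A k) y)%:E * (w y)%:E)); last first.
  rewrite -ge0_integral_fsum//.
  - apply: eq_integral => y _; rewrite fimfunE -fsumEFin//; under [in RHS]eq_fsbigr do rewrite EFinM.
    by rewrite ge0_mule_fsuml// => k; exact: k0.
  - by move=> k; apply: emeasurable_funM => //; apply: measurable_funeM.
  - by move=> k y Dy; rewrite mule_ge0// lee_fin; exact: w0.
apply: eq_fsbigr => k /[!inE] -[t _ kt].
have {}kt : (0 <= k)%R by rewrite -kt.
rewrite ge0_integralZl//.
have -> : \int[mu]_(x in DX) (\1_(A k) (phi x))%:E = mu (DX `&` phi @^-1` A k).
  transitivity (\int[mu]_(x in DX) (\1_(DX `&` phi @^-1` A k) x)%:E).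
    apply: eq_integral => x DXx; rewrite !indicE; congr ((nat_of_bool _)%:R%:E).
    by rewrite in_setI DXx.
  by rewrite integral_indic// setIAC setIid.
under [RHS]eq_integral do rewrite -muleA.
rewrite ge0_integralZl//; last 2 first.
- by apply: emeasurable_funM.
- by move=> y Dy; rewrite mule_ge0 ?lee_fin//; exact: w0.
congr (_ * _).
have -> : DX `&` phi @^-1` A k = DX `&` phi @^-1` (D `&` A k).
  apply/seteqP; split=> [x [DXx Ax]|x [DXx [_ Ax]]]; split=> //.
  by split=> //; exact: phiD.
rewrite density//; last by apply: measurableI.
rewrite integral_mkcondr; apply: eq_integral => y _; rewrite patchE indicE.
by case: ifPn => yA; rewrite ?mul1e ?mul0e.
Qed.

Lemma integral_density (f : Y -> R) : measurable_fun D f ->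
  \int[mu]_(x in DX) (f (phi x))%:E = \int[nu]_(y in D) (f y * w y)%:E.
Proof.
move=> mf; have mfE : measurable_fun D (EFin \o f) by exact/measurable_EFinP.
rewrite integralE [RHS]integralE; congr (_ - _).
  transitivity (\int[mu]_(x in DX) ((EFin \o f)^\+ (phi x))).
    by apply: eq_integral => x _; rewrite !funeposE.
  rewrite ge0_integral_density//; last exact: measurable_funepos.
  apply: eq_integral => y /[!inE] Dy; rewrite !funeposE EFinM.
  by rewrite maxe_pMl ?mul0e// lee_fin w0.
transitivity (\int[mu]_(x in DX) ((EFin \o f)^\- (phi x))).
  by apply: eq_integral => x _; rewrite !funenegE.
rewrite ge0_integral_density//; last exact: measurable_funeneg.
apply: eq_integral => y /[!inE] Dy; rewrite !funenegE EFinM -mulNe.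
by rewrite maxe_pMl ?mul0e// lee_fin w0.
Qed.

End ChangeOfVariables.


(** * Integrals of derivatives over squares *)

Section Divergence.
Context {R : realType}.
Notation leb := (@lebesgue_measure R).
Notation R2 := (measurableTypeR R * measurableTypeR R)%type.

Lemma bounded_on_compact (X : topologicalType) (K : set X) (F : X -> R) :
  compact K -> (forall p, K p -> (F q : R^o) @[q --> p] --> (F p : R^o)) ->
  [bounded F p | p in K].
Proof.
move=> cK cF.
have FK : compact (F @` K : set R^o).
  apply: continuous_compact => //; apply: continuous_in_subspaceT => p /[!inE] Kp.
  exact: cF.
have [B [Br hB]] := compact_bounded FK.
by exists B; split=> // x Bx p Kp; apply: hB => //; exists p.
Qed.

Lemma integral_segment_derive (F f : R -> R) (a b : R) : a < b ->
  (forall x, a <= x <= b -> is_derive x 1 (F : R -> R^o) (f x)) ->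
  (forall x, a <= x <= b -> (f y : R^o) @[y --> x] --> (f x : R^o)) ->
  (\int[leb]_(x in `[a, b]) (f x)%:E = (F b - F a)%:E)%E.
Proof.
move=> ab dF cf; rewrite EFinB.
have Fc x : a <= x <= b -> (F y : R^o) @[y --> x] --> (F x : R^o).
  move=> /dF [dx _].
  have : differentiable (F : R^o -> R^o) x by apply/derivable1_diffP.
  exact: differentiable_continuous.
apply: continuous_FTC2 => //.
- apply: continuous_in_subspaceT => x /[!inE]; rewrite /= in_itv /= => xab.
  exact: cf.
- split; last first.
  + by apply: cvg_at_left_filter; apply: Fc; rewrite ltW//= lexx.
  + by apply: cvg_at_right_filter; apply: Fc; rewrite lexx /= ltW.
  + by move=> x; rewrite in_itv /= => /andP[x1 x2]; have [] := dF x; rewrite ?ltW.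
- move=> x; rewrite in_itv /= => /andP[x1 x2]; rewrite derive1E.
  by have [] := dF x; rewrite ?ltW.
Qed.

Variables (a b r : R) (r0 : 0 < r).
Notation box := (box a b r).

Lemma box_measurable : measurable (box : set R2).
Proof. by apply: measurableX; exact: measurable_itv. Qed.

Lemma box_finite : ((leb \x leb) (box : set R2) < +oo)%E.
Proof.
rewrite product_measure1E; try exact: measurable_itv.
rewrite /=.
by rewrite !lebesgue_measure_itv /=; case: ifP => _; case: ifP => _;
  rewrite ?mule0 ?mul0e ?ltry// -?EFinB -?EFinM ltry.
Qed.

Lemma box_integrable (F : R * R -> R) :
  (forall v, box v -> (F u : R^o) @[u --> v] --> (F v : R^o)) ->
  (leb \x leb)%E.-integrable (box : set R2) (EFin \o F).
Proof.
move=> cF; apply: measurable_bounded_integrable.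
- exact: box_measurable.
- exact: box_finite.
- by apply: continuous_measurable_prod; [exact: box_measurable|exact: cF].
- by apply: (bounded_on_compact _ cF); exact: box_compact.
Qed.

(** Fubini with the x-integral inside, then the fundamental theorem of calculus: F vanishes on the
    two vertical sides. *)
Lemma box_integral_dx (F D : R * R -> R) :
  (forall v, box v -> is_derive v ((1, 0) : R * R) (F : R * R -> R^o) (D v)) ->
  (forall v, box v -> (D u : R^o) @[u --> v] --> (D v : R^o)) ->
  (forall v, box v -> `|v.1 - a| = r -> F v = 0) ->
  (\int[leb \x leb]_(v in (box : set R2)) (D v)%:E = 0)%E.
Proof.
move=> dF cD F0.
have nr : `|r| = r by rewrite ger0_norm ?ltW.
have ab : a - r < a + r by move: r0; lra.
rewrite integral_mkcond -integral21_prod_meas1; last first.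
  by rewrite -integrable_mkcond; [exact: box_integrable|exact: box_measurable].
apply: integral0_eq => y _; rewrite /fubini_G.
have [yb|yb] := pselect (`[(b - r)%R, (b + r)%R]%classic y); last first.
  apply: integral0_eq => x _; rewrite patchE ifF//.
  by apply/negbTE; apply/negP; rewrite inE => -[_ /=] /yb.
transitivity (\int[leb]_(x in `[(a - r)%R, (a + r)%R]) (D (x, y))%:E)%E.
  rewrite [RHS]integral_mkcond; apply: eq_integral => x _; rewrite !patchE.
  congr (if _ then _ else _); apply/idP/idP; rewrite !inE.
    by case.
  by split.
have inb x : a - r <= x <= a + r -> box (x, y) by move=> xa; split; rewrite //= in_itv.
transitivity (F (a + r, y) - F (a - r, y))%:E; last first.
  rewrite !F0 ?subrr//=.
  - by apply: inb; rewrite lexx ltW.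
  - by rewrite addrAC subrr add0r normrN.
  - by apply: inb; rewrite lexx ltW.
  - by rewrite addrAC subrr add0r.
apply: (@integral_segment_derive (fun x => F (x, y)) (fun x => D (x, y))); first exact: ab.
- move=> x /inb xb.
  have /is_derive_line : is_derive (x *: ((1, 0) : R * R) + (0, y)) ((1, 0) : R * R)
      (F : R * R -> R^o) (D (x, y)).
    have -> : x *: ((1, 0) : R * R) + (0, y) = (x, y).
      by apply: pair_ext => /=; [rewrite addr0 -[LHS]/(x * 1) mulr1|rewrite -[x *: 0]/(x * 0) mulr0 add0r].
    exact: dF.
  apply: is_derive_near; near=> s; congr F.
  by apply: pair_ext => /=; [rewrite addr0 -[LHS]/(s * 1) mulr1|rewrite -[s *: 0]/(s * 0) mulr0 add0r].
- move=> x /inb xb; exact: (cvg_comp _ _ (cvg_pair cvg_id (cvg_cst y)) (cD _ xb)).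
Unshelve. all: by end_near. Qed.

Lemma box_integral_dy (F D : R * R -> R) :
  (forall v, box v -> is_derive v ((0, 1) : R * R) (F : R * R -> R^o) (D v)) ->
  (forall v, box v -> (D u : R^o) @[u --> v] --> (D v : R^o)) ->
  (forall v, box v -> `|v.2 - b| = r -> F v = 0) ->
  (\int[leb \x leb]_(v in (box : set R2)) (D v)%:E = 0)%E.
Proof.
move=> dF cD F0.
have nr : `|r| = r by rewrite ger0_norm ?ltW.
have bb : b - r < b + r by move: r0; lra.
rewrite integral_mkcond -integral12_prod_meas1; last first.
  by rewrite -integrable_mkcond; [exact: box_integrable|exact: box_measurable].
apply: integral0_eq => x _; rewrite /fubini_F.
have [xa|xa] := pselect (`[(a - r)%R, (a + r)%R]%classic x); last first.
  apply: integral0_eq => y _; rewrite patchE ifF//.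
  by apply/negbTE; apply/negP; rewrite inE => -[/= /xa].
transitivity (\int[leb]_(y in `[(b - r)%R, (b + r)%R]) (D (x, y))%:E)%E.
  rewrite [RHS]integral_mkcond; apply: eq_integral => y _; rewrite !patchE.
  congr (if _ then _ else _); apply/idP/idP; rewrite !inE.
    by case.
  by split.
have inb y : b - r <= y <= b + r -> box (x, y) by move=> yb; split; rewrite //= in_itv.
transitivity (F (x, b + r) - F (x, b - r))%:E; last first.
  rewrite !F0 ?subrr//=.
  - by apply: inb; rewrite lexx ltW.
  - by rewrite addrAC subrr add0r normrN.
  - by apply: inb; rewrite lexx ltW.
  - by rewrite addrAC subrr add0r.
apply: (@integral_segment_derive (fun y => F (x, y)) (fun y => D (x, y))); first exact: bb.
- move=> y /inb yb.
  have /is_derive_line : is_derive (y *: ((0, 1) : R * R) + (x, 0)) ((0, 1) : R * R)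
      (F : R * R -> R^o) (D (x, y)).
    have -> : y *: ((0, 1) : R * R) + (x, 0) = (x, y).
      by apply: pair_ext => /=; [rewrite -[y *: 0]/(y * 0) mulr0 add0r|rewrite addr0 -[LHS]/(y * 1) mulr1].
    exact: dF.
  apply: is_derive_near; near=> s; congr F.
  by apply: pair_ext => /=; [rewrite -[s *: 0]/(s * 0) mulr0 add0r|rewrite addr0 -[LHS]/(s * 1) mulr1].
- move=> y /inb yb; exact: (cvg_comp _ _ (cvg_pair (cvg_cst x) cvg_id) (cD _ yb)).
Unshelve. all: by end_near. Qed.

End Divergence.


Section ChartIntegral.
Context {R : realType} {M : ptopologicalType}.
Variable S : riemann_surface R M.
Variable g : conformal_metric S.
Context {H : lmodType R[i]}.
Variable ip : {dot H for Num.conj}.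
Notation R2 := (measurableTypeR R * measurableTypeR R)%type.
Notation borelM := (g_sigma_algebraType (@open M)).
Notation leb2 := (@lebesgue_measure R \x @lebesgue_measure R)%E.
Notation ex := ((1, 0) : R * R).
Notation ey := ((0, 1) : R * R).

Lemma borel_closed (K : set M) : closed K -> measurable (K : set borelM).
Proof.
rewrite -openC => oK; rewrite -(setCK K); apply: measurableC.
by apply: sub_sigma_algebra.
Qed.

Lemma xy_measurable (c : chart S) (D : set M) : measurable (D : set borelM) ->
  D `<=` chart_dom c ->
  measurable_fun (D : set borelM) (xy c : borelM -> R2).
Proof.
move=> mD sD.
have h (F : R * R -> R^o) : continuous F ->
    measurable_fun (D : set borelM) ((fun p => F (xy c p)) : borelM -> R).
  move=> cF; apply: continuous_measurable_borel => // p /sD cp.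
  exact: (cvg_comp _ _ (xy_cvg cp) (cF _)).
have h1 := h fst (fun v => cvg_fst); have h2 := h snd (fun v => cvg_snd).
pose G : set (set R2) :=
  preimage_set_system setT fst measurable `|` preimage_set_system setT snd measurable.
have mG : @measurable _ R2 = <<s G >> by [].
apply: (measurability G mG) => _ [_ [[B mB <-]|[B mB <-]] <-].
  by rewrite setTI -comp_preimage; exact: h1.
by rewrite setTI -comp_preimage; exact: h2.
Qed.

Variables (c : chart S) (a b rho : R) (rho0 : 0 < rho).
Hypothesis box_sub : box a b (2 * rho) `<=` chart_img c.
Notation Bx := (box a b (2 * rho)).
Notation BS := (box_surface c a b rho).

Lemma box_surface_measurable : measurable (BS : set borelM).
Proof. by apply: borel_closed; exact: box_surface_closed. Qed.

(** [area_chart] speaks of the area of sets; [integral_density] extends it to integrals of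
    functions. *)
Lemma box_surface_integral (F : M -> R) :
  (forall p, (F q : R^o) @[q --> p] --> (F p : R^o)) ->
  (\int[area g]_(p in (BS : set borelM)) (F p)%:E =
   \int[leb2]_(v in (Bx : set R2)) (F (of_xy c v) * conf g c v)%:E)%E.
Proof.
move=> cF.
have BSE := box_surfaceE box_sub.
have cFx v : Bx v -> (F (of_xy c u) : R^o) @[u --> v] --> (F (of_xy c v) : R^o).
  by move=> /box_sub cv; exact: (cvg_comp _ _ (of_xy_cvg cv) (cF _)).
have BSc : BS `<=` chart_dom c by rewrite BSE => p [].
transitivity (\int[area g]_(p in (BS : set borelM)) (F (of_xy c (xy c p)))%:E)%E.
  by apply: eq_integral => p /[!inE] /BSc cp; rewrite of_xyK.
apply: (integral_density (mu := area g) (nu := leb2) (phi := (xy c : borelM -> R2))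
  (DX := (BS : set borelM)) (D := (Bx : set R2)) (w := conf g c)
  _ _ _ _ _ _ _ (f := fun v => F (of_xy c v))).
- exact: box_surface_measurable.
- exact: box_measurable.
- by apply: xy_measurable => //; exact: box_surface_measurable.
- by rewrite BSE => p [].
- apply: continuous_measurable_prod; first exact: box_measurable.
  by move=> v /box_sub cv; exact: smooth_on_continuous (conf_smooth g c) cv.
- by move=> v /box_sub cv; rewrite ltW// conf_gt0.
- move=> B mB sB; rewrite BSE -(area_chart g mB) => [|v /sB /box_sub//].
  congr (area g _); apply/seteqP; split=> [p [[? ?] ?]|p [? Bp]]; split=> //.
  by split=> //; exact: sB.
- by apply: continuous_measurable_prod => //; exact: box_measurable.
Qed.

Variables (f V : M -> hs ip).
Hypothesis f_smooth : smooth_on (chart_img c) (f \o of_xy c).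
Hypothesis fC : C1M S f.
Hypothesis VC : C1M S V.
Let fc := f \o of_xy c.
Let Vc := V \o of_xy c.
Hypothesis lap0 : forall v, chart_img c v ->
  hsip ('D_ex ('D_ex fc) v + 'D_ey ('D_ey fc) v) (Vc v) = 0.
Hypothesis V0 : forall v, Bx v -> `|v.1 - a| = 2 * rho \/ `|v.2 - b| = 2 * rho -> Vc v = 0.

(* By lap0, dens times conf is the divergence of (<f_x, V>, <f_y, V>). *)
Lemma box_surface_dens0 :
  (\int[area g]_(p in (BS : set borelM)) (dens g f V p)%:E = 0)%E.
Proof.
rewrite box_surface_integral; last by move=> p; exact: dens_cvg.
have rho2 : 0 < 2 * rho by rewrite mulr_gt0.
pose D1 e v := hsip ('D_e ('D_e fc) v) (Vc v) + hsip ('D_e fc v) ('D_e Vc v).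
have VC1 v : Bx v -> C1_at Vc v.
  move=> /box_sub/chart_imgP[cp ev].
  by have := C1M_at VC cp; rewrite ev.
have dV v e : e = ex \/ e = ey -> Bx v -> is_derive v e Vc ('D_e Vc v).
  by move=> he /VC1/C1_at_derive[h1 h2]; case: he => ->; [exact: h1|exact: h2].
have cV v e : e = ex \/ e = ey -> Bx v -> {for v, continuous ('D_e Vc)}.
  by move=> he /VC1[_ h1 h2]; case: he => ->; [exact: h1|exact: h2].
have fs e := smooth_on_derive e f_smooth.
have dD e v : e = ex \/ e = ey -> Bx v ->
    is_derive v e (fun u => hsip ('D_e fc u) (Vc u) : R^o) (D1 e v).
  move=> he bv; have cv := box_sub bv.
  exact: (is_derive_bilinear (hsip_bilinear ip) (smooth_on_is_derive e (fs e) cv) (dV v e he bv)).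
have cD e v : e = ex \/ e = ey -> Bx v -> (D1 e u : R^o) @[u --> v] --> (D1 e v : R^o).
  move=> he bv; have cv := box_sub bv.
  have c1 := smooth_on_continuous (smooth_on_derive e (fs e)) cv.
  have c2 := smooth_on_continuous (fs e) cv.
  have c3 := C1_at_continuous (VC1 v bv).
  pose proof (bilin_cvg (hsip_bilinear ip) c1 c3) as L1.
  pose proof (bilin_cvg (hsip_bilinear ip) c2 (cV v e he bv)) as L2.
  exact: (cvgD L1 L2).
transitivity (\int[leb2]_(v in (Bx : set R2)) ((D1 ex v)%:E + (D1 ey v)%:E))%E.
  apply: eq_integral => v /[!inE] bv; have cv := box_sub bv.
  have [cp ev] := chart_imgP cv.
  rewrite (dens_chart g fC VC cp) ev divfK ?gt_eqF ?conf_gt0// -EFinD; congr (_%:E).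
  rewrite /dpair /pd -/fc -/Vc ev /D1.
  have alg (x y z w : R) : x + y = 0 -> z + w = x + z + (y + w).
    by move=> h; rewrite addrACA h add0r.
  by apply: alg; rewrite -hsipDl; exact: lap0.
rewrite integralD; first last.
- by apply: box_integrable => // v; apply: cD; right.
- by apply: box_integrable => // v; apply: cD; left.
- exact: box_measurable.
have h0 (T : hs ip) : hsip T 0 = 0 by rewrite -(scale0r T) hsipZr mul0r.
have Ix : (\int[leb2]_(v in (Bx : set R2)) (D1 ex v)%:E = 0)%E.
  apply: (box_integral_dx rho2 (F := fun u => hsip ('D_ex fc u) (Vc u))).
  - by move=> v; apply: dD; left.
  - by move=> v; apply: cD; left.
  - by move=> v bv h; rewrite V0 ?h0//; left.
have Iy : (\int[leb2]_(v in (Bx : set R2)) (D1 ey v)%:E = 0)%E.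
  apply: (box_integral_dy rho2 (F := fun u => hsip ('D_ey fc u) (Vc u))).
  - by move=> v; apply: dD; right.
  - by move=> v; apply: cD; right.
  - by move=> v bv h; rewrite V0 ?h0//; right.
transitivity (0 + 0 : \bar R)%E; last exact: add0e.
apply: f_equal2; [exact: Ix|exact: Iy].
Qed.

End ChartIntegral.


(** * Localization over compact sets *)

Section CompactIntegral.
Context {R : realType} {M : ptopologicalType}.
Variable S : riemann_surface R M.
Variable g : conformal_metric S.
Context {H : lmodType R[i]}.
Variable ip : {dot H for Num.conj}.
Notation R2 := (measurableTypeR R * measurableTypeR R)%type.
Notation borelM := (g_sigma_algebraType (@open M)).
Notation leb2 := (@lebesgue_measure R \x @lebesgue_measure R)%E.
Notation ex := ((1, 0) : R * R).
Notation ey := ((0, 1) : R * R).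

Notation cx p := (xy (chart_at S p) p).1.
Notation cy p := (xy (chart_at S p) p).2.

Lemma small_box_exists (p : M) : exists2 rho : R, 0 < rho &
  box (cx p) (cy p) (2 * rho) `<=` chart_img (chart_at S p).
Proof.
set c := chart_at S p; have cp : chart_dom c p by exact: rs_cover.
have /nbhs_normP[e /= e0 he] := near_chart_img (chart_img_xy cp).
(* The support of the bump has half-side 2 rho and must fit into the chart; rho = e / 4 makes it e /
   2 < e. *)
exists (e / 4); first by rewrite divr_gt0.
move=> v /boxP[h1 h2]; apply: he => /=.
rewrite prod_normE /= gt_max ![`|_ - v.1|]distrC ![`|_ - v.2|]distrC.
by apply/andP; split; [apply: le_lt_trans h1 _|apply: le_lt_trans h2 _]; lra.
Qed.

Definition radius (p : M) : R := sval (cid2 (small_box_exists p)).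

Lemma radius_gt0 p : 0 < radius p.
Proof. by rewrite /radius; case: cid2. Qed.

Lemma radius_box p : box (cx p) (cy p) (2 * radius p) `<=` chart_img (chart_at S p).
Proof. by rewrite /radius; case: cid2. Qed.

Notation BS p := (box_surface (chart_at S p) (cx p) (cy p) (radius p)).
Notation beta p := (bump_surface (chart_at S p) (cx p) (cy p) (radius p)).

(** Taking the interior makes the cells an open cover; on a cell the bump function of its centre is
    1. *)
Definition cell (p : M) : set M :=
  (chart_dom (chart_at S p) `&` xy (chart_at S p) @^-1` box (cx p) (cy p) (radius p))°.

Lemma cell_self p : cell p p.
Proof.
have cp : chart_dom (chart_at S p) p by exact: rs_cover.
have bp : \forall v \near xy (chart_at S p) p, box (cx p) (cy p) (radius p) v.
  apply/nbhs_normP; exists (radius p); first exact: radius_gt0.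
  move=> v /=; rewrite prod_normE /= gt_max => /andP[h1 h2].
  by apply/boxP; split; rewrite distrC ltW.
have near_b := near_xy cp bp; have near_c := near_chart cp.
by apply: filterS (filterI near_c near_b).
Qed.

Lemma cell_bump p q : cell p q -> beta p q = 1.
Proof.
move=> /interior_subset[cq bq]; apply: bump_surface_in => //; exact: radius_gt0.
Qed.

Lemma cell_box_surface p : cell p `<=` BS p.
Proof.
move=> q /interior_subset[cq /boxP[h1 h2]].
rewrite (box_surfaceE (@radius_box p)); split=> //; apply/boxP.
by have := radius_gt0 p; split; [apply: le_trans h1 _|apply: le_trans h2 _]; lra.
Qed.

Lemma compact_cells (K : set M) : compact K ->
  exists s : seq M, forall q, K q -> exists2 p, p \in s & cell p q.
Proof.
rewrite compact_cover => /(_ M setT cell)[||D _ KD].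
- by move=> p _; exact: open_interior.
- by move=> q Kq; exists q => //; exact: cell_self.
- by exists (finmap.enum_fset D) => q /KD[p Dp pq]; exists p.
Qed.

Lemma area_box_surface p : (area g (BS p : set borelM) < +oo)%E.
Proof.
rewrite (box_surfaceE (@radius_box p)) area_chart; first last.
- exact: radius_box.
- exact: box_measurable.
have : leb2.-integrable (box (cx p) (cy p) (2 * radius p) : set R2)
    (EFin \o conf g (chart_at S p)).
  apply: box_integrable => v /radius_box cv.
  exact: smooth_on_continuous (conf_smooth g _) cv.
move=> /integrableP[_]; apply: le_lt_trans; rewrite le_eqVlt; apply/orP; left; apply/eqP.
apply: eq_integral => v /[!inE] /radius_box cv /=.
by rewrite ger0_norm// ltW// conf_gt0.
Qed.

(** K is covered by finitely many closed coordinate squares, each of finite area because the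
    conformal factor is continuous there. *)
Lemma area_compact (K : set M) : compact K -> (area g (K : set borelM) < +oo)%E.
Proof.
move=> cK; have [s hs] := compact_cells cK.
have mK : measurable (K : set borelM).
  by apply: borel_closed; apply: compact_closed => //; exact: (rs_hausdorff S).
have mB p : measurable (BS p : set borelM).
  by apply: box_surface_measurable; exact: radius_box.
have : measurable (\big[setU/set0]_(p <- s) BS p : set borelM) /\
   (area g (\big[setU/set0]_(p <- s) BS p : set borelM) < +oo)%E.
  elim: (s) => [|p t [mt ft]]; first by rewrite big_nil measure0 ltry; split.
  rewrite big_cons; split; first exact: measurableU.
  apply: le_lt_trans (measureU2 _ _ _) _ => //.
  by rewrite lte_add_pinfty// area_box_surface.
move=> [mU fU]; apply: le_lt_trans fU; apply: le_measure; rewrite ?inE//.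
move=> q /hs[p ps /cell_box_surface pq].
by rewrite -bigcup_seq; exists p.
Qed.

Lemma compact_integrable (K : set M) (F : M -> R) : compact K ->
  (forall p, K p -> (F q : R^o) @[q --> p] --> (F p : R^o)) ->
  (area g).-integrable (K : set borelM) (EFin \o F).
Proof.
move=> cK cF; have mK : measurable (K : set borelM).
  by apply: borel_closed; apply: compact_closed => //; exact: (rs_hausdorff S).
apply: measurable_bounded_integrable => //.
- exact: area_compact.
- exact: continuous_measurable_borel.
- exact: (bounded_on_compact cK).
Qed.

Variable f : M -> hs ip.
Hypothesis fC : C1M S f.
Hypothesis f_smooth : forall c : chart S, smooth_on (chart_img c) (f \o of_xy c).
(* off p stands for the space of off-diagonal operators, the tangent space of the
   Grassmannian at the value in p of the map with embedding f. *)
Variable off : M -> set (hs ip).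
Hypothesis off_scale : forall p s V, off p V -> off p (s *: V).
Hypothesis off_sub : forall p U V, off p U -> off p V -> off p (U - V).
Hypothesis lap0 : forall (c : chart S) v V, chart_img c v -> off (of_xy c v) V ->
  hsip ('D_ex ('D_ex (f \o of_xy c)) v + 'D_ey ('D_ey (f \o of_xy c)) v) V = 0.
Variables (K : set M) (cK : compact K).

(* The bump function of the first cell splits off a field supported in one chart
   and leaves a field that vanishes on this cell. *)
Lemma compact_dens0_cells (s : seq M) (V : M -> hs ip) : C1M S V ->
  (forall p, off p (V p)) -> (forall p, ~ K p -> V p = 0) ->
  (forall q, V q != 0 -> exists2 p, p \in s & cell p q) ->
  (\int[area g]_(p in (K : set borelM)) (dens g f V p)%:E = 0)%E.
Proof.
have cl : closed K by apply: compact_closed => //; exact: (rs_hausdorff S).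
have mK : measurable (K : set borelM) by exact: borel_closed.
have outK U : (forall p, ~ K p -> U p = 0) -> forall p, ~ K p -> dens g f U p = 0.
  move=> U0 p nK; apply: dens_eq0; move: cl; rewrite -openC => oC.
  by apply: filterS (open_nbhs_nbhs (conj oC nK)) => q; exact: U0.
elim: s V => [|p s IH] V VC offV V0 Vs.
  apply: integral0_eq => q _; rewrite dens_eq0//.
  near=> u; apply/eqP; apply: contrapT => /negP /Vs[].
  by move=> ?; rewrite in_nil.
pose V1 q := beta p q *: V q; pose V2 q := V q - V1 q.
have V1C : C1M S V1.
  by apply: C1M_bump => //; [exact: radius_gt0|exact: radius_box].
have V2C : C1M S V2 by exact: C1M_sub.
have V10 q : ~ K q -> V1 q = 0 by move=> /V0; rewrite /V1 => ->; rewrite scaler0.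
have I2 : (\int[area g]_(q in (K : set borelM)) (dens g f V2 q)%:E = 0)%E.
  apply: IH => // [q|q nK|q].
  - by apply: off_sub => //; exact: off_scale.
  - by rewrite /V2 V10// V0// subr0.
  - rewrite /V2 /V1 => V2q; have [] := Vs q.
      by apply: contraNneq V2q => ->; rewrite scaler0 subr0.
    move=> p'; rewrite inE => /orP[/eqP -> /cell_bump b1|p's ?]; last by exists p'.
    by move: V2q; rewrite b1 scale1r subrr eqxx.
have outB q : ~ BS p q -> dens g f V1 q = 0.
  move=> nq; apply: dens_eq0; apply: filterS (near_out (@radius_box p) nq) => u nu.
  by rewrite /V1 (bump_surface_out (radius_gt0 p) (@radius_box p))// scale0r.
have I1 : (\int[area g]_(q in (K : set borelM)) (dens g f V1 q)%:E = 0)%E.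
  (* The density of [V1] vanishes off K and off the square, so either set may serve as the domain of
     integration. *)
  transitivity (\int[area g]_(q in (BS p : set borelM)) (dens g f V1 q)%:E)%E.
    rewrite integral_mkcond [RHS]integral_mkcond; apply: eq_integral => q _.
    rewrite !patchE; case: ifPn => [_|nK]; case: ifPn => [_|nB] => //.
      by rewrite outB// => /mem_set; exact/negP.
    by rewrite (outK _ V10)// => /mem_set; exact/negP.
  apply: box_surface_dens0 => //.
  - exact: radius_gt0.
  - exact: radius_box.
  - by move=> v /= cv; apply: lap0 => //; apply: off_scale.
  - move=> v /radius_box bv h; rewrite /= /V1 /bump_surface; case: asboolP => [cv|_]; last by rewrite scale0r.
    have [_ ->] := chart_imgP bv; have -> : bump (cx p) (cy p) (radius p) v = 0 
      by apply: bump0; [exact: radius_gt0|case: h => ->; [left|right]].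
    by rewrite scale0r.
transitivity (\int[area g]_(q in (K : set borelM)) ((dens g f V2 q)%:E + (dens g f V1 q)%:E))%E.
  by apply: eq_integral => q _; rewrite -EFinD /V2 densB// subrK.
rewrite integralD//.
- transitivity (0 + 0 : \bar R)%E; last exact: add0e.
  by apply: f_equal2; [exact: I2|exact: I1].
- by apply: compact_integrable => // q _; exact: dens_cvg.
- by apply: compact_integrable => // q _; exact: dens_cvg.
Unshelve. all: by end_near. Qed.

Lemma compact_dens0 (V : M -> hs ip) : C1M S V ->
  (forall p, off p (V p)) -> (forall p, ~ K p -> V p = 0) ->
  (\int[area g]_(p in (K : set borelM)) (dens g f V p)%:E = 0)%E.
Proof.
move=> VC offV V0; have [s hs] := compact_cells cK.
apply: (compact_dens0_cells (s := s)) => // q Vq; apply: hs.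
by apply: contrapT => /V0 h; rewrite h eqxx in Vq.
Qed.

End CompactIntegral.


(** * The first variation of the energy *)

Section Slices.
Context {R : realType} {X Y W : normedModType R}.
Implicit Types (F : X * Y -> W).

Lemma slice1_line (h : R) (a t : X) (v : Y) :
  h *: ((a, 0) : X * Y) + (t, v) = (h *: a + t, v).
Proof. by apply: pair_ext => /=; rewrite ?scaler0 ?add0r. Qed.

Lemma slice2_line (h : R) (b v : Y) (t : X) :
  h *: ((0, b) : X * Y) + (t, v) = (t, h *: b + v).
Proof. by apply: pair_ext => /=; rewrite ?scaler0 ?add0r. Qed.

Lemma derive_slice1 F a t v : 'D_a (fun s => F (s, v)) t = 'D_(a, 0) F (t, v).
Proof.
rewrite /derive; apply: (congr1 (fun G : R -> W => lim (G h @[h --> 0^']))).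
by apply/funext => h /=; rewrite slice1_line.
Qed.

Lemma derive_slice2 F b t v : 'D_b (fun u => F (t, u)) v = 'D_(0, b) F (t, v).
Proof.
rewrite /derive; apply: (congr1 (fun G : R -> W => lim (G h @[h --> 0^']))).
by apply/funext => h /=; rewrite slice2_line.
Qed.

Lemma is_derive_slice1 F a t v d : is_derive ((t, v) : X * Y) ((a, 0) : X * Y) F d ->
  is_derive t a (fun s => F (s, v)) d.
Proof.
move=> /is_deriveP h; apply/is_deriveP; refine (cvg_near _ h).
by near=> s; rewrite slice1_line.
Unshelve. all: by end_near. Qed.

Lemma is_derive_slice2 F b t v d : is_derive ((t, v) : X * Y) ((0, b) : X * Y) F d ->
  is_derive v b (fun u => F (t, u)) d.
Proof.
move=> /is_deriveP h; apply/is_deriveP; refine (cvg_near _ h).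
by near=> s; rewrite slice2_line.
Unshelve. all: by end_near. Qed.

Lemma smooth_on_slice (O : set (X * Y)) (O' : set Y) F t :
  (forall v, O' v -> O (t, v)) -> smooth_on O F -> smooth_on O' (fun v => F (t, v)).
Proof.
move=> sO [S [SF hS]].
(* The slices at t of the functions in the class for F form a class for the slice of F, derivatives
   in the direction b being slices of those in the direction (0, b). *)
exists [set G | exists2 G', S G' & G = (fun v => G' (t, v))]; split; first by exists F.
move=> _ [G SG ->]; have [cG dG] := hS G SG; split=> [v /sO Ov|b].
  exact: (cvg_comp _ _ (cvg_pair (cvg_cst t) cvg_id) (cG _ Ov)).
have [SD hD] := dG (0, b); split.
  exists ('D_(0, b) G); [exact: SD|apply/funext => v; exact: derive_slice2].
move=> v /sO Ov; have := derivableP (hD _ Ov) => /is_derive_slice2 h.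
exact: (@ex_derive _ _ _ _ _ _ _ h).
Qed.

End Slices.

Section VariationSlices.
Context {R : realType} {H : completeNormedModType R[i]}.
Variable ip : {dot H for Num.conj}.
Variables (Hp Hm : set H) (d : int).
Hypothesis pol : polarization ip Hp Hm.
Context {M : ptopologicalType}.
Variable S : riemann_surface R M.
Variables (phi : M -> set H) (K : set M) (e : R) (Phi : R -> M -> set H).
Hypothesis Phi_variation : Defs.variation ip Hp Hm d S phi K e Phi.
Notation V3 := (R * (R * R))%type.
Implicit Types (c : chart S) (t : R) (v : R * R) (p : M).

Definition vembed t p : hs ip := gr_embed ip Hp (Phi t p).
Definition vfield t p : hs ip := 'D_1 (fun s : R => vembed s p) t.

Definition vdom c : set V3 := [set w | `|w.1| < e /\ chart_img c w.2].
Definition vchart c (w : V3) : hs ip := vembed w.1 (of_xy c w.2).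

Lemma near_lt t : `|t| < e -> \forall s \near t, `|s| < e.
Proof.
move=> te; have nt : `|s| @[s --> t] --> `|t| by apply: cvg_norm; exact: cvg_id.
by move/cvgrPdist_lt: nt => /(_ (e - `|t|)); rewrite subr_gt0 => /(_ te);
  apply: filterS => s; rewrite ltr_norml => /andP[h _]; lra.
Qed.

Lemma vdom_open c : open (vdom c).
Proof.
rewrite openE => -[t v] [/= te cv]; rewrite /interior.
have n1 := near_lt te.
have n2 := near_chart_img cv.
by exists ([set s | `|s| < e], chart_img c) => // -[s u] [].
Qed.

Lemma vchart_smooth c : smooth_on (vdom c) (vchart c).
Proof. by have [_ _ /(_ c)[_ _]] := Phi_variation. Qed.

Lemma vembed_smooth c t : `|t| < e -> smooth_on (chart_img c) (vembed t \o of_xy c).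
Proof. by move=> te; apply: (smooth_on_slice (t := t) _ (vchart_smooth c)). Qed.

Lemma vfieldE c t : vfield t \o of_xy c = (fun v => 'D_((1, 0) : V3) (vchart c) (t, v)).
Proof. by apply/funext => v; rewrite -derive_slice1. Qed.

Lemma vfield_smooth c t : `|t| < e -> smooth_on (chart_img c) (vfield t \o of_xy c).
Proof.
move=> te; rewrite vfieldE.
by apply: (smooth_on_slice (t := t) _ (smooth_on_derive ((1, 0) : V3) (vchart_smooth c))).
Qed.

Lemma smooth_C1M (F : M -> hs ip) :
  (forall c, smooth_on (chart_img c) (F \o of_xy c)) -> C1M S F.
Proof.
move=> Fs c p cp; apply: C1_chart_at => //.
apply: filterS (near_chart_img (chart_img_xy cp)) => v cv.
by apply: (smooth_on_C1_at _ cv (Fs c)); exact: chart_img_open.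
Qed.

Lemma vembed_C1M t : `|t| < e -> C1M S (vembed t).
Proof. by move=> te; apply: smooth_C1M => c; exact: vembed_smooth. Qed.

Lemma vfield_C1M t : `|t| < e -> C1M S (vfield t).
Proof. by move=> te; apply: smooth_C1M => c; exact: vfield_smooth. Qed.

Lemma variation_gr_smooth t c : `|t| < e ->
  gr_smooth ip Hp Hm d (chart_img c) (Phi t \o of_xy c).
Proof.
move=> te; have [_ _ /(_ c)[h1 h2 _]] := Phi_variation; split.
- by move=> v cv; exact: (h1 (t, v)).
- by move=> v cv; exact: (h2 (t, v)).
- exact: vembed_smooth.
Qed.

(** The variation is a smooth map on a three-dimensional parameter domain and the velocity is its
    derivative in the time direction, so [gr_derive_offdiag] applies as it does to the space
    directions. *)
Lemma vfield_offdiag t p x : `|t| < e ->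
  vfield t p x = oproj ip (Phi t p) (vfield t p x) + vfield t p (oproj ip (Phi t p) x).
Proof.
move=> te; set c := chart_at S p.
have cp : chart_dom c p by exact: rs_cover.
have [_ _ /(_ c) h] := Phi_variation.
have Ov : vdom c (t, xy c p) by split=> //; exact: chart_img_xy.
have E := congr1 (fun F => F (xy c p)) (vfieldE c t).
rewrite -(of_xyK cp); move: (xy c p) Ov E => v Ov E.
rewrite [vfield t (of_xy c v)]E.
exact: (gr_derive_offdiag pol (@vdom_open c) h ((1, 0) : V3) x Ov).
Qed.

Lemma vfield_out t p : `|t| < e -> ~ K p -> vfield t p = 0.
Proof.
move=> te nK; have [_ h _] := Phi_variation.
rewrite /vfield.
suff h0 : is_derive t (1 : R) (fun s : R => vembed s p) 0 by exact: (@derive_val _ _ _ _ _ _ _ h0).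
apply: (is_derive_near _ (is_derive_cst (gr_embed ip Hp (phi p)) t 1)).
by apply: filterS (near_lt te) => s se; rewrite /vembed h.
Qed.

Variable g : conformal_metric S.

Lemma energy_densityE t p : `|t| < e ->
  energy_density ip Hp g (Phi t) p = 2^-1 * dens g (vembed t) (vembed t) p.
Proof.
move=> te; rewrite /energy_density /dens; set c := chart_at S p.
have cp : chart_dom c p by exact: rs_cover.
have cv := chart_img_xy cp.
have h := variation_gr_smooth c te.
rewrite !(gr_speed2E pol (chart_img_open (c:=c)) h _ cv) -mulrDr mulrA; congr (_ * _ / _).
Qed.

End VariationSlices.


Section EnergyDerivative.
Context {R : realType} {H : completeNormedModType R[i]}.
Variable ip : {dot H for Num.conj}.
Variables (Hp Hm : set H) (d : int).
Hypothesis pol : polarization ip Hp Hm.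
Context {M : ptopologicalType}.
Variable S : riemann_surface R M.
Variables (phi : M -> set H) (K : set M) (e : R) (Phi : R -> M -> set H).
Hypothesis Phi_variation : Defs.variation ip Hp Hm d S phi K e Phi.
Variable g : conformal_metric S.
Notation ex := ((1, 0) : R * R).
Notation ey := ((0, 1) : R * R).
Notation V3 := (R * (R * R))%type.
Notation f := (vembed ip Hp Phi).
Notation V := (vfield ip Hp Phi).
Notation Fc := (vchart ip Hp Phi).
Notation et := ((1, 0) : V3).
Implicit Types (c : chart S) (t : R) (v b : R * R) (p : M).

Lemma pd_vembed b c t p : pd b c (f t) p = 'D_((0, b) : V3) (Fc c) (t, xy c p).
Proof. exact: (derive_slice2 (Fc c) b t (xy c p)). Qed.

Lemma pd_vfield b c t p :
  pd b c (V t) p = 'D_((0, b) : V3) ('D_et (Fc c)) (t, xy c p).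
Proof. by rewrite /pd vfieldE; exact: (derive_slice2 ('D_et (Fc c)) b t (xy c p)). Qed.

Lemma vchart_schwarz b c t v : `|t| < e -> chart_img c v ->
  'D_et ('D_((0, b) : V3) (Fc c)) (t, v) = 'D_((0, b) : V3) ('D_et (Fc c)) (t, v).
Proof.
move=> te cv; have Fs := vchart_smooth Phi_variation c.
have Ov : vdom e c (t, v) by [].
apply: (schwarz (f := Fc c) (a := ((0, b) : V3)) (b := et)
  (fa := 'D_((0, b) : V3) (Fc c)) (fb := 'D_et (Fc c))
  (fab := 'D_et ('D_((0, b) : V3) (Fc c))) (fba := 'D_((0, b) : V3) ('D_et (Fc c)))
  (x := (t, v))).
- apply: filterS (open_nbhs_nbhs (conj (@vdom_open _ _ S e c) Ov)) => w Ow; split.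
  + exact: (smooth_on_is_derive _ Fs Ow).
  + exact: (smooth_on_is_derive _ Fs Ow).
  + exact: (smooth_on_is_derive _ (smooth_on_derive _ Fs) Ow).
  + exact: (smooth_on_is_derive _ (smooth_on_derive _ Fs) Ow).
- exact: (smooth_on_continuous (smooth_on_derive _ (smooth_on_derive _ Fs)) Ov).
- exact: (smooth_on_continuous (smooth_on_derive _ (smooth_on_derive _ Fs)) Ov).
Qed.

Lemma pd_sq_derive b c t p : `|t| < e -> chart_dom c p ->
  is_derive t (1 : R) (fun s : R => hsip (pd b c (f s) p) (pd b c (f s) p) : R^o)
    (2 * hsip (pd b c (f t) p) (pd b c (V t) p)).
Proof.
move=> te cp; have cv := chart_img_xy cp.
have Fs := smooth_on_derive ((0, b) : V3) (vchart_smooth Phi_variation c).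
have Ov : vdom e c (t, xy c p) by [].
have h := is_derive_slice1 (smooth_on_is_derive et Fs Ov).
have E : (fun s : R => hsip (pd b c (f s) p) (pd b c (f s) p) : R^o) =
  (fun s : R => hsip ('D_((0, b) : V3) (Fc c) (s, xy c p)) ('D_((0, b) : V3) (Fc c) (s, xy c p))).
  by apply/funext => s; rewrite pd_vembed.
rewrite E mulr_natl mulr2n {1}hsipC pd_vembed pd_vfield -(vchart_schwarz b te cv).
exact: (is_derive_bilinear (hsip_bilinear ip) h h).
Qed.

(** The 1/2 of [energy_densityE] absorbs the 2 from differentiating a square; time and space
    derivatives are exchanged by [vchart_schwarz]. *)
Lemma energy_density_derive t p : `|t| < e ->
  is_derive t (1 : R) (fun s : R => energy_density ip Hp g (Phi s) p : R^o)
    (dens g (f t) (V t) p).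
Proof.
move=> te; set c := chart_at S p.
have cp : chart_dom c p by exact: rs_cover.
have h := is_deriveD (pd_sq_derive ex te cp) (pd_sq_derive ey te cp).
have h2 := is_deriveZ (2^-1 / conf g c (xy c p)) h.
have alg (x y z : R) : 2^-1 / z * (x + y) = 2^-1 * ((x + y) / z).
  by rewrite -mulrA [z^-1 * _]mulrC.
have alg2 (x y z : R) : 2^-1 / z * (2 * x + 2 * y) = (x + y) / z.
  by rewrite -mulrDr mulrACA mulVf ?mul1r 1?mulrC// pnatr_eq0.
have E : \forall s \near t, 2^-1 / conf g c (xy c p) *
    (hsip (pd ex c (f s) p) (pd ex c (f s) p) + hsip (pd ey c (f s) p) (pd ey c (f s) p))
    = energy_density ip Hp g (Phi s) p.
  apply: filterS (near_lt te) => s se.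
  rewrite (energy_densityE pol Phi_variation g p se); exact: alg.
have D : dens g (f t) (V t) p = 2^-1 / conf g c (xy c p) *
    (2 * hsip (pd ex c (f t) p) (pd ex c (V t) p) +
     2 * hsip (pd ey c (f t) p) (pd ey c (V t) p)).
  exact/esym/alg2.
rewrite D; exact: (is_derive_near (W := R^o) E h2).
Qed.

(** Joint continuity in time and position, taken in one fixed chart around p, is what compactness of
    K turns into a uniform bound. *)
Lemma dens_joint_cvg p : 0 < e ->
  (dens g (f w.1) (V w.1) w.2 : R^o) @[w --> ((0 : R), p)] --> (dens g (f 0) (V 0) p : R^o).
Proof.
move=> e0; set c := chart_at S p.
have cp : chart_dom c p by exact: rs_cover.
have cv := chart_img_xy cp.
have Fs := vchart_smooth Phi_variation c.
have Ov : vdom e c (0, xy c p) by split; rewrite //= normr0.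
have L0 : (w.1, xy c w.2) @[w --> ((0 : R), p)] --> ((0 : R), xy c p).
  exact: (cvg_pair cvg_fst (cvg_comp _ _ cvg_snd (xy_cvg cp))).
have cA b : pd b c (f w.1) w.2 @[w --> ((0 : R), p)] --> pd b c (f 0) p.
  have E : (fun w : R * M => pd b c (f w.1) w.2) =
      (fun w => 'D_((0, b) : V3) (Fc c) (w.1, xy c w.2)).
    by apply/funext => w; rewrite pd_vembed.
  rewrite E pd_vembed.
  exact: (cvg_comp _ _ L0 (smooth_on_continuous (smooth_on_derive _ Fs) Ov)).
have cB b : pd b c (V w.1) w.2 @[w --> ((0 : R), p)] --> pd b c (V 0) p.
  have E : (fun w : R * M => pd b c (V w.1) w.2) =
      (fun w => 'D_((0, b) : V3) ('D_et (Fc c)) (w.1, xy c w.2)).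
    by apply/funext => w; rewrite pd_vfield.
  rewrite E pd_vfield.
  exact: (cvg_comp _ _ L0 (smooth_on_continuous (smooth_on_derive _ (smooth_on_derive _ Fs)) Ov)).
have cf b : (hsip (pd b c (f w.1) w.2) (pd b c (V w.1) w.2) : R^o) @[w --> ((0 : R), p)]
    --> (hsip (pd b c (f 0) p) (pd b c (V 0) p) : R^o).
  exact: (bilin_cvg (hsip_bilinear ip) (cA b) (cB b)).
have cc : (conf g c (xy c w.2) : R^o) @[w --> ((0 : R), p)] --> (conf g c (xy c p) : R^o).
  have L1 : xy c w.2 @[w --> ((0 : R), p)] --> xy c p.
    exact: (cvg_comp _ _ cvg_snd (xy_cvg cp)).
  have L2 := smooth_on_continuous (conf_smooth g c) cv.
  exact: (cvg_comp (fun w : R * M => xy c w.2) (conf g c) L1 L2).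
have c0 : conf g c (xy c p) != 0 by rewrite gt_eqF// conf_gt0.
pose proof (cvgM (cvgD (cf ex) (cf ey)) (cvgV c0 cc)) as L.
have n1 : \forall w \near ((0 : R), p), dpair c (f w.1) (V w.1) w.2 / conf g c (xy c w.2)
    = dens g (f w.1) (V w.1) w.2.
  have n0 : \forall s \near (0 : R), `|s| < e by apply: near_lt; rewrite normr0.
  exists ([set s : R | `|s| < e], chart_dom c).
    by split; [exact: n0|exact: near_chart].
  move=> [s q] [/= se cq]; apply/esym; apply: dens_chart => //.
    exact: (vembed_C1M Phi_variation).
  exact: (vfield_C1M Phi_variation).
rewrite -(nbhs_singleton n1); exact: (cvg_near (W := R^o) n1 L).
Qed.

End EnergyDerivative.


Section FirstVariation.
Context {R : realType} {H : completeNormedModType R[i]}.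
Variable ip : {dot H for Num.conj}.
Variables (Hp Hm : set H) (d : int).
Hypothesis pol : polarization ip Hp Hm.
Context {M : ptopologicalType}.
Variable S : riemann_surface R M.
Variables (phi : M -> set H) (K : set M) (e : R) (Phi : R -> M -> set H).
Hypothesis e0 : 0 < e.
Hypothesis cK : compact K.
Hypothesis Phi_variation : Defs.variation ip Hp Hm d S phi K e Phi.
Variable g : conformal_metric S.
Notation borelM := (g_sigma_algebraType (@open M)).
Notation f := (vembed ip Hp Phi).
Notation V := (vfield ip Hp Phi).

(** The constant C is the integrable majorant for differentiating under the integral over K. *)
Lemma dens_bounded : exists u C : R, [/\ 0 < u, u <= e, 0 <= C &
  forall t p, `|t| < u -> K p -> `|dens g (f t) (V t) p| <= C].
Proof.
(* The bound is a second parameter, tending to +oo beside the time t; the covering form of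
   compactness then provides one bound for all of K. *)
have := cK => /compact_near_coveringP /(_ (R * R)%type
  (filter_prod (nbhs (0 : R)) (pinfty_nbhs R))
  (fun w p => `|dens g (f w.1) (V w.1) p| <= w.2) _) [].
  move=> p Kp; set D := dens g (f 0) (V 0) p.
  have /cvgrPdist_lt /(_ 1 ltr01) := @dens_joint_cvg _ _ _ _ _ _ _ _ _ _ _ _ Phi_variation g p e0.
  rewrite -/D => -[[A B] /= [A0 Bp] AB].
  have C0 : \forall C \near +oo, `|D| + 1 < C.
    by apply: nbhs_pinfty_gt; exact: num_real.
  exists (B, [set w : R * R | A w.1 /\ `|D| + 1 < w.2]).
    split; [exact: Bp|exists (A, [set C | `|D| + 1 < C]); first exact: (conj A0 C0)].
    by move=> [t C] [tA hC]; exact: (conj tA hC).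
  move=> [q [t C]] [/= Bq [At hC]].
  have := AB (t, q) (conj At Bq); rewrite /= => h.
  apply: le_trans (ltW hC); rewrite -lerBlDl.
  by apply: le_trans (lerB_dist _ _) _; rewrite distrC ltW.
move=> [A B] /= [A0 Boo] AB.
have /nbhs_normP[u /= u0 hu] := A0.
have [C0 [_ hC]] := Boo.
(* The bound holds beyond the threshold C0, whose sign is unknown; |C0| + 1 is beyond it and
   nonnegative. *)
have BC : B (`|C0| + 1) by apply: hC; rewrite (le_lt_trans (ler_norm _))// ltrDl.
exists (Num.min u e), (`|C0| + 1); split.
- by rewrite lt_min u0.
- by rewrite ge_min lexx orbT.
- by rewrite addr_ge0.
- move=> t p; rewrite lt_min => /andP[tu _] Kp.
  apply: (AB (t, `|C0| + 1) _ p Kp); split=> //=.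
  by apply: hu; rewrite /= sub0r normrN.
Qed.

Lemma energy_density_cvg t p : `|t| < e ->
  (energy_density ip Hp g (Phi t) q : R^o) @[q --> p] --> (energy_density ip Hp g (Phi t) p : R^o).
Proof.
move=> te; have fC := vembed_C1M Phi_variation te.
have E : energy_density ip Hp g (Phi t) = (fun q => 2^-1 * dens g (f t) (f t) q).
  by apply/funext => q; rewrite (energy_densityE pol Phi_variation g q te).
have L1 := @dens_cvg _ _ _ g _ _ _ _ p fC fC.
have L2 : ((2^-1 : R^o) : R^o) @[q --> p] --> (2^-1 : R^o) by exact: cvg_cst.
pose proof (cvgM L2 L1) as L.
by rewrite E; exact: L.
Qed.

Lemma energy_is_derive :
  is_derive (0 : R) (1 : R) (fun t : R => energy ip Hp g K (Phi t) : R^o)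
    (2^-1 * Rintegral (area g) (K : set borelM) (dens g (f 0) (V 0))).
Proof.
have [u [C [u0 ue C0 bC]]] := dens_bounded.
have mK : measurable (K : set borelM).
  by apply: borel_closed; apply: compact_closed => //; exact: (rs_hausdorff S).
have Iu t : `](- u), u[%classic t -> `|t| < u by rewrite /= in_itv /= ltr_norml.
have Ie t : `](- u), u[%classic t -> `|t| < e by move=> /Iu h; exact: lt_le_trans ue.
have Ia : `](- u), u[%classic 0 by rewrite /= in_itv /= oppr_lt0 u0.
pose F (t : R) (p : borelM) : R := energy_density ip Hp g (Phi t) p.
have dF t p : `](- u), u[%classic t ->
    is_derive t (1 : R) (F ^~ p : R -> R^o) (dens g (f t) (V t) p).
  by move=> /Ie te; exact: (energy_density_derive pol Phi_variation g p te).
have F1 t p : `](- u), u[%classic t -> partial1of2 F t p = dens g (f t) (V t) p.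
  by move=> tu; rewrite partial1of2E; exact: (@derive_val _ _ _ _ _ _ _ (dF t p tu)).
pose proof (@cvg_differentiation_under_integral R _ borelM (area g) F (K : set borelM) mK
  0 (- u) u Ia) as L.
have {}L : h^-1 *: (Rintegral (area g) K (F (h + 0)) - Rintegral (area g) K (F 0))
    @[h --> 0^'] --> (Rintegral (area g) (K : set borelM) (dens g (f 0) (V 0)) : R^o).
  have -> : Rintegral (area g) (K : set borelM) (dens g (f 0) (V 0)) =
      Rintegral (area g) (K : set borelM) (partial1of2 F 0).
    by congr fine; apply: eq_integral => p _; rewrite F1.
  apply: (L _ _ (fun=> C) (fun=> C0)).
  - by move=> t /Ie te; apply: compact_integrable => // p _; exact: energy_density_cvg.
  - by move=> t p tu _; exact: (@ex_derive _ _ _ _ _ _ _ (dF t p tu)).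
  - by apply: compact_integrable => // p _; exact: cvg_cst.
  - by move=> t p tu Kp; rewrite F1//; apply: bC => //; exact: Iu.
have D : is_derive (0 : R) (1 : R) (fun t : R => Rintegral (area g) (K : set borelM) (F t) : R^o)
    (Rintegral (area g) (K : set borelM) (dens g (f 0) (V 0))).
  by apply/is_deriveP; refine (cvg_near _ L); near=> h; rewrite -[h *: 1]/(h * 1) mulr1.
exact: (is_deriveZ (2^-1) D).
Unshelve. all: by end_near. Qed.

End FirstVariation.

(** * Harmonicity from the vanishing of the Laplacian blocks *)

Section Harmonicity.
Context {R : realType} {H : completeNormedModType R[i]}.
Variable ip : {dot H for Num.conj}.
Variables (Hp Hm : set H) (d : int).
Hypothesis pol : polarization ip Hp Hm.
Context {M : ptopologicalType}.
Variable S : riemann_surface R M.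
Variable phi : M -> set H.
Hypothesis phi_smooth : gr_smooth_map ip Hp Hm d S phi.
Notation ex := ((1, 0) : R * R).
Notation ey := ((0, 1) : R * R).
Notation T c := (fun v => gr_embed ip Hp (phi (of_xy c v))).
Hypothesis lap0 : forall (c : chart S) v (V : hs ip), chart_img c v ->
  (forall x, V x = oproj ip (phi (of_xy c v)) (V x) + V (oproj ip (phi (of_xy c v)) x)) ->
  hsip ('D_ex ('D_ex (T c)) v + 'D_ey ('D_ey (T c)) v) V = 0.

(** At time 0 the velocity of a variation is a C^1 off-diagonal field vanishing outside K, which is
    what [compact_dens0] asks of a field; so the derivative given by [energy_is_derive] is 0. *)
Lemma harmonic_of_laplacian : harmonic_map ip Hp Hm d S phi.
Proof.
split=> // g K e Phi cK e0 hv.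
have [Phi0 _ _] := hv.
have e00 : `|0 : R| < e by rewrite normr0.
have := energy_is_derive pol e0 cK hv g.
suff -> : Rintegral (area g) K (dens g (vembed ip Hp Phi 0) (vfield ip Hp Phi 0)) = 0.
  by rewrite mulr0.
have Q_lin p : linear (oproj ip (phi p)).
  have cp : chart_dom (chart_at S p) p by exact: rs_cover.
  have [[+ _ _] _ _] := gr_oproj pol (phi_smooth (chart_at S p)) (chart_img_xy cp).
  by rewrite /= of_xyK.
pose off p : set (hs ip) := [set U | forall x,
  U x = oproj ip (phi p) (U x) + U (oproj ip (phi p) x)].
have offZ p (s : R) U : off p U -> off p (s *: U).
  move=> hU x; rewrite -[LHS]/(s%:C *: U x) -[X in _ = X + _]/(oproj ip (phi p) (s%:C *: U x)).
  rewrite -[X in _ = _ + X]/(s%:C *: U (oproj ip (phi p) x)).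
  by rewrite (linear_funZ _ _ (Q_lin p)) -scalerDr -hU.
have offB p U W : off p U -> off p W -> off p (U - W).
  move=> hU hW x; rewrite -[LHS]/(U x - W x) -[X in _ = X + _]/(oproj ip (phi p) (U x - W x)).
  rewrite -[X in _ = _ + X]/(U (oproj ip (phi p) x) - W (oproj ip (phi p) x)).
  by rewrite (linear_funB _ _ (Q_lin p)) addrACA -opprD -hU -hW.
rewrite /Rintegral -[RHS]/(fine (0 : \bar R)%E); apply: congr1.
apply: (@compact_dens0 _ _ _ g _ _ _ _ _ off offZ offB _ K cK).
- exact: (vembed_C1M hv).
- by move=> c; apply: (vembed_smooth hv).
- by move=> c v U cv hU; rewrite /vembed Phi0; exact: lap0.
- exact: (vfield_C1M hv).
- by move=> p x; rewrite -Phi0; exact: (vfield_offdiag pol hv).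
- by move=> p nK; exact: (vfield_out hv).
Qed.

End Harmonicity.


(** * The J2 equations of a flag-valued map *)

Section FlagBlocks.
Context {R : realType} {H : completeNormedModType R[i]}.
Variable ip : {dot H for Num.conj}.
Variables (n : nat) (E : 'I_n -> set H).
Hypothesis E_closed : forall i, closed_subspace (E i).
Hypothesis E_orth : forall i j, i != j -> orthogonal_sets ip (E i) (E j).
Hypothesis E_decomp : forall x, exists u : 'I_n -> H, (forall i, E i (u i)) /\ x = \sum_i u i.
Notation P i := (oproj ip (E i)).

(** The operator h may depend on the indices, so that the same extraction of a block applies to
    [flag_diff] and to [J2]. *)
Lemma block_sum (h : 'I_n -> 'I_n -> H -> H) i j x : (forall i j, h i j 0 = 0) -> i != j ->
  P i (\sum_i' \sum_(j' | j' != i') P i' (h i' j' (P j' (P j x)))) = P i (h i j (P j x)).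
Proof.
move=> h0 ij; have [lP _ PP] := E_oproj E_closed E_orth E_decomp i.
have [_ _ PPj] := E_oproj E_closed E_orth E_decomp j.
have P0 i' : P i' 0 = 0.
  by have [l _ _] := E_oproj E_closed E_orth E_decomp i'; exact: linear_fun0 l.
rewrite (linear_sumr _ _ _ lP) (bigD1 i)//= [X in _ + X]big1 ?addr0 => [|i' i'i]; last first.
  rewrite (linear_sumr _ _ _ lP) big1// => j' _.
  by rewrite (E_oproj_orth E_closed E_orth E_decomp)// eq_sym.
rewrite (linear_sumr _ _ _ lP) (bigD1 j) 1?eq_sym//= [X in _ + X]big1 ?addr0 => [|j' /andP[_ j'j]].
  by rewrite PP PPj.
by rewrite (E_oproj_orth E_closed E_orth E_decomp x j'j) h0 !P0.
Qed.

End FlagBlocks.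

Section FlagMaps.
Context {R : realType} {H : completeNormedModType R[i]}.
Variable ip : {dot H for Num.conj}.
Variables (Hp Hm : set H).
Hypothesis ip_norm : forall x : H, ip x x = `|x| ^+ 2.
Hypothesis pol : polarization ip Hp Hm.
Variables (n : nat) (r : 'I_n -> int) (k l : 'I_n).
Variables (sigma : {set 'I_n}) (k_sigma : k \in sigma) (l_sigma : l \notin sigma).
Context {M : ptopologicalType}.
Variables (S : riemann_surface R M) (psi : M -> 'I_n -> set H).
Hypothesis psi_J2 : J2_holomorphic ip Hp Hm r k l sigma S psi.
Notation ex := ((1, 0) : R * R).
Notation ey := ((0, 1) : R * R).
Notation d := (\sum_(i in sigma) r i).
Implicit Types (c : chart S).

Let p i := flag_ref ip Hp Hm k l i.
Let T c i v := flag_embed ip Hp Hm k l i (psi (of_xy c v) i).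

Lemma orth_proj0 : orth_proj ip (fun=> 0 : H).
Proof.
split=> [a x y|x y|x] //; first by rewrite scaler0 addr0.
by rewrite linear0l linear0r.
Qed.

Lemma flag_ref_proj i : orth_proj ip (p i).
Proof.
rewrite /p /flag_ref; case: ifP => _; first by case: (Hp_oproj pol).
by case: ifP => _; [case: (Hm_oproj pol)|exact: orth_proj0].
Qed.

Let psi_flag c v : chart_img c v -> flag ip Hp Hm r k l (psi (of_xy c v)).
Proof. by move=> cv; have [/(_ c)[h _ _] _] := psi_J2; exact: (h v cv). Qed.

Let psi_hs c v i : chart_img c v ->
  hs_op ip (fun x => oproj ip (psi (of_xy c v) i) x - p i x).
Proof. by move=> cv; have [/(_ c)[_ h _] _] := psi_J2; exact: (h v i cv). Qed.

Let T_smooth c i : smooth_on (chart_img c) (T c i).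
Proof. by have [/(_ c)[_ _ h] _] := psi_J2; exact: (h i). Qed.

Lemma flag_proj_at c v i : chart_img c v ->
  proj_at (p i) (T c i) v = oproj ip (psi (of_xy c v) i).
Proof.
move=> cv; apply/funext => x.
by rewrite /proj_at /T /flag_embed (to_hsE (psi_hs i cv)) addrC subrK.
Qed.

Lemma flag_J2_eq c i j v x : chart_img c v -> i != j ->
  oproj ip (psi (of_xy c v) i) ('D_ey (T c j) v (oproj ip (psi (of_xy c v) j) x)) =
  Jc (J2_type10 sigma i j) *:
    oproj ip (psi (of_xy c v) i) ('D_ex (T c j) v (oproj ip (psi (of_xy c v) j) x)).
Proof.
(* At (a, b) = (1, 0) the rotated vector is (0, 1), which compares the y-derivative with J2 of the
   x-derivative. *)
move=> cv ij; have [_ /(_ c v cv 1 0)] := psi_J2; rewrite oppr0 => Jeq.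
have [[Ec Eo] Ed _ _ _] := psi_flag cv.
set E := psi (of_xy c v) in Ec Eo Ed *.
have lP i' : linear (oproj ip (E i')) by case: (E_oproj Ec Eo Ed i').
have B e i' j' y : i' != j' ->
    oproj ip (E i') (flag_diff ip Hp Hm k l (psi \o of_xy c) v e (oproj ip (E j') y)) =
    oproj ip (E i') ('D_e (T c j') v (oproj ip (E j') y)).
  exact: (block_sum Ec Eo Ed (h := fun i j => ('D_e (T c j) v : H -> H)) y
    (fun _ j => linear_fun0 (hs_linear _))).
have xi0 : flag_diff ip Hp Hm k l (psi \o of_xy c) v ex 0 = 0.
  rewrite /flag_diff big1// => i' _; rewrite big1// => j' _.
  by rewrite (linear_fun0 (lP j')) (linear_fun0 (hs_linear _)) (linear_fun0 (lP i')).
rewrite -[LHS](B ey i j x ij) Jeq -[in RHS](B ex i j x ij); move: xi0.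
move: (flag_diff _ _ _ _ _ _ _ ex) => xi xi0; clear B Jeq.
rewrite -(linear_funZ _ _ (lP i)).
have h0 i' j' : Jc (J2_type10 sigma i' j') *: xi 0 = 0 by rewrite xi0 scaler0.
have := block_sum Ec Eo Ed (h := fun i j y => Jc (J2_type10 sigma i j) *: xi y) x h0 ij.
move=> <-; congr (oproj ip (E i) _); apply: eq_bigr => i' _; apply: eq_bigr => j' _.
by rewrite (linear_funZ _ _ (lP i')).
Qed.

Let Ts c v := gr_embed ip Hp (pi_sigma sigma (psi (of_xy c v))).

Lemma pi_sigma_embedE c v : chart_img c v -> Ts c v = Tsigma sigma (T c) v.
Proof.
move=> cv; have [_ h] := gr_embed_pi_sigma k_sigma l_sigma (psi_flag cv)
  (fun i => psi_hs i cv).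
exact: h.
Qed.

Lemma Tsigma_chart_smooth c : smooth_on (chart_img c) (Tsigma sigma (T c)).
Proof. by apply: smooth_on_sum; [exact: chart_img_open|exact: T_smooth]. Qed.

Lemma pi_sigma_smooth : gr_smooth_map ip Hp Hm d S (fun q => pi_sigma sigma (psi q)).
Proof.
move=> c; split.
- move=> v cv; exact: (pi_sigma_grassmannian ip_norm pol k_sigma l_sigma (psi_flag cv)).
- move=> v cv; have [h _] := gr_embed_pi_sigma k_sigma l_sigma (psi_flag cv)
    (fun i => psi_hs i cv); exact: h.
- apply: (smooth_on_ext _ (Tsigma_chart_smooth c)); first exact: chart_img_open.
  exact: pi_sigma_embedE.
Qed.

(** The embedding of the sum is known to equal [Tsigma] on the chart image only; since this image is
    open, the first and second derivatives agree there too, and [J2_laplacian_orth] applies. *)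
Lemma pi_sigma_laplacian c v (V : hs ip) : chart_img c v ->
  (forall x, V x = oproj ip (pi_sigma sigma (psi (of_xy c v))) (V x)
                 + V (oproj ip (pi_sigma sigma (psi (of_xy c v))) x)) ->
  hsip ('D_ex ('D_ex (Ts c)) v + 'D_ey ('D_ey (Ts c)) v) V = 0.
Proof.
move=> cv hV; have oO := chart_img_open (c := c).
have nE u : chart_img c u -> \forall w \near u, Tsigma sigma (T c) w = Ts c w.
  by move=> cu; apply: filterS (near_chart_img cu) => w cw; rewrite pi_sigma_embedE.
have sT := Tsigma_chart_smooth c.
have D1 e u : chart_img c u -> 'D_e (Ts c) u = 'D_e (Tsigma sigma (T c)) u.
  move=> cu; have h := is_derive_near (nE u cu) (smooth_on_is_derive e sT cu).
  exact: (@derive_val _ _ _ _ _ _ _ h).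
have D2 e : 'D_e ('D_e (Ts c)) v = 'D_e ('D_e (Tsigma sigma (T c))) v.
  have n1 : \forall w \near v, 'D_e (Tsigma sigma (T c)) w = 'D_e (Ts c) w.
    by apply: filterS (near_chart_img cv) => w cw; rewrite D1.
  have h := is_derive_near n1 (smooth_on_is_derive e (smooth_on_derive e sT) cv).
  exact: (@derive_val _ _ _ _ _ _ _ h).
have LE : 'D_ex ('D_ex (Ts c)) v + 'D_ey ('D_ey (Ts c)) v = laplacian_Tsigma sigma (T c) v.
  exact: (f_equal2 +%R (D2 ex) (D2 ey)).
apply: (etrans (congr1 (fun X => hsip X V) LE)); clear LE D1 D2 nE.
have psE : psigma sigma p = oproj ip Hp.
  by apply/funext => x; exact: (sum_flag_ref ip Hp Hm k_sigma l_sigma).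
have QE : proj_at (psigma sigma p) (Tsigma sigma (T c)) v =
    oproj ip (pi_sigma sigma (psi (of_xy c v))).
  rewrite psE; apply/funext => x; rewrite /proj_at -(pi_sigma_embedE cv).
  have [h _] := gr_embed_pi_sigma k_sigma l_sigma (psi_flag cv) (fun i => psi_hs i cv).
  by rewrite /Ts /gr_embed (to_hsE h) addrC subrK.
apply: (J2_laplacian_orth (p := p) (T := T c) oO flag_ref_proj _ _ _ _ _ _ cv).
- have -> : (fun x : H => \sum_(i in sigma) p i x) = oproj ip Hp by exact: psE.
  by case: (Hp_oproj pol).
- move=> i u cu; rewrite flag_proj_at//; have [[Ec Eo] Ed _ _ _] := psi_flag cu.
  exact: E_oproj.
- move=> i j u x cu ij; rewrite !flag_proj_at//; have [[Ec Eo] Ed _ _ _] := psi_flag cu.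
  exact: E_oproj_orth.
- move=> u x cu; under eq_bigr do rewrite flag_proj_at//.
  have [[Ec Eo] Ed _ _ _] := psi_flag cu; exact: E_oproj_sum.
- exact: T_smooth.
- by move=> i j u x cu ij; rewrite !flag_proj_at//; exact: flag_J2_eq.
- by rewrite QE.
Qed.

Lemma pi_sigma_harmonic : harmonic_map ip Hp Hm d S (fun q => pi_sigma sigma (psi q)).
Proof.
apply: (harmonic_of_laplacian pol pi_sigma_smooth) => c v V cv hV.
exact: pi_sigma_laplacian.
Qed.

End FlagMaps.

Theorem theorem3 (R : realType) (H : completeNormedModType R[i])
    (ip : {dot H for Num.conj})
    (ip_norm : forall x : H, ip x x = `|x| ^+ 2)
    (Hp Hm : set H) (pol : polarization ip Hp Hm)
    (n : nat) (r : 'I_n -> int) (k l : 'I_n) (lt_kl : (k < l)%N)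
    (r_gt0 : forall i, i != k -> i != l -> 0 < r i)
    (sigma : {set 'I_n}) (k_sigma : k \in sigma) (l_sigma : l \notin sigma) :
  let d := \sum_(i in sigma) r i in
  (forall E : 'I_n -> set H, flag ip Hp Hm r k l E ->
     grassmannian ip Hp Hm d (pi_sigma sigma E)) /\
  (forall (M : ptopologicalType) (S : riemann_surface R M)
     (psi : M -> 'I_n -> set H),
     J2_holomorphic ip Hp Hm r k l sigma S psi ->
     harmonic_map ip Hp Hm d S (fun p => pi_sigma sigma (psi p))).
Proof.
move=> d; split=> [E|M S psi]; first exact: pi_sigma_grassmannian.
exact: pi_sigma_harmonic.
Qed.
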